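(* Let $d\geqslant 1$ be an integer and let $A(X)=(a_{r,s}(X))_{r,s=1}^d\in\mathbb{Z}[X]^{d\times d}$ be a matrix of integer polynomials such that $a_{r,s}(0)=0$ for all $r,s=1,\ldots,d$, and such that for any non-zero vectors $\mathbf u,\mathbf v\in\mathbb{Z}^d$ the polynomial $\mathbf u^t A(X)\mathbf v$ is not the zero polynomial. Let $e$ be the largest degree of the polynomials $a_{r,s}(X)$ and let $H$ be the largest absolute value of their coefficients. Then, as $\varepsilon\to 0$, $$ k_{d,A}(\varepsilon)\leqslant c(d,e)\, H^{(3d+1)/2+o(1)}\,\varepsilon^{-d(2d+1)e-(7d+1)/2+o(1)}, $$ where $c(d,e)$ is a constant depending only on $d$ and $e$.
   Context: Let $\mathsf{T}_d=(\mathbb{R}/\mathbb{Z})^d$, identified with $[0,1)^d$, with the distance $\|\cdot\|$ induced by the Euclidean norm. For an integer matrix $B$, a set $B\mathcal X=\{B\mathbf x:\mathbf x\in\mathcal X\}\subseteq\mathsf{T}_d$ is called $\varepsilon$-dense if $\sup_{\boldsymbol\zeta\in\mathsf{T}_d}\inf_{\mathbf x\in\mathcal X}\|\boldsymbol\zeta-B\mathbf x\|\leqslant\varepsilon$. For $\varepsilon>0$, $k_{d,A}(\varepsilon)$ denotes the least integer $k$ such that for every set $\mathcal X\subseteq\mathsf{T}_d$ with $\#\mathcal X\geqslant k$ there exists $n\in\mathbb{N}$ for which $A(n)\mathcal X$ is $\varepsilon$-dense in $\mathsf{T}_d$. The notation $V^{o(1)}$ denotes a quantity bounded between $V^{-\delta}$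 and $V^{\delta}$ for any fixed $\delta>0$ in the indicated limit. *)

(* Defs.v *)
From HB Require Import structures.
From mathcomp Require Import all_boot all_order all_algebra.
From mathcomp Require Import all_classical all_reals all_analysis.

Set Implicit Arguments.
Unset Strict Implicit.
Unset Printing Implicit Defensive.

Import Order.TTheory GRing.Theory Num.Theory.

Local Open Scope classical_set_scope.
Local Open Scope ring_scope.

Section Torus.
Variables (R : realType) (d : nat).
Implicit Types (x y : 'cV[R]_d) (B : 'M[int]_d) (X : set 'cV[R]_d).

(* The torus (R/Z)^d is identified with [0,1)^d: a point is represented by its
   unique lift with coordinates in [0,1), so cardinalities of subsets of the
   torus are those of the sets of lifts. *)
Definition torus : set 'cV[R]_d := [set x | forall i, 0 <= x i 0 < 1].

Definition torus_proj x : 'cV[R]_d :=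
  map_mx (fun t : R => t - (Num.floor t)%:~R) x.

(* The library norm on matrices is the sup norm, not the Euclidean one. *)
Definition euclid_norm x : R := Num.sqrt (\sum_(i < d) x i 0 ^+ 2).

Definition torus_dist x y : R :=
  inf [set euclid_norm (x - y - map_mx intr z) | z in [set: 'cV[int]_d]].

Definition torus_act B x : 'cV[R]_d := torus_proj (map_mx intr B *m x).

(* The infimum and supremum are taken in the extended reals, so that
   for X = set0 the infimum is +oo and the image is not eps-dense. *)
Definition eps_dense_image (eps : R) B X : Prop :=
  (ereal_sup [set ereal_inf [set (torus_dist zeta (torus_act B x))%:E | x in X]
             | zeta in torus] <= eps%:E)%E.

End Torus.

Section PolyMatrix.
Variable d : nat.
Implicit Types (A : 'M[{poly int}]_d) (u v : 'cV[int]_d).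

Definition poly_mx_eval A (n : nat) : 'M[int]_d :=
  map_mx (fun p : {poly int} => p.[n%:Z]) A.

Definition poly_mx_form A u v : {poly int} :=
  ((map_mx polyC u)^T *m A *m map_mx polyC v) 0 0.

Definition poly_mx_deg A : nat :=
  (\max_(r < d) \max_(s < d) (size (A r s)).-1)%N.

Definition poly_mx_height A : nat :=
  (\max_(r < d) \max_(s < d) \max_(i < size (A r s)) absz ((A r s)`_i)%R)%N.

End PolyMatrix.

Definition glasner_bound (R : realType) (d : nat) (A : 'M[{poly int}]_d)
    (eps : R) (k : nat) : Prop :=
  forall X : set 'cV[R]_d, X `<=` @torus R d -> (`I_k #<= X)%card ->
    exists n : nat, (0 < n)%N /\ eps_dense_image eps (poly_mx_eval A n) X.

(* k = k_{d,A}(eps).  Natural numbers suffice: for k <= 0 the condition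
   #X >= k also allows X = set0, for which no image is eps-dense. *)
Definition is_glasner_number (R : realType) (d : nat) (A : 'M[{poly int}]_d)
    (eps : R) (k : nat) : Prop :=
  glasner_bound A eps k /\ forall j : nat, glasner_bound A eps j -> (k <= j)%N.

(* Main.v *)
Require Import Defs.
From HB Require Import structures.
From mathcomp Require Import all_boot all_order all_algebra.
From mathcomp Require Import all_classical all_reals all_analysis.
From mathcomp Require Import complex.
From mathcomp Require Import ring lra zify.

(** Suppose that no [A(n) X] is [eps]-dense, where [X] contains [k] points [x_j].
A trigonometric kernel concentrated on an [eps]-ball shows that, for every [n],
the sums [S_m(n) = \sum_j chi (m^t A(n) x_j)] over the nonzero frequencies [m]
of size [O(eps^(-1-))] are large in mean square. Averaging over [n], the mean of
[|S_m(n)|^2] splits into pairs [(i, j)]: a pair contributes nothing when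
[m^t A(X) (x_i - x_j)] has an irrational coefficient (Weyl), and at most
[q^(-1/deg + o(1))] when its coefficients have common denominator [q] (Hua's
bound on complete exponential sums, obtained from Mordell's argument modulo
primes, a lifting argument modulo prime powers, and the Chinese remainder
theorem). The pairs with denominator at most [Q] are few: congruence modulo [q]
gives equivalence relations whose classes have [O(q^d)] elements, and iterating
Cauchy-Schwarz on the weighted number of pairs gives
[k^(1 + o(1)) Q^(d + o(1))] of them. For [k] as large as in the statement the
upper bound contradicts the lower one; there is enough room to take [c = 1] and
to ignore the [delta] in the exponents. *)

Set Implicit Arguments.
Unset Strict Implicit.
Unset Printing Implicit Defensive.

Import Order.TTheory GRing.Theory Num.Theory.

Local Open Scope ring_scope.

(** * The additive character of the reals and its distance to 1 *)

Section Character.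
Variable R : realType.
Local Notation C := R[i].
Implicit Types (s t : R) (z w : C).

(** Origin of the exponents. A kernel of width [eps] takes [M] of order [eps^-1] frequencies per
    coordinate and costs a factor [B] of order [M^(2d)]. Pairs of denominator above [Q] are harmless
    once [B Q^(-1/e) <= 1], so [Q] is about [B^e]. The other pairs number about [k D Q^d], where [D]
    of order [(M H)^d] comes from the size of the congruence classes; they are harmless once
    [B D Q^d <= k]. This asks for [k] of order [H^d eps^-(2 d^2 e + 3 d)]. The exponents of the
    statement exceed these, by at least 2 for [1/eps], and that margin pays for all constants and
    small losses. The obstacle is uniformity in [A]: constants may depend on [d] and [e] only. Hence
    pairs are counted for abstract families of relations, and [H] enters through [D] alone. The
    speed of convergence of the means over [n], on the other hand, need not be uniform, since only
    finitely many phases occur for given points. *)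

Definition cmod z : R := ComplexField.Normc.normc z.

Lemma normr_cmod z : `|z| = (cmod z)%:C%C.
Proof. by rewrite normc_def; case: z. Qed.

Lemma cmod_ge0 z : 0 <= cmod z.
Proof. by case: z => a b; rewrite /cmod /= sqrtr_ge0. Qed.

Lemma cmodM z w : cmod (z * w) = cmod z * cmod w.
Proof. exact: ComplexField.Normc.normcM. Qed.

Lemma cmodD z w : cmod (z + w) <= cmod z + cmod w.
Proof. exact: le_normcD. Qed.

Lemma cmodN z : cmod (- z) = cmod z.
Proof. exact: normcN. Qed.

Lemma cmodB z w : cmod (z - w) <= cmod z + cmod w.
Proof. by rewrite (le_trans (cmodD _ _))// cmodN. Qed.

Lemma cmod0 : cmod 0 = 0.
Proof. exact: ComplexField.Normc.normc0. Qed.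

Lemma cmod1 : cmod 1 = 1.
Proof. exact: ComplexField.Normc.normc1. Qed.

Lemma cmod_eq0 z : cmod z = 0 -> z = 0.
Proof. exact: ComplexField.Normc.eq0_normc. Qed.

Lemma cmodX z n : cmod (z ^+ n) = cmod z ^+ n.
Proof. by elim: n => [|n IH]; rewrite ?cmod1// !exprS cmodM IH. Qed.

Lemma cmodC z : cmod (z^*)%C = cmod z.
Proof. by case: z => a b; rewrite /cmod /= sqrrN. Qed.

Lemma cmod_real r : cmod r%:C%C = `|r|.
Proof. by rewrite /cmod /= expr0n /= addr0 sqrtr_sqr. Qed.

Lemma cmod_nat n : cmod n%:R = n%:R.
Proof. by rewrite -(rmorph_nat (real_complex R)) cmod_real ger0_norm. Qed.

Lemma cmod_sum (I : Type) (r : seq I) (P : pred I) (F : I -> C) :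
  cmod (\sum_(i <- r | P i) F i) <= \sum_(i <- r | P i) cmod (F i).
Proof.
elim/big_ind2: _ => // [|x a y b ha hb]; first by rewrite cmod0.
exact: le_trans (cmodD _ _) (lerD ha hb).
Qed.

Lemma Re_le_cmod z : complex.Re z <= cmod z.
Proof.
case: z => a b; rewrite /cmod /=; apply: (le_trans (ler_norm _)).
by rewrite -sqrtr_sqr ler_wsqrtr// lerDl sqr_ge0.
Qed.

Lemma mulconjC z : z * (z^*)%C = (cmod z ^+ 2)%:C%C.
Proof.
case: z => a b; rewrite /cmod /= sqr_sqrtr ?addr_ge0 ?sqr_ge0//.
by apply/eqP; rewrite eq_complex /=; apply/andP; split; apply/eqP; ring.
Qed.

Definition chi t : C := (cos (t * (pi *+ 2)) +i* sin (t * (pi *+ 2)))%C.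

Lemma chiD s t : chi (s + t) = chi s * chi t.
Proof.
rewrite /chi mulrDl cosD sinD; apply/eqP; rewrite eq_complex /=.
by apply/andP; split; apply/eqP; ring.
Qed.

Lemma chi0 : chi 0 = 1.
Proof. by rewrite /chi mul0r cos0 sin0. Qed.

Lemma chiN t : chi (- t) = ((chi t)^*)%C.
Proof. by rewrite /chi mulNr cosN sinN. Qed.

Lemma cmod_chi t : cmod (chi t) = 1.
Proof. by rewrite /cmod /chi /= cos2Dsin2 sqrtr1. Qed.

Lemma chi_neq0 t : chi t != 0.
Proof. by apply/eqP => h; move: (cmod_chi t); rewrite h cmod0 => /eqP; rewrite eq_sym oner_eq0. Qed.

Lemma chi_nat n : chi n%:R = 1.
Proof.
elim: n => [|n IH]; first exact: chi0.
by rewrite -natr1 chiD IH mul1r /chi mul1r cos2pi sin2pi.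
Qed.

Lemma chi_int (z : int) : chi z%:~R = 1.
Proof.
case: z => n; first exact: chi_nat.
by rewrite NegzE rmorphN /= chiN chi_nat conjc1.
Qed.

Lemma chiDint t (z : int) : chi (t + z%:~R) = chi t.
Proof. by rewrite chiD chi_int mulr1. Qed.

Lemma chiMn t n : chi (n%:R * t) = chi t ^+ n.
Proof.
elim: n => [|n IH]; first by rewrite mul0r chi0.
by rewrite -natr1 mulrDl mul1r chiD IH exprSr.
Qed.

Lemma chi_sum (I : Type) (r : seq I) (P : pred I) (F : I -> R) :
  chi (\sum_(i <- r | P i) F i) = \prod_(i <- r | P i) chi (F i).
Proof. exact: (big_morph chi chiD chi0). Qed.

Lemma cmod1B_chiX t n : cmod (1 - chi t ^+ n) <= n%:R * cmod (1 - chi t).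
Proof.
elim: n => [|n IH]; first by rewrite expr0 subrr cmod0 mul0r.
have -> : 1 - chi t ^+ n.+1 = (1 - chi t ^+ n) + chi t ^+ n * (1 - chi t).
  by rewrite exprSr; ring.
rewrite (le_trans (cmodD _ _))// -natr1 mulrDl mul1r lerD//.
by rewrite cmodM cmodX cmod_chi expr1n mul1r.
Qed.

(** On this interval the cosine is nonpositive, so the real part of [1 - chi t] is already at least
    1. *)
Lemma cmod1B_chi_ge1 t : 1 / 4 <= t <= 1 / 2 -> 1 <= cmod (1 - chi t).
Proof.
move=> /andP[h1 h2].
have hpi := @pi_gt0 R.
have hc : cos (t * (pi *+ 2)) <= 0.
  have -> : t * (pi *+ 2) = t * (pi *+ 2) - pi / 2 + pi / 2 by ring.
  rewrite cosDpihalf oppr_le0 sin_ge0_pi//.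
  by rewrite -[pi *+ 2]mulr_natr; apply/andP; split; nra.
apply: le_trans (Re_le_cmod _); rewrite /= .
by rewrite lerDl oppr_ge0.
Qed.

(* Some multiple [n t] with [n <= 1 / (2 t)] lies in [1/4, 1/2], where [chi] is
   at distance at least 1 from 1; then telescope. *)
Lemma cmod1B_chi_ge t : 0 <= t <= 1 / 2 -> 2 * t <= cmod (1 - chi t).
Proof.
move=> /andP[h0 h2].
have [h4|h4] := leP (1 / 4) t.
  by apply: (le_trans _ (cmod1B_chi_ge1 _)); [lra | rewrite h4 h2].
have [->|t0] := eqVneq t 0; first by rewrite mulr0 cmod_ge0.
have {t0 h0}t0 : 0 < t by rewrite lt_def t0.
set n := Num.truncn (1 / (2 * t)).
have h2t : 0 < 2 * t by rewrite mulr_gt0.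
have hpos : 0 <= 1 / (2 * t) by rewrite divr_ge0// ltW.
have /andP[hn1 hn2] : n%:R <= 1 / (2 * t) < n.+1%:R by exact: truncn_itv.
rewrite ler_pdivlMr// in hn1; rewrite ltr_pdivrMr// -natr1 in hn2.
have /cmod1B_chi_ge1 : 1 / 4 <= n%:R * t <= 1 / 2 by apply/andP; split; nra.
rewrite chiMn => /le_trans /(_ (cmod1B_chiX _ _)) h.
have := cmod_ge0 (1 - chi t); set c := cmod _ in h *.
by nra.
Qed.

(** Reduction to the fractional part [u]; when [u > 1/2], complex conjugation replaces it by
    [1 - u]. *)
Lemma cmod1B_chi_dist t (eps : R) :
  (forall z : int, eps <= `|t - z%:~R|) -> 2 * eps <= cmod (1 - chi t).
Proof.
move=> h; set f := Num.floor t; set u := t - f%:~R.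
have /andP[hf1 hf2] : f%:~R <= t < (f + 1)%:~R by exact: floor_itv.
rewrite rmorphD /= in hf2.
have hu : 0 <= u < 1 by rewrite /u; apply/andP; split; lra.
have -> : chi t = chi u by rewrite -(chiDint u f) /u subrK.
have h1 := h f; have h2 := h (f + 1).
rewrite rmorphD /= opprD addrA -/u in h2.
case/andP: hu => hu1 hu2.
rewrite ger0_norm// -/u in h1.
rewrite ler0_norm in h2; last by lra.
have [hh|hh] := leP u (1 / 2).
  by apply: le_trans (cmod1B_chi_ge _); [lra | rewrite hu1 hh].
have -> : cmod (1 - chi u) = cmod (1 - chi (1 - u)).
  rewrite -cmodC [chi (1 - u)]chiD chiN (chi_nat 1) mul1r; congr cmod.
  by case: (chi u) => a b; apply/eqP; rewrite eq_complex /=; apply/andP; split; apply/eqP; ring.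
apply: le_trans (cmod1B_chi_ge _); lra.
Qed.

Lemma chi_eq1 t : chi t = 1 -> exists z : int, t = z%:~R.
Proof.
move=> h; apply: contrapT => hz.
set f := Num.floor t; set u := t - f%:~R.
have /andP[hf1 hf2] : f%:~R <= t < (f + 1)%:~R by exact: floor_itv.
rewrite rmorphD /= in hf2.
have hu : 0 < u.
  rewrite /u subr_gt0 lt_def hf1 andbT; apply/eqP => e; apply: hz; exists f; by rewrite e.
have hu1 : u < 1 by rewrite /u; lra.
have : 2 * Num.min u (1 - u) <= cmod (1 - chi t).
  apply: cmod1B_chi_dist => z.
  have [zf|zf] := leP z f.
    apply: (le_trans _ (ler_norm _)); rewrite ge_min; apply/orP; left.
    by rewrite /u lerD2l lerN2 ler_int.
  rewrite -normrN; apply: (le_trans _ (ler_norm _)); rewrite ge_min; apply/orP; right.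
  have : (f + 1)%:~R <= z%:~R :> R by rewrite ler_int; lia.
  by rewrite rmorphD /= /u => ?; lra.
rewrite h subrr cmod0; have : 0 < Num.min u (1 - u) by rewrite lt_min hu subr_gt0.
by lra.
Qed.

(** The geometric series, left in product form so that the ratio 1 needs no separate case. *)
Lemma cmod_chi_geom t n :
  cmod (\sum_(j < n) chi (j%:R * t)) * cmod (1 - chi t) <= 2.
Proof.
rewrite -cmodM mulrC.
rewrite (eq_bigr (fun j : 'I_n => chi t ^+ j)); last by move=> j _; rewrite chiMn.
have -> : (1 - chi t) * (\sum_(j < n) chi t ^+ j) = 1 - chi t ^+ n.
  by have := subrX1 (chi t) n => /(congr1 -%R); rewrite opprB -mulNr opprB.
by rewrite (le_trans (cmodB _ _))// cmod1 cmodX cmod_chi expr1n.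
Qed.

End Character.

Arguments chi {R} t : simpl never.

(** * Newton's identities: tuples with equal power sums *)

Lemma leq_exp2r_weak m n e : (m <= n)%N -> (m ^ e <= n ^ e)%N.
Proof. by case: e => // e h; rewrite leq_exp2r. Qed.

(* The generating identity [P'/P = - \sum_s p_(s+1) T^s] for
   [P = \prod_i (1 - x_i T)], truncated at order [n] so as to stay among
   polynomials. *)
Lemma deriv_prod_1BX (F : fieldType) (n : nat) (x : 'I_n -> F) (m : nat) :
  exists W : {poly F},
  (\prod_(i < n) (1 - x i *: 'X))^`() =
    - (\prod_(i < n) (1 - x i *: 'X)) *
        (\sum_(i < n) \sum_(s < m) x i ^+ s.+1 *: 'X^s) + 'X^m * W.
Proof.
have key (c : F) : (\sum_(s < m) c ^+ s.+1 *: 'X^s) * (1 - c *: 'X) =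
                   c%:P - (c ^+ m.+1)%:P * 'X^m.
  elim: m => [|m IH]; first by rewrite big_ord0 mul0r expr1 expr0 mulr1 subrr.
  rewrite big_ord_recr /= mulrDl IH -!mul_polyC [c ^+ m.+2]exprSr polyCM [X in _ = _ - _ * X]exprSr.
  by set a := (c ^+ _)%:P; ring.
elim: n x => [|n IH] x.
  by exists 0; rewrite !big_ord0 mulr0 mulr0 addr0 -[1]/(1%:P) derivC.
have [W hW] := IH (fun i => x (widen_ord (leqnSn n) i)).
rewrite !big_ord_recr /=.
move: hW; set P := \prod_(i < n) _; set G := \sum_(i < n) _ => hW.
set c := x ord_max.
exists (W * (1 - c *: 'X) - (c ^+ m.+1)%:P * P).
have d1 : (1 - c *: 'X)^`() = - c%:P.
  by rewrite derivB derivZ derivX -[in X in X - _]/(1%:P) derivC sub0r alg_polyC.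
rewrite derivM hW d1 [X in _ = X + _]mulrDr.
have -> : - (P * (1 - c *: 'X)) * (\sum_(s < m) c ^+ s.+1 *: 'X^s) =
   - P * ((\sum_(s < m) c ^+ s.+1 *: 'X^s) * (1 - c *: 'X)) by ring.
rewrite key; ring.
Qed.

(** Both products solve the same differential equation [P' = - P G] modulo ['X^n]. If they differed,
    the lowest nonzero coefficient of their difference, of index [r] with [0 < r <= n], would be
    killed by [r]. *)
Lemma power_sums_eq_prod (F : fieldType) (n : nat) (x y : 'I_n -> F) :
  (forall r, (0 < r <= n)%N -> r%:R != 0 :> F) ->
  (forall s : 'I_n, \sum_(i < n) x i ^+ s.+1 = \sum_(i < n) y i ^+ s.+1) ->
  \prod_(i < n) (1 - x i *: 'X) = \prod_(i < n) (1 - y i *: 'X) :> {poly F}.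
Proof.
move=> hchar hps.
have [W1 hW1] := deriv_prod_1BX x n; have [W2 hW2] := deriv_prod_1BX y n.
set P := \prod_(i < n) (1 - x i *: 'X) in hW1 *.
set Q := \prod_(i < n) (1 - y i *: 'X) in hW2 *.
have hG : \sum_(i < n) \sum_(s < n) x i ^+ s.+1 *: 'X^s =
          \sum_(i < n) \sum_(s < n) y i ^+ s.+1 *: 'X^s :> {poly F}.
  rewrite exchange_big /= [RHS]exchange_big /=; apply: eq_bigr => s _.
  by rewrite -!scaler_suml hps.
rewrite -hG in hW2; move: hW1 hW2; set G := \sum_(i < n) _ => hW1 hW2.
have size1 (z : 'I_n -> F) : (size (\prod_(i < n) (1 - z i *: 'X))%R <= n.+1)%N.
  have h : (size (\prod_(i < n) (1 - z i *: 'X))%R <= (\sum_(i < n) 1).+1)%N.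
    elim/big_rec2: _ => [|i p m _ ih]; first by rewrite size_poly1.
    apply: leq_trans (size_polyMleq _ _) _.
    have : (size (1 - z i *: 'X : {poly F})%R <= 2)%N.
      rewrite (leq_trans (size_polyD _ _))// geq_max size_poly1 size_polyN.
      by rewrite (leq_trans (size_scale_leq _ _))// size_polyX.
    move=> h; have := leq_add h ih; move: (size _ + size _)%N => k; lia.
  by rewrite sum1_card card_ord in h.
have c1 (z : 'I_n -> F) : (\prod_(i < n) (1 - z i *: 'X)).[0] = 1.
  rewrite horner_prod big1// => i _; by rewrite !hornerE ?mulr0 ?subr0.
set D := P - Q.
have hD : D^`() * Q - D * Q^`() = 'X^n * (W1 * Q - W2 * P).
  by rewrite /D derivB hW1 hW2; ring.
apply/eqP; rewrite -subr_eq0 -/D; apply/negPn/negP => D0.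
pose r := find (fun c => c != 0) D.
have hr : has (fun c => c != 0) D.
  apply/hasP; exists (lead_coef D); last by rewrite lead_coef_eq0.
  by rewrite /lead_coef mem_nth// prednK// size_poly_gt0.
have hr1 : D`_r != 0 by exact: (nth_find 0 hr).
have hr2 j : (j < r)%N -> D`_j = 0.
  by move=> /(before_find 0)/negbFE/eqP.
have hrs : (r < size D)%N by rewrite -has_find.
have hrn : (r <= n)%N.
  have : (size D <= n.+1)%N.
    by rewrite (leq_trans (size_polyD _ _))// size_polyN geq_max !size1.
  lia.
have r0 : (0 < r)%N.
  rewrite lt0n; apply/eqP => r0; move: hr1; rewrite r0 -horner_coef0 /D hornerD hornerN.
  by rewrite !c1 subrr eqxx.
(* On the left only [r] times the coefficient of index [r] of [D], times the constant term 1 of [Q],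
   survives; the right-hand side is divisible by ['X^n]. *)
have := congr1 (fun p : {poly F} => p`_r.-1) hD.
rewrite /= coefXnM; have -> : (r.-1 < n)%N by lia.
rewrite coefB !coefM big_ord_recr /= subnn big1 ?add0r; last first.
  move=> j _; rewrite coef_deriv hr2 ?mul0rn ?mul0r//; have := ltn_ord j; lia.
rewrite big1 ?subr0; last first.
  move=> j _; rewrite hr2 ?mul0r//; have := ltn_ord j; lia.
rewrite coef_deriv prednK// -horner_coef0 c1 mulr1 -mulr_natr => /eqP.
by rewrite mulf_eq0 (negPf hr1) /= (negPf (hchar r _))// r0.
Qed.

(** A nonzero [y i] makes the [y]-product vanish at its inverse, hence the [x]-product as well. The
    value 0 is added because a zero entry contributes the invisible factor 1. This weak form spares
    a count of permutations. *)
Lemma power_sums_mem (F : fieldType) (n : nat) (x y : 'I_n -> F) :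
  (forall r, (0 < r <= n)%N -> r%:R != 0 :> F) ->
  (forall s : 'I_n, \sum_(i < n) x i ^+ s.+1 = \sum_(i < n) y i ^+ s.+1) ->
  forall i, y i \in 0 :: [seq x j | j : 'I_n].
Proof.
move=> hchar hps i; rewrite inE; case: (eqVneq (y i) 0) => //= yi0.
have /(congr1 (fun p : {poly F} => p.[(y i)^-1])) := power_sums_eq_prod hchar hps.
rewrite /= !horner_prod => h.
have : \prod_(i0 < n) (1 - x i0 *: 'X).[(y i)^-1] = 0.
  rewrite h (bigD1 i)//= !hornerE divff// subrr mul0r//.
move/eqP; rewrite prodf_seq_eq0 => /hasP[j _ /=]; rewrite !hornerE subr_eq0 => /eqP hj.
apply/mapP; exists j; rewrite ?mem_enum//.
by rewrite -[LHS]mul1r hj mulfVK.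
Qed.

(** * Mordell's bound for complete sums modulo a prime *)

Section Mordell.
Variables (R : realType) (p : nat).
Hypothesis pp : prime p.
Local Notation C := R[i].

Definition psi (x : 'F_p) : C := chi ((x : nat)%:R / p%:R).

Let p_gt0 : (0 < p)%N. Proof. exact: prime_gt0. Qed.
Let pR0 : p%:R != 0 :> R. Proof. by rewrite pnatr_eq0 -lt0n. Qed.

Lemma psi_nat (n : nat) : psi n%:R = chi (n%:R / p%:R).
Proof.
rewrite /psi val_Fp_nat// [in RHS](divn_eq n p) natrD natrM mulrDl mulfK//.
by rewrite addrC (chiDint _ (n %/ p)%N%:Z).
Qed.

Lemma psiD x y : psi (x + y) = psi x * psi y.
Proof.
by rewrite -[x]natr_Zp -[y]natr_Zp -natrD !psi_nat natrD mulrDl chiD.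
Qed.

Lemma psi0 : psi 0 = 1.
Proof. by rewrite /psi mul0r chi0. Qed.

Lemma psiN x : psi (- x) = ((psi x)^*)%C.
Proof.
apply: (mulIf (chi_neq0 ((x : nat)%:R / p%:R))); rewrite -/(psi x) -psiD addNr psi0.
by rewrite mulrC mulconjC cmod_chi expr1n.
Qed.

Lemma psi_intr (z : int) : psi z%:~R = chi (z%:~R / p%:R).
Proof.
case: z => n; first exact: psi_nat.
by rewrite NegzE !rmorphN /= psiN psi_nat mulNr chiN.
Qed.

Lemma cmod_psi x : cmod (psi x) = 1.
Proof. exact: cmod_chi. Qed.

Lemma psi_sum (I : Type) (r : seq I) (P : pred I) (F : I -> 'F_p) :
  psi (\sum_(i <- r | P i) F i) = \prod_(i <- r | P i) psi (F i).
Proof. exact: (big_morph psi psiD psi0). Qed.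

Lemma psi_neq1 x : x != 0 -> psi x != 1.
Proof.
move=> x0; apply/eqP => /chi_eq1[z hz].
have hxp : ((x : nat) < p)%N by apply: leq_trans (ltn_ord x) _; rewrite (Fp_cast pp).
have h : (x : nat)%:R = z%:~R * p%:R :> R by rewrite -hz divfK.
have {}h : ((x : nat)%:Z = z * p%:Z)%R.
  by apply/eqP; rewrite -(eqr_int R) rmorphM; apply/eqP; exact: h.
have : (p %| x)%N by apply/dvdnP; exists `|z|%N; lia.
move/dvdn_leq; have : (0 < (x : nat))%N by rewrite lt0n.
lia.
Qed.

(** Shifting [a] by 1 multiplies the sum by [psi t], which differs from 1 unless [t = 0]. *)
Lemma psi_orthogonality t : \sum_(a : 'F_p) psi (a * t) = (p * (t == 0%R))%N%:R.
Proof.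
have [->|t0] := eqVneq t 0.
  under eq_bigr do rewrite mulr0 psi0.
  by rewrite sumr_const card_Fp// muln1.
rewrite muln0; set S := \sum_a _.
have : S = psi t * S.
  rewrite {1}/S (reindex_inj (addrI 1)) /= mulr_sumr; apply: eq_bigr => a _.
  by rewrite mulrDl mul1r psiD.
move/eqP; rewrite -subr_eq0 -{1}[S]mul1r -mulrBl mulf_eq0 subr_eq0 eq_sym.
by rewrite (negPf (psi_neq1 t0)) /= => /eqP.
Qed.

Variable e : nat.
Hypothesis ep : (e < p)%N.

Definition gsum (a : {ffun 'I_e -> 'F_p}) : C :=
  \sum_(x : 'F_p) psi (\sum_(s < e) a s * x ^+ s.+1).

(** Expanding the power [2 e] and summing over the coefficients [a] leaves [p ^ e] times the number
    of pairs of [e]-tuples with equal power sums of orders 1 to [e]. As [e < p], every [y i] is 0 or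
    some [x j], so each of the [p ^ e] tuples [x] has at most [e.+1 ^ e] partners. *)
Lemma gsum_moment :
  \sum_a cmod (gsum a) ^+ e.*2 <= (p ^ (e.*2) * e.+1 ^ e)%:R.
Proof.
pose t (x y : {ffun 'I_e -> 'F_p}) (s : 'I_e) :=
  \sum_(i < e) x i ^+ s.+1 - \sum_(i < e) y i ^+ s.+1.
have hG a : (cmod (gsum a) ^+ e.*2)%:C%C =
    \sum_(x : {ffun 'I_e -> 'F_p}) \sum_(y : {ffun 'I_e -> 'F_p})
       psi (\sum_(s < e) a s * t x y s).
  rewrite -mul2n exprM rmorphXn /= -mulconjC exprMn.
  have -> : gsum a ^+ e = \sum_(x : {ffun 'I_e -> 'F_p})
      psi (\sum_(s < e) a s * (\sum_(i < e) x i ^+ s.+1)).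
    rewrite -[in LHS](card_ord e) -prodr_const (bigA_distr_bigA (fun _ x => psi _)).
    apply: eq_bigr => x _; rewrite -psi_sum exchange_big /=; congr psi.
    by apply: eq_bigr => s _; rewrite mulr_sumr.
  have -> : ((gsum a)^*)%C ^+ e = \sum_(y : {ffun 'I_e -> 'F_p})
      psi (- \sum_(s < e) a s * (\sum_(i < e) y i ^+ s.+1)).
    rewrite -[in LHS](card_ord e) -prodr_const /gsum.
    rewrite (eq_bigr (fun i : 'I_e => \sum_(x : 'F_p) psi (- \sum_(s < e) a s * x ^+ s.+1))); last first.
      by move=> i _; rewrite rmorph_sum /=; apply: eq_bigr => x _; rewrite psiN.
    rewrite (bigA_distr_bigA (fun _ x => psi _)).
    apply: eq_bigr => x _; rewrite -psi_sum sumrN exchange_big /=; congr (psi (- _)).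
    by apply: eq_bigr => s _; rewrite mulr_sumr.
  rewrite mulr_suml; apply: eq_bigr => x _; rewrite mulr_sumr; apply: eq_bigr => y _.
  rewrite -psiD -sumrB; congr psi; apply: eq_bigr => s _.
  by rewrite /t mulrBr.
have hsum x y : \sum_(a : {ffun 'I_e -> 'F_p}) psi (\sum_(s < e) a s * t x y s) =
    (p ^ e * [forall s, t x y s == 0%R])%N%:R.
  under eq_bigr do rewrite psi_sum.
  rewrite -(bigA_distr_bigA (fun s a => psi (a * t x y s))) /=.
  under eq_bigr do rewrite psi_orthogonality.
  case: forallP => [h|h].
    rewrite muln1 natrX -[in RHS](card_ord e) -prodr_const; apply: eq_bigr => s _.
    by rewrite h muln1.
  have /existsP[s hs] : [exists s, t x y s != 0].
    by rewrite -negb_forall; apply/forallP.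
  by rewrite muln0 (bigD1 s)//= (negPf hs) muln0 mul0r.
rewrite -lecR rmorph_sum /=; under eq_bigr do rewrite hG.
rewrite exchange_big /=.
under eq_bigr => x _ do (rewrite exchange_big /=; under eq_bigr do rewrite hsum).
under eq_bigr do rewrite -natr_sum.
rewrite -natr_sum -(rmorph_nat (real_complex R)) lecR ler_nat.
under eq_bigr do rewrite -big_distrr /=.
rewrite -big_distrr /= -addnn expnD -mulnA leq_mul2l; apply/orP; right.
have -> : (p ^ e * e.+1 ^ e = \sum_(x : {ffun 'I_e -> 'F_p}) e.+1 ^ e)%N.
  by rewrite sum_nat_const card_ffun card_Fp// card_ord.
apply: leq_sum => x _.
pose A : {set 'F_p} := [set z in 0 :: [seq x j | j : 'I_e]].
have hA : (#|A| <= e.+1)%N.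
  by rewrite cardsE (leq_trans (card_size _))//= size_map size_enum_ord.
apply: (@leq_trans (#|A| ^ #|'I_e|)); last by rewrite card_ord; exact: leq_exp2r_weak.
rewrite -card_ffun_on -sum1_card big_mkcond [leqRHS]big_mkcond /=.
apply: leq_sum => y _; case: forallP => //= h.
rewrite ifT//; apply/ffun_onP => i; rewrite inE.
apply: (power_sums_mem (x := x)) => [r /andP[r0 rn]|s].
  by rewrite -(dvdn_pcharf (pchar_Fp pp)) gtnNdvd// (leq_ltn_trans rn).
by apply/eqP; rewrite -subr_eq0; exact: h.
Qed.

(* The affine substitutions [x |-> u x + v] preserve the modulus of the sum
   and give about [p ^ 2 / e] distinct coefficient vectors. *)
Lemma mordell_bound (f : {poly 'F_p}) : (2 < size f <= e.+1)%N ->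
  cmod (\sum_(x : 'F_p) psi f.[x]) ^+ e.*2 * (p * p.-1)%:R <=
    (e * (p ^ e.*2 * e.+1 ^ e))%:R.
Proof.
move=> /andP[hf1 hfe].
pose a (w : 'F_p * 'F_p) : {ffun 'I_e -> 'F_p} :=
  [ffun s : 'I_e => w.1 ^+ s.+1 * (f^`N(s.+1)).[w.2]].
pose S := \sum_(x : 'F_p) psi f.[x].
have ha w : w.1 != 0 -> cmod (gsum (a w)) = cmod S.
  case: w => u v /= u0.
  have hx x : \sum_(s < e) a (u, v) s * x ^+ s.+1 = f.[v + u * x] - f.[v].
    rewrite (@nderiv_taylor_wide _ e.+1)//; last exact: mulrC.
    rewrite big_ord_recl /= expr0 mulr1 nderivn0 addrC addKr.
    by apply: eq_bigr => s _; rewrite ffunE exprMn /bump /=; ring.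
  rewrite /gsum; under eq_bigr do rewrite hx psiD.
  rewrite -mulr_suml cmodM cmod_psi mulr1 /S.
  have hb : injective (fun x => v + u * x) by move=> x y /addrI /(mulfI u0).
  by rewrite [in RHS](reindex_inj hb).
pose B : {set 'F_p * 'F_p} := [set w | w.1 != 0].
have cB : #|B| = (p * p.-1)%N.
  have -> : B = finset.setX [set~ 0]%SET [set: 'F_p]%SET by apply/setP => -[u v]; rewrite !inE andbT.
  by rewrite cardsX cardsT cardsC1 card_Fp// mulnC.
(* At most [e] substitutions give the same vector. With [n.+1] the degree of [f], the coefficient of
   degree [n.+1] fixes [u ^+ n.+1]; once [u] is known, the coefficient of degree [n] is affine in
   [v], with nonzero slope since [n.+1 < p]. That coefficient is recorded by [a] only if [n > 0],
   hence the degree at least 2. *)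
have hfib b : (#|[set w in B | a w == b]| <= e)%N.
  set D := [set _ in B | _]; have [->|[w0 hw0]] := set_0Vmem D; first by rewrite cards0.
  have hw w : w \in D -> w.1 != 0 /\ a w = b by rewrite !inE => /andP[? /eqP].
  have [w00 aw0] := hw _ hw0.
  pose n := (size f).-2.
  have hn : size f = n.+2 by rewrite /n; case: (size f) hf1 => [|[|]].
  have n0 : (0 < n)%N by rewrite hn in hf1.
  have hne : (n < e)%N by move: hfe; rewrite hn.
  have lc0 : f`_n.+1 != 0.
    have : lead_coef f != 0 by rewrite lead_coef_eq0 -size_poly_gt0 hn.
    by rewrite /lead_coef hn.
  have hch : n.+1%:R != 0 :> 'F_p.
    by rewrite -(dvdn_pcharf (pchar_Fp pp)) gtnNdvd// (leq_ltn_trans hne).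
  have top v : (f^`N(n.+1)).[v] = f`_n.+1.
    rewrite horner_poly hn subSnn big_ord_recl big_ord0 /= expr0 mulr1 addr0.
    by rewrite addn0 binn mulr1n.
  have sub v : (f^`N(n)).[v] = f`_n + (f`_n.+1 *+ n.+1) * v.
    rewrite horner_poly hn; have -> : (n.+2 - n = 2)%N by lia.
    rewrite !big_ord_recl big_ord0 /= expr0 mulr1 addr0 /bump /= addn0 binn mulr1n expr1.
    by rewrite addn1 binSn.
  have hu w : w \in D -> w.1 ^+ n.+1 = w0.1 ^+ n.+1.
    move=> /hw[_ aw]; have /ffunP/(_ (Ordinal hne)) : a w = a w0 by rewrite aw aw0.
    by rewrite !ffunE /= !top => /(mulIf lc0).
  have hinj : {in D &, injective fst}.
    move=> [u v] [u' v'] hwD hwD' /= huu; rewrite -huu in hwD' *.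
    have [u0 aw] := hw _ hwD; have [_ aw'] := hw _ hwD'.
    rewrite /= in u0.
    congr (_, _).
    have hne' : (n.-1 < e)%N by rewrite (leq_ltn_trans (leq_pred _)).
    have /ffunP/(_ (Ordinal hne')) : a (u, v) = a (u, v') by rewrite aw aw'.
    rewrite !ffunE /= prednK// !sub => /(mulfI (expf_neq0 _ u0))/addrI.
    by apply: mulfI; rewrite -mulr_natr mulf_neq0.
  rewrite -(card_in_imset hinj).
  pose P : {poly 'F_p} := 'X^(n.+1) - (w0.1 ^+ n.+1)%:P.
  have sP : size P = n.+2 by rewrite size_XnsubC.
  have P0 : P != 0 by rewrite -size_poly_gt0 sP.
  have hr : all (root P) (enum [set w.1 | w in D]).
    apply/allP => u; rewrite mem_enum => /imsetP[w wD ->].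
    by rewrite /root !hornerE hu// subrr.
  have := max_poly_roots P0 hr (enum_uniq _).
  by rewrite sP -cardE => h; apply: leq_trans hne.
have h1 : \sum_(w in B) cmod (gsum (a w)) ^+ e.*2 = cmod S ^+ e.*2 * (p * p.-1)%:R.
  rewrite (eq_bigr (fun=> cmod S ^+ e.*2)); last by move=> w; rewrite inE => /ha ->.
  by rewrite sumr_const cB mulr_natr.
rewrite -h1 (partition_big a predT)//= natrM.
apply: (@le_trans _ _ (e%:R * \sum_a cmod (gsum a) ^+ e.*2)); last first.
  by rewrite ler_wpM2l// gsum_moment.
rewrite mulr_sumr; apply: ler_sum => b _.
rewrite (eq_bigr (fun=> cmod (gsum b) ^+ e.*2)); last by move=> w /andP[_ /eqP ->].
rewrite sumr_const -[_ *+ _]mulr_natl ler_wpM2r ?exprn_ge0 ?cmod_ge0// ler_nat.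
by rewrite -cardsE (leq_trans _ (hfib b))// subset_leq_card//; apply/fintype.subsetP => w; rewrite !inE.
Qed.

(** In degree 1 the sum vanishes by orthogonality. *)
Lemma mordell_bound_nonconst (f : {poly 'F_p}) : (1 < size f <= e.+1)%N ->
  cmod (\sum_(x : 'F_p) psi f.[x]) ^+ e.*2 * (p * p.-1)%:R <=
    (e * (p ^ e.*2 * e.+1 ^ e))%:R.
Proof.
move=> /andP[hf1 hfe]; move: (hf1); rewrite leq_eqVlt => /orP[/eqP hf2|hf2]; last first.
  by apply: mordell_bound; rewrite hf2.
have e0 : (0 < e)%N by rewrite -ltnS (leq_trans hf1).
have f1 : f`_1 != 0.
  have : lead_coef f != 0 by rewrite lead_coef_eq0 -size_poly_gt0 -hf2.
  by rewrite /lead_coef -hf2.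
have -> : \sum_(x : 'F_p) psi f.[x] = 0.
  transitivity (psi f`_0 * \sum_(x : 'F_p) psi (x * f`_1)).
    rewrite mulr_sumr; apply: eq_bigr => x _; rewrite -psiD horner_coef -hf2.
    by rewrite !big_ord_recl big_ord0 /= expr0 mulr1 addr0 /bump /= expr1 mulrC.
  by rewrite psi_orthogonality (negPf f1) muln0 mulr0.
by rewrite cmod0 expr0n double_eq0 (gtn_eqF e0) mul0r.
Qed.

End Mordell.

(** * Sums of periodic sequences *)

Section Periodic.
Variables (V : comNzRingType).
Implicit Types (u v : nat -> V).

Lemma sum_periodic_shift u q a : (forall n, u (n + q)%N = u n) ->
  \sum_(n < q) u (n + a)%N = \sum_(n < q) u n.
Proof.
move=> hu; elim: a => [|a IH]; first by under eq_bigr do rewrite addn0.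
rewrite -{}IH; case: q hu => [|q] hu; first by rewrite !big_ord0.
rewrite big_ord_recr /= [RHS]big_ord_recl /= add0n.
have -> : (q + a.+1 = a + q.+1)%N by lia.
rewrite hu addrC; congr (_ + _); apply: eq_bigr => i _.
by congr u; rewrite /bump /=; lia.
Qed.

Lemma sum_ord_mul u m k :
  \sum_(n < m * k) u n = \sum_(i < m) \sum_(j < k) u (i + m * j)%N.
Proof.
elim: k => [|k IH].
  by rewrite muln0 big_ord0 big1// => i _; rewrite big_ord0.
under [RHS]eq_bigr do rewrite big_ord_recr /=.
rewrite big_split /= -IH mulnS addnC big_split_ord /=; congr (_ + _).
by apply: eq_bigr => i _; rewrite addnC.
Qed.

Lemma periodic_mulr u q : (forall n, u (n + q)%N = u n) ->
  forall n j, u (n + q * j)%N = u n.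
Proof.
move=> hu n; elim=> [|j IH]; first by rewrite muln0 addn0.
by rewrite mulnS addnCA addnC hu.
Qed.

Lemma periodic_mod u q : (forall n, u (n + q)%N = u n) ->
  forall n, u (n %% q)%N = u n.
Proof.
by move=> hu n; rewrite [in RHS](divn_eq n q) addnC mulnC (periodic_mulr hu).
Qed.

Lemma sum_periodic_mul u q k : (forall n, u (n + q)%N = u n) ->
  \sum_(n < q * k) u n = (\sum_(n < q) u n) *+ k.
Proof.
move=> hu; rewrite sum_ord_mul -sumrMnl; apply: eq_bigr => i _.
under eq_bigr do rewrite (periodic_mulr hu).
by rewrite sumr_const card_ord.
Qed.

Lemma sum_periodic_affine u q a c : (forall n, u (n + q)%N = u n) ->
  (0 < q)%N -> coprime a q ->
  \sum_(n < q) u (c + a * n)%N = \sum_(n < q) u n.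
Proof.
move=> hu q0 aq.
pose f (n : 'I_q) : 'I_q := Ordinal (ltn_pmod (c + a * n) q0).
have fI : injective f.
  move=> m n /(congr1 val) /= /eqP; rewrite eqn_modDl.
  wlog le_mn : m n / (m <= n)%N.
    move=> H; have [/H//|/ltnW/H h] := leqP m n.
    by rewrite eq_sym => /h ->.
  rewrite eq_sym eqn_mod_dvd ?leq_mul2l ?le_mn ?orbT// -mulnBr.
  rewrite Gauss_dvdr 1?coprime_sym// => h.
  apply: val_inj => /=; have := ltn_ord n.
  have [|h0] := posnP (n - m); first lia.
  by have := dvdn_leq h0 h; lia.
rewrite [RHS](reindex_inj fI) /=; apply: eq_bigr => n _.
by rewrite (periodic_mod hu).
Qed.

(** Chinese remainder theorem: for [n = i + q1 j] the factor [u] sees only [i], while for fixed [i]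
    the map from [j] to [i + q1 j] permutes the residues modulo [q2]. *)
Lemma sum_periodic_coprime u v q1 q2 :
  (forall n, u (n + q1)%N = u n) -> (forall n, v (n + q2)%N = v n) ->
  (0 < q2)%N -> coprime q1 q2 ->
  \sum_(n < q1 * q2) u n * v n = (\sum_(n < q1) u n) * (\sum_(n < q2) v n).
Proof.
move=> hu hv q20 hq; rewrite (sum_ord_mul (fun n => u n * v n)) mulr_suml; apply: eq_bigr => i _.
under eq_bigr do rewrite (periodic_mulr hu).
by rewrite -mulr_sumr (sum_periodic_affine i hv q20 hq).
Qed.

End Periodic.

Lemma dvdz_hornerB (f : {poly int}) (x y : int) : (x - y %| f.[x] - f.[y])%Z.
Proof.
elim/poly_ind: f => [|f c IH]; first by rewrite !hornerE.
rewrite !hornerE.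
have -> : f.[x] * x + c - (f.[y] * y + c) = f.[x] * (x - y) + (f.[x] - f.[y]) * y by ring.
by apply: rpredD; [exact: dvdz_mull (dvdzz _) | exact: dvdz_mulr].
Qed.

Lemma horner_taylor2 (f : {poly int}) (x h : int) :
  exists z : int, f.[x + h] = f.[x] + f^`().[x] * h + z * h ^+ 2.
Proof.
elim/poly_ind: f => [|f c [z IH]]; first by exists 0; rewrite linear0 !hornerE.
exists (f^`().[x] + z * (x + h)).
by rewrite derivMXaddC !hornerMXaddC hornerD hornerMX IH; ring.
Qed.

(** * Complete exponential sums and their multiplicativity *)

Section ExpSum.
Variable R : realType.
Local Notation C := R[i].

Definition expsum (q : nat) (f : {poly int}) : C :=
  \sum_(n < q) chi ((f.[n%:Z])%:~R / q%:R).

Lemma chi_divq_periodic (q : nat) (x y : int) : (0 < q)%N -> (q%:Z %| x - y)%Z ->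
  chi (x%:~R / q%:R) = chi (y%:~R / q%:R) :> C.
Proof.
move=> q0 /dvdzP[z hz].
have -> : x = y + z * q%:Z by rewrite -hz addrC subrK.
rewrite rmorphD rmorphM /= mulrDl mulfK ?chiDint//.
by rewrite pnatr_eq0 -lt0n.
Qed.

Lemma chi_poly_periodic (q : nat) (f : {poly int}) n : (0 < q)%N ->
  chi ((f.[(n + q)%N%:Z])%:~R / q%:R) = chi ((f.[n%:Z])%:~R / q%:R) :> C.
Proof.
move=> q0; apply: chi_divq_periodic => //.
by have := dvdz_hornerB f (n + q)%N%:Z n%:Z; rewrite PoszD addrAC subrr add0r.
Qed.

Lemma cmod_expsum_le (q : nat) f : cmod (expsum q f) <= q%:R.
Proof.
rewrite (le_trans (cmod_sum _ _ _))// (eq_bigr (fun=> 1)) => [|i _]; last exact: cmod_chi.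
by rewrite sumr_const card_ord.
Qed.

(** Partial fractions: [u q1 + v q2 = 1] gives [1/(q1 q2) = v/q1 + u/q2], which splits the phase.
    The multipliers are units, so they keep a polynomial nonconstant modulo the primes dividing [q1]
    and [q2] respectively. *)
Lemma expsum_mul q1 q2 (f : {poly int}) : (0 < q1)%N -> (0 < q2)%N -> coprime q1 q2 ->
  exists a b : int, [/\ coprimez a q1, coprimez b q2 &
    expsum (q1 * q2) f = expsum q1 (a *: f) * expsum q2 (b *: f)].
Proof.
move=> q10 q20 hq.
have [u [v huv]] : exists u v : int, u * q1%:Z + v * q2%:Z = 1.
  by have [u [v h]] := Bezoutz q1 q2; exists u, v; rewrite h /gcdz /= (eqP hq).
exists v, u; split.
- by apply/coprimezP; exists (q2%:Z, u) => /=; rewrite -huv; ring.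
- by apply/coprimezP; exists (q1%:Z, v) => /=; rewrite -huv; ring.
have q1R : q1%:R != 0 :> R by rewrite pnatr_eq0 -lt0n.
have q2R : q2%:R != 0 :> R by rewrite pnatr_eq0 -lt0n.
rewrite /expsum -(sum_periodic_coprime (u := fun n => chi (((v *: f).[n%:Z])%:~R / q1%:R))
   (v := fun n => chi (((u *: f).[n%:Z])%:~R / q2%:R))) //; last 2 first.
- by move=> n; exact: chi_poly_periodic.
- by move=> n; exact: chi_poly_periodic.
apply: eq_bigr => n _; rewrite -chiD !hornerZ !rmorphM /= ?natrM.
have h1 : u%:~R * q1%:R + v%:~R * q2%:R = 1 :> R.
  by have /(congr1 (fun z : int => z%:~R : R)) := huv; rewrite rmorphD !rmorphM.
congr chi; set F := _.[_]%:~R.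
have -> : v%:~R * F / q1%:R + u%:~R * F / q2%:R =
          F / (q1%:R * q2%:R) * (u%:~R * q1%:R + v%:~R * q2%:R).
  by field; rewrite q1R q2R.
by rewrite h1 mulr1.
Qed.

End ExpSum.

(** * Hua's bound modulo prime powers *)

Section PrimePower.
Variables (R : realType) (p : nat).
Hypothesis pp : prime p.
Local Notation C := R[i].

Definition redp (f : {poly int}) : {poly 'F_p} := map_poly intr f.

Let p_gt0 : (0 < p)%N. Proof. exact: prime_gt0. Qed.

Lemma pexpz i : (p ^ i)%:Z = p%:Z ^+ i.
Proof. by elim: i => // i IH; rewrite expnS exprS PoszM IH. Qed.

Lemma dvdz_Fp (z : int) : (p%:Z %| z)%Z = (z%:~R == 0 :> 'F_p).
Proof. exact: (dvdz_pcharf (pchar_Fp pp)). Qed.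

Lemma redp_coef f i : (redp f)`_i = (f`_i)%:~R.
Proof. exact: coef_map. Qed.

Lemma redp_horner f (x : int) : (redp f).[x%:~R] = (f.[x])%:~R.
Proof. exact: horner_map. Qed.

Lemma redp_comp f g : redp (f \Po g) = redp f \Po redp g.
Proof. exact: map_comp_poly. Qed.

Lemma size_redp f : (size (redp f) <= size f)%N.
Proof. exact: size_poly. Qed.

(** Extraction of the [p]-part of the content; it terminates because each division by [p] decreases
    the absolute value of the leading coefficient. *)
Lemma poly_content (h : {poly int}) : h != 0 ->
  exists nu G, h = (p ^ nu)%:Z *: G /\ redp G != 0.
Proof.
have [n] := ubnP (absz (lead_coef h)); elim: n h => // n IH h hn h0.
have [hr|hr] := eqVneq (redp h) 0; last by exists 0%N, h; rewrite scale1r.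
pose h' := \poly_(i < size h) (h`_i %/ p%:Z)%Z.
have hh : h = p%:Z *: h'.
  apply/polyP => i; rewrite coefZ coef_poly; case: ltnP => hi; last first.
    by rewrite mulr0 nth_default.
  rewrite mulrC divzK// dvdz_Fp -redp_coef hr coef0//.
have h'0 : h' != 0 by apply: contraNneq h0 => h0; rewrite hh h0 scaler0.
have [|nu [G [hG G0]]] := IH h' _ h'0.
  move: hn; rewrite {1}hh lead_coefZ abszM /=.
  have : (0 < absz (lead_coef h'))%N by rewrite absz_gt0 lead_coef_eq0.
  have := prime_gt1 pp; move: (absz _) => a; nia.
by exists nu.+1, G; rewrite hh hG scalerA expnS PoszM.
Qed.

Lemma dvd_pexpz (m n : nat) (u v : int) :
  (p ^ m)%:Z * u = (p ^ n)%:Z * v -> ~~ (p%:Z %| v)%Z -> (m <= n)%N.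
Proof.
move=> /(congr1 absz); rewrite !abszM /= => h hv.
have : (p ^ m %| p ^ n * `|v|)%N by rewrite -h dvdn_mulr.
rewrite Gauss_dvdl; first by rewrite dvdn_Pexp2l// prime_gt1.
by rewrite coprimeXl// prime_coprime.
Qed.

Lemma coef_comp_scaleX (f : {poly int}) (a : int) i :
  (f \Po (a *: 'X))`_i = a ^+ i * f`_i.
Proof.
rewrite comp_polyE coef_sum; under eq_bigr do rewrite exprZn scalerA coefZ coefXn.
have [hi|hi] := ltnP i (size f).
  rewrite (bigD1 (Ordinal hi))//= eqxx mulr1 big1 ?addr0 1?mulrC// => j hj.
  by case: eqP => [h|]; rewrite ?mulr0//; case/eqP: hj; apply: val_inj.
rewrite (nth_default _ hi) mulr0 big1// => j _; rewrite gtn_eqF ?mulr0//.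
by apply: leq_trans (ltn_ord j) hi.
Qed.

Definition aff (x : int) : {poly int} := p%:Z *: 'X + x%:P.

Lemma comp_affE f x : f \Po aff x = (f \Po ('X + x%:P)) \Po (p%:Z *: 'X).
Proof. by rewrite -comp_polyA comp_polyD comp_polyX comp_polyC. Qed.

Lemma coef_comp_aff f x i :
  (f \Po aff x)`_i = (p ^ i)%:Z * (f \Po ('X + x%:P))`_i.
Proof. by rewrite comp_affE coef_comp_scaleX pexpz. Qed.

Lemma horner_comp_aff f x y : (f \Po aff x).[y] = f.[x + p%:Z * y].
Proof. by rewrite horner_comp !hornerE addrC. Qed.

Lemma redp_shift f x : redp (f \Po ('X + x%:P)) = redp f \Po ('X + (x%:~R)%:P).
Proof. by rewrite redp_comp /redp rmorphD /= map_polyX map_polyC. Qed.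

Lemma sum_mup_le (Q : {poly 'F_p}) : Q != 0 ->
  (\sum_(x : 'F_p) mup x Q <= (size Q).-1)%N.
Proof.
have [n] := ubnP (size Q); elim: n Q => // n IH Q hn Q0.
have [/existsP[x hx]|] := boolP [exists x, root Q x]; last first.
  by rewrite negb_exists => /forallP h; rewrite big1// => x _; rewrite mupNroot.
have /factor_theorem[Q' hQ] := hx.
have Q'0 : Q' != 0 by apply: contraNneq Q0 => h; rewrite hQ h mul0r.
have sQ : size Q = (size Q').+1 by rewrite hQ size_Mmonic ?monicXsubC// size_XsubC addn2.
have hX0 : 'X - x%:P != 0 :> {poly 'F_p} by rewrite polyXsubC_eq0.
have hm y : mup y Q = (mup y Q' + (if x == y then 1 else 0))%N.
  by rewrite {1}hQ mupM// -['X - _]expr1 mup_XsubCX.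
under eq_bigr do rewrite hm.
rewrite big_split /= -big_mkcond /=.
have -> : (\sum_(i : 'F_p | x == i) 1 = 1)%N by rewrite (big_pred1 x)// => i; rewrite eq_sym.
have := IH Q' _ Q'0; rewrite sQ /=; have : (0 < size Q')%N by rewrite size_poly_gt0.
move: hn; rewrite sQ; move: (\sum_(x : 'F_p) mup x Q')%N => k hn hs h.
have {}h : (k <= (size Q').-1)%N by apply: h.
by rewrite addn1; apply: leq_ltn_trans h _; rewrite prednK.
Qed.

Lemma mup_coef_shift (Q : {poly 'F_p}) x : Q != 0 ->
  (Q \Po ('X + x%:P))`_(mup x Q) != 0.
Proof.
move=> Q0; set m := mup x Q.
have /dvdpP[q hq] : ('X - x%:P) ^+ m %| Q by rewrite -mup_geq.
have hqx : q.[x] != 0.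
  apply/negP => /factor_theorem[q' hq'].
  have : ('X - x%:P) ^+ m.+1 %| Q by rewrite hq hq' -mulrA -exprS dvdp_mull.
  by rewrite -mup_geq// ltnn.
have hX : (('X - x%:P) ^+ m) \Po ('X + x%:P) = 'X^m.
  by rewrite rmorphXn /= comp_polyB comp_polyX comp_polyC addrK.
rewrite {1}hq comp_polyM hX coefMXn ltnn subnn -horner_coef0 horner_comp.
by rewrite !hornerE ?add0r.
Qed.

Variable e : nat.
Hypothesis e0 : (0 < e)%N.

(** With [j] the degree of [f] modulo [p], the power [p ^ tau] divides [j] times the coefficient of
    index [j]; that coefficient is prime to [p], so [p ^ tau] divides [j], and [j <= e]. *)
Lemma pexp_content_le (f F : {poly int}) tau : (size f <= e.+1)%N ->
  (1 < size (redp f))%N -> f^`() = (p ^ tau)%:Z *: F -> (p ^ tau <= e)%N.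
Proof.
move=> hs hf hF; pose j := (size (redp f)).-1.
have hj : (redp f)`_j != 0 by rewrite -/(lead_coef _) lead_coef_eq0 -size_poly_gt0 ltnW.
have j0 : (0 < j)%N by rewrite /j; lia.
have je : (j <= e)%N.
  by have := leq_trans (size_redp f) hs; rewrite /j; lia.
have := congr1 (fun g : {poly int} => g`_j.-1) hF.
rewrite /= coef_deriv prednK// coefZ -mulr_natr => h.
have : (p ^ tau %| absz (f`_j)%R * j)%N.
  have -> : (absz (f`_j)%R * j)%N = absz (f`_j * j%:R) by rewrite abszM natz.
  by rewrite h abszM dvdn_mulr.
rewrite Gauss_dvdr; last first.
  rewrite coprimeXl// prime_coprime// -[(_ %| _)%N]/(p%:Z %| f`_j)%Z dvdz_Fp.
  by rewrite -redp_coef.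
by move/dvdn_leq => /(_ j0) h2; apply: leq_trans h2 je.
Qed.

(** Shift the argument by [p ^ h] with [h = l - tau - 1]. In the Taylor expansion the quadratic term
    disappears since [2 h >= l], and the linear one is [p ^ l.-1 * F.[x]] modulo [p ^ l]. The sum is
    thus multiplied by [chi (F.[x] / p)], which is not 1. *)
Lemma sum_nonroot_class (f F : {poly int}) tau l (x : nat) :
  f^`() = (p ^ tau)%:Z *: F -> ~~ (p%:Z %| F.[x%:Z])%Z -> (tau.*2.+2 <= l)%N ->
  \sum_(y < p ^ l.-1) chi ((f.[(x + p * y)%N%:Z])%:~R / (p ^ l)%:R) = 0 :> C.
Proof.
move=> hF hx hl.
have pl0 : (0 < p ^ l)%N by rewrite expn_gt0 p_gt0.
pose h := (l - tau.+1)%N.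
pose u (y : nat) : C := chi ((f.[(x + p * y)%N%:Z])%:~R / (p ^ l)%:R).
have hu n : u (n + p ^ l.-1)%N = u n.
  apply: chi_divq_periodic => //.
  have := dvdz_hornerB f (x + p * (n + p ^ l.-1))%N%:Z (x + p * n)%N%:Z.
  apply: dvdz_trans.
  rewrite mulnDr -expnS prednK ?addnA; last lia.
  by rewrite [(_ + p ^ l)%N%:Z]PoszD addrAC subrr add0r.
have hshift n : u (n + p ^ h.-1)%N = chi ((F.[x%:Z])%:~R / p%:R) * u n.
  have -> : u (n + p ^ h.-1)%N =
     chi ((f.[(x + p * n)%N%:Z] + (p ^ l.-1)%:Z * F.[x%:Z])%:~R / (p ^ l)%:R).
    apply: chi_divq_periodic => //.
    rewrite mulnDr -expnS prednK ?addnA; last by rewrite /h; lia.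
    rewrite PoszD; set X := (x + p * n)%N%:Z.
    have [z ->] := horner_taylor2 f X (p ^ h)%:Z.
    rewrite hF hornerZ.
    have [w hw] : exists w, F.[X] = F.[x%:Z] + p%:Z * w.
      have := dvdz_hornerB F X x%:Z; rewrite /X PoszD addrAC subrr add0r PoszM => hd.
      have /dvdzP[w hw] : (p%:Z %| F.[x%:Z + p%:Z * n%:Z] - F.[x%:Z])%Z.
        by apply: dvdz_trans hd; rewrite dvdz_mulr.
      by exists w; rewrite [p%:Z * w]mulrC -hw [RHS]addrC subrK.
    rewrite hw.
    have hpow : (p ^ tau)%:Z * (p ^ h)%:Z = (p ^ l.-1)%:Z.
      by rewrite -PoszM -expnD; congr ((p ^ _)%:Z); rewrite /h; lia.
    have hpl : (p ^ l.-1)%:Z * p%:Z = (p ^ l)%:Z.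
      by rewrite -PoszM mulnC -expnS prednK//; lia.
    have hp2 : (p ^ h)%:Z ^+ 2 = (p ^ l)%:Z * (p ^ (h + h - l))%:Z.
      by rewrite expr2 -!PoszM -!expnD subnKC// /h; lia.
    have -> : f.[X] + (p ^ tau)%:Z * (F.[x%:Z] + p%:Z * w) * (p ^ h)%:Z
      + z * (p ^ h)%:Z ^+ 2 - (f.[X] + (p ^ l.-1)%:Z * F.[x%:Z])
      = (p ^ l)%:Z * (w + z * (p ^ (h + h - l))%:Z).
      by rewrite hp2 -hpl -hpow; ring.
    by rewrite dvdz_mulr.
  rewrite /u -chiD rmorphD rmorphM /= mulrDl addrC; congr (chi (_ + _)).
  have -> : (p ^ l)%:R = (p ^ l.-1)%:R * p%:R :> R.
    by rewrite -natrM mulnC -expnS prednK//; lia.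
  rewrite -pmulrn; field.
  by rewrite !pnatr_eq0 -!lt0n expn_gt0 p_gt0.
have : \sum_(y < p ^ l.-1) u (y + p ^ h.-1)%N = \sum_(y < p ^ l.-1) u y.
  exact: sum_periodic_shift.
under eq_bigr do rewrite hshift.
rewrite -mulr_sumr => /eqP; rewrite -subr_eq0 -{2}[\sum_(y < _) _]mul1r -mulrBl mulf_eq0.
case/orP; last by move/eqP.
rewrite subr_eq0 => /eqP/chi_eq1[z hz]; exfalso; move/negP: hx; apply.
apply/dvdzP; exists z.
have : F.[x%:Z]%:~R = (z * p%:Z)%:~R :> R.
  by rewrite rmorphM /= -hz divfK// pnatr_eq0 -lt0n.
by move/eqP; rewrite eqr_int => /eqP.
Qed.

(** The lifting step, applied at a root [x] of [F] modulo [p]: on its class [f] is a constant plus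
    [p ^ sigma] times a polynomial [g] again nonconstant modulo [p]. The degree bound on [G] is the
    key: the branches issued from a root are charged to its multiplicity, so their number does not
    grow with the depth. *)
Lemma root_class_reduction (f F : {poly int}) tau (x : nat) :
  (size f <= e.+1)%N -> (1 < size (redp f))%N ->
  f^`() = (p ^ tau)%:Z *: F -> redp F != 0 ->
  exists sigma tau' (g G : {poly int}),
    [/\ (0 < sigma <= e)%N,
       forall y : int, f.[x%:Z + p%:Z * y] = f.[x%:Z] + (p ^ sigma)%:Z * g.[y],
       (size g <= e.+1)%N /\ (1 < size (redp g))%N &
       [/\ g^`() = (p ^ tau')%:Z *: G, redp G != 0 &
           (size (redp G) <= (mup (x%:~R : 'F_p) (redp F)).+1)%N]].
Proof.
move=> hs hf hF F0; set mu := mup _ _.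
pose c := f \Po ('X + (x%:Z)%:P); pose phi := F \Po ('X + (x%:Z)%:P).
pose h := f \Po aff x - (f.[x%:Z])%:P.
have hcoef i : h`_i.+1 = (p ^ i.+1)%:Z * c`_i.+1.
  by rewrite coefB coefC subr0 coef_comp_aff.
have h0 : h`_0 = 0.
  rewrite coefB coefC /= -horner_coef0 horner_comp_aff mulr0 addr0 subrr//.
have size_shift (Q : {poly 'F_p}) (a : 'F_p) : size (Q \Po ('X + a%:P)) = size Q.
  by rewrite size_comp_poly2// size_XaddC.
pose j := (size (redp f)).-1.
have hj : ~~ (p%:Z %| c`_j)%Z.
  rewrite dvdz_Fp -redp_coef redp_shift.
  rewrite /j -(size_shift _ (x%:Z)%:~R) -/(lead_coef _) lead_coef_eq0.
  by rewrite -size_poly_gt0 size_shift ltnW.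
have j0 : (0 < j)%N by rewrite /j -ltnS prednK ?(ltnW hf).
have je : (j <= e)%N.
  by rewrite /j -ltnS prednK ?(ltnW hf)// (leq_trans (size_redp f)).
have hn0 : h != 0.
  apply: contraNneq hj => hz; have := hcoef j.-1; rewrite hz coef0 prednK// => /esym/eqP.
  by rewrite mulf_eq0 -[_ == 0 :> int]/(_ == 0)%N expn_eq0 (gtn_eqF p_gt0) /= => /eqP ->; rewrite dvdz0.
have [sigma [g [hg g0]]] := poly_content hn0.
have psg0 k : (p ^ k)%:Z != 0 by rewrite -[_ == 0 :> int]/(_ == 0)%N expn_eq0 (gtn_eqF p_gt0).
have sg0 : (0 < sigma)%N.
  rewrite lt0n; apply: contraNneq g0 => s0; apply/eqP/polyP => i; rewrite coef0.
  rewrite redp_coef; apply/eqP; rewrite -dvdz_Fp.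
  have -> : g = h by rewrite hg s0 scale1r.
  by case: i => [|i]; rewrite ?h0 ?dvdz0// hcoef expnS PoszM -mulrA dvdz_mulr.
(* The coefficient of index [j] of [h] has [p]-valuation exactly [j], because that of [c] is prime
   to [p]. *)
have sge : (sigma <= e)%N.
  apply: leq_trans je; apply: (@dvd_pexpz _ _ g`_j c`_j) => //.
  by rewrite -coefZ -hg -[in LHS](prednK j0) hcoef prednK.
have g00 : g`_0 = 0.
  have /eqP := h0; rewrite hg coefZ mulf_eq0 (negPf (psg0 _)) /= => /eqP//.
have hgs : (1 < size (redp g))%N.
  rewrite ltnNge; apply: contra g0 => /size1_polyC ->.
  by rewrite redp_coef g00.
have hsg : (size g <= e.+1)%N.
  have -> : size g = size h by rewrite hg size_scale.
  apply: leq_trans (size_polyD _ _) _; rewrite geq_max size_polyN (leq_trans (size_polyC_leq1 _))// andbT.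
  have := size_comp_poly_leq f (aff x); move/leq_trans; apply.
  have : (size (aff x) <= 2)%N.
    apply: leq_trans (size_polyD _ _) _; rewrite geq_max (leq_trans (size_scale_leq _ _)) ?size_polyX//.
    by rewrite (leq_trans (size_polyC_leq1 _)).
  by move: hs; move: (size f) (size (aff x)) => a b; nia.
have phimu : ~~ (p%:Z %| phi`_mu)%Z.
  by rewrite dvdz_Fp -redp_coef redp_shift mup_coef_shift.
have hFa i : (F \Po aff x)`_i = (p ^ i)%:Z * phi`_i by exact: coef_comp_aff.
have Fa0 : F \Po aff x != 0.
  apply: contraNneq phimu => hz; have := hFa mu; rewrite hz coef0 => /esym/eqP.
  by rewrite mulf_eq0 (negPf (psg0 _)) /= => /eqP ->; rewrite dvdz0.
have [nu [G [hG G0]]] := poly_content Fa0.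
have hGi i : (p ^ nu)%:Z * G`_i = (p ^ i)%:Z * phi`_i by rewrite -hFa hG coefZ.
(* The Taylor coefficient of [F] at [x] of index [mu] is prime to [p]. Beyond [mu], the coefficients
   of [F \Po aff x] keep a factor [p] after division by [p ^ nu], which bounds the degree of
   [redp G]. *)
have numu : (nu <= mu)%N by exact: dvd_pexpz (hGi mu) phimu.
have hder : (p ^ sigma)%:Z *: g^`() = (p ^ (tau.+1 + nu))%:Z *: G.
  rewrite -derivZ -hg /h derivB derivC subr0 deriv_comp hF comp_polyZ hG.
  rewrite /aff derivD derivC addr0 derivZ derivX.
  rewrite scalerA -scalerAl -scalerAr mulr1 scalerA -!PoszM.
  by rewrite -mulnA -expnSr -expnD addSnnS addnC.
have hst : (sigma <= tau.+1 + nu)%N.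
  have hi : (redp G)`_(size (redp G)).-1 != 0 by rewrite -/(lead_coef _) lead_coef_eq0.
  apply: (@dvd_pexpz _ _ (g^`())`_(size (redp G)).-1 G`_(size (redp G)).-1).
    by rewrite -!coefZ hder.
  by rewrite dvdz_Fp -redp_coef.
(* The exponent comes from the chain rule [hder]; the subtraction is exact by [hst]. *)
exists sigma, (tau.+1 + nu - sigma)%N, g, G; split=> //.
- by rewrite sg0.
- move=> y; rewrite -horner_comp_aff -hornerZ -hg /h hornerD hornerN hornerC.
  by rewrite addrC subrK.
split=> //.
- apply/polyP => i; apply: (mulfI (psg0 sigma)).
  by rewrite -coefZ hder !coefZ mulrA -PoszM -expnD subnKC.
- apply/leq_sizeP => i hi; rewrite redp_coef; apply/eqP; rewrite -dvdz_Fp.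
  have -> : G`_i = (p ^ (i - nu))%:Z * phi`_i.
    apply: (mulfI (psg0 nu)); rewrite hGi mulrA -PoszM -expnD subnKC//.
    by rewrite (leq_trans numu)// ltnW.
  have -> : (i - nu = (i - nu).-1.+1)%N by rewrite prednK// subn_gt0 (leq_ltn_trans numu).
  by rewrite expnS PoszM -mulrA dvdz_mulr.
Qed.

Lemma sum_ord_Fp (V : nmodType) (u : 'F_p -> V) :
  \sum_(n < p) u n%:R = \sum_(x : 'F_p) u x.
Proof.
rewrite -(big_mkord xpredT (fun n => u n%:R)) -{1}(Fp_cast pp) big_mkord.
by apply: eq_bigr => x _; rewrite natr_Zp.
Qed.

Lemma expsum_prime (f : {poly int}) :
  expsum R p f = \sum_(x : 'F_p) psi R (redp f).[x].
Proof.
rewrite -sum_ord_Fp; apply: eq_bigr => n _.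
by rewrite -[n%:R]/((n%:Z)%:~R) redp_horner psi_intr.
Qed.

(** The factor [2 * e * e.+1 ^ e] comes from Mordell's bound, with 2 from [p ^ 2 <= 2 p (p - 1)];
    [e ^ 3] bounds [p ^ l] for the primes [p <= e] and the exponents [l <= 2 tau + 1], to which the
    lifting argument does not apply. *)
Definition hua_const : nat := (2 * e * e.+1 ^ e * e ^ 3)%N.

Lemma hua_const_gt0 : (0 < hua_const)%N.
Proof. by rewrite !muln_gt0 !expn_gt0 e0. Qed.

(** [b] is [p ^ (-1/e)], given by its [e]-th power so that only integer powers occur here. *)
Variable b : R.
Hypothesis b_gt0 : 0 < b.
Hypothesis hb : b ^+ e * p%:R = 1.

Lemma b_le1 : b <= 1.
Proof.
rewrite leNgt; apply/negP => b1; have : 1 < b ^+ e by rewrite exprn_egt1// -lt0n.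
have : 1 < p%:R :> R by rewrite ltr1n prime_gt1.
by move: hb; set x := _ ^+ _; nra.
Qed.

(** Either [p <= e], and [p ^ l <= e ^ 3] makes the trivial bound good enough; or [p > e], and
    [p ^ tau <= e] forces [tau = 0] and [l <= 1], the range of Mordell's bound. *)
Lemma hua_small (f : {poly int}) (F : {poly int}) tau l : (size f <= e.+1)%N ->
  (1 < size (redp f))%N -> f^`() = (p ^ tau)%:Z *: F -> (l < tau.*2.+2)%N ->
  cmod (expsum R (p ^ l) f) <= hua_const%:R * ((p ^ l)%:R * b ^+ l).
Proof.
move=> hs hf hF hl; have htau := pexp_content_le hs hf hF.
have K1 : 1 <= hua_const%:R :> R by rewrite ler1n hua_const_gt0.
have pl0 : 0 < (p ^ l)%:R :> R by rewrite ltr0n expn_gt0 p_gt0.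
have [pe|ep] := leqP p e.
  apply: le_trans (cmod_expsum_le _ _ _) _.
  rewrite mulrCA ler_peMr ?(ltW pl0)//.
  have hpl : (p ^ l <= e ^ 3)%N.
    apply: (@leq_trans (p ^ (tau + tau + 1))); first by rewrite leq_pexp2l//; move: hl; rewrite -addnn; lia.
    by rewrite !expnD expn1 -[(e ^ 3)%N]/(e * (e * e))%N mulnA leq_mul// leq_mul.
  have hbl : (b ^+ e) ^+ l <= b ^+ l.
    by rewrite -exprM ler_wiXn2l ?b_le1 ?(ltW b_gt0)// leq_pmull.
  have hbe : (b ^+ e) ^+ l * (p ^ l)%:R = 1 by rewrite natrX -exprMn hb expr1n.
  have h3 : (p ^ l)%:R <= hua_const%:R :> R.
    rewrite ler_nat (leq_trans hpl)// /hua_const leq_pmull//.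
    by rewrite !muln_gt0 e0 expn_gt0.
  apply: (@le_trans _ _ ((p ^ l)%:R * (b ^+ e) ^+ l)); first by rewrite mulrC hbe.
  by rewrite ler_pM// ?exprn_ge0// ltW.
have tau0 : tau = 0%N.
  apply/eqP; rewrite -leqn0 -ltnS; apply/negPn/negP => h.
  have : (p <= p ^ tau)%N by rewrite -{1}(expn1 p) leq_pexp2l//; case: tau h {hF hl htau}.
  by rewrite leqNgt (leq_ltn_trans htau).
have {hl} : (l <= 1)%N by move: hl; rewrite tau0.
rewrite leq_eqVlt ltnS leqn0 => /orP[]/eqP ->; last first.
  by apply: le_trans (cmod_expsum_le _ _ _) _; rewrite expn0 expr0 !mulr1.
rewrite expn1 expr1 expsum_prime.
have := mordell_bound_nonconst R pp ep (f := redp f).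
rewrite hf (leq_trans (size_redp f) hs) => /(_ isT).
set S := cmod _ => hS.
have S0 : 0 <= S by exact: cmod_ge0.
have e20 : (0 < e.*2)%N by rewrite double_gt0.
rewrite -(@ler_pXn2r _ e.*2)// ?nnegrE// ?mulr_ge0// ?(ltW b_gt0)//.
have hp2 : (p <= 2 * p.-1)%N by have := prime_gt1 pp; lia.
have pR : 0 < p%:R :> R by rewrite ltr0n.
rewrite !exprMn.
have -> : b ^+ e.*2 = (p%:R ^+ 2)^-1.
  rewrite -muln2 exprM; apply: (mulIf (_ : p%:R ^+ 2 != 0)); first by rewrite expf_neq0// gt_eqF.
  by rewrite -exprMn hb expr1n mulVf// expf_neq0// gt_eqF.
rewrite mulrA ler_pdivlMr ?exprn_gt0//.
apply: (@le_trans _ _ (2 * (S ^+ e.*2 * (p * p.-1)%:R))).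
  rewrite [leRHS]mulrCA ler_wpM2l ?exprn_ge0// -natrX -(natrM _ 2) ler_nat.
  by rewrite -mulnn mulnCA leq_mul.
apply: (@le_trans _ _ (2 * (e * (p ^ e.*2 * e.+1 ^ e))%:R)); first by rewrite ler_wpM2l.
rewrite -(natrM _ 2) -!natrX -natrM ler_nat.
apply: (@leq_trans (hua_const * p ^ e.*2)); last first.
  by rewrite leq_mul2r -{1}(expn1 hua_const) leq_pexp2l ?hua_const_gt0// orbT.
rewrite [(p ^ _ * _)%N]mulnC !mulnA leq_mul2r /hua_const leq_pmulr ?orbT//.
by rewrite expn_gt0 e0.
Qed.

(** Induction on [l], with the degree bound [D] carried in the constant. Nonroot classes vanish, a
    root of multiplicity [m] costs a constant times [m], and multiplicities add up to at most [D],
    so the constant does not deteriorate. The [maxn 1] serves small [l], where [D] may be 0. *)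
Lemma hua_prime_power_ind l (f F : {poly int}) tau D : (size f <= e.+1)%N ->
  (1 < size (redp f))%N -> f^`() = (p ^ tau)%:Z *: F -> redp F != 0 ->
  (size (redp F) <= D.+1)%N ->
  cmod (expsum R (p ^ l) f) <= hua_const%:R * (maxn 1 D)%:R * ((p ^ l)%:R * b ^+ l).
Proof.
have [n] := ubnP l; elim: n l f F tau D => // n IH l f F tau D hln hs hf hF F0 hD.
have K0 : 0 <= hua_const%:R :> R by [].
have K1 : 1 <= hua_const%:R :> R by rewrite ler1n hua_const_gt0.
have b0 : 0 <= b by exact: ltW.
have pl0 k : 0 < (p ^ k)%:R :> R by rewrite ltr0n expn_gt0 p_gt0.
have [hl|hl] := ltnP l tau.*2.+2.
  apply: le_trans (hua_small hs hf hF hl) _.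
  rewrite ler_wpM2r ?mulr_ge0 ?exprn_ge0 ?(ltW (pl0 _))//.
  by rewrite ler_peMr// ler1n leq_maxl.
have l0 : (0 < l)%N by exact: leq_trans hl.
pose T (x : nat) := \sum_(y < p ^ l.-1) chi ((f.[(x + p * y)%N%:Z])%:~R / (p ^ l)%:R) : C.
have -> : expsum R (p ^ l) f = \sum_(x < p) T x.
  have hsum (u : nat -> C) a k k' : a = (k * k')%N ->
     \sum_(n < a) u n = \sum_(i < k) \sum_(j < k') u (i + k * j)%N.
    by move=> ->; exact: sum_ord_mul.
  apply: (hsum (fun n => chi ((f.[n%:Z])%:~R / (p ^ l)%:R))).
  by rewrite -expnS prednK.
pose m (x : 'F_p) := mup x (redp F).
have pinv : (p ^ l)%:R * b ^+ e = (p ^ l.-1)%:R :> R.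
  by rewrite -{1}(prednK l0) expnS natrM mulrC mulrA hb mul1r.
have hT (x : nat) : cmod (T x) <= hua_const%:R * ((p ^ l)%:R * b ^+ l) * (m x%:R)%:R.
  have [hx|hx] := boolP (p%:Z %| F.[x%:Z])%Z; last first.
    by rewrite /T (sum_nonroot_class hF hx hl) cmod0 !mulr_ge0 ?exprn_ge0 ?(ltW (pl0 _)).
  have m0 : (0 < m x%:R)%N.
    rewrite /m -XsubC_dvd// dvdp_XsubCl /root -[x%:R]/((x%:Z)%:~R) redp_horner.
    by rewrite -dvdz_Fp.
  have [sg [tau' [g [G [/andP[sg0 sge] hg [hsg hgs] [hG G0 hGs]]]]]] :=
    root_class_reduction x hs hf hF F0.
  have hbe : b ^+ e <= b ^+ sg by rewrite ler_wiXn2l// b_le1.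
  (* If [l <= sg] the phase is constant on the class; the trivial bound [p ^ l.-1], that is
     [p ^ l * b ^+ e], suffices because [l <= e]. *)
  have [lsg|lsg] := leqP l sg.
    apply: (@le_trans _ _ (p ^ l.-1)%:R).
      apply: le_trans (cmod_sum _ _ _) _.
      by under eq_bigr do rewrite cmod_chi; rewrite sumr_const card_ord.
    have hbl : b ^+ e <= b ^+ l by rewrite ler_wiXn2l// ?b_le1// (leq_trans lsg).
    rewrite -pinv; apply: (@le_trans _ _ ((p ^ l)%:R * b ^+ l)).
      by rewrite ler_wpM2l// ltW.
    rewrite mulrAC ler_peMl ?mulr_ge0 ?exprn_ge0 ?(ltW (pl0 _))//.
    by rewrite mulr_ege1// ler1n.
  have hle : (p ^ (l - sg) * p ^ sg.-1 = p ^ l.-1)%N by rewrite -expnD; congr (_ ^ _)%N; lia.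
  have pln0 k : (p ^ k)%:R != 0 :> R by rewrite gt_eqF.
  (* The [p ^ l.-1] values of [y] run through [p ^ sg.-1] periods of a sum modulo [p ^ (l - sg)]. *)
  have -> : T x = chi ((f.[x%:Z])%:~R / (p ^ l)%:R) * (expsum R (p ^ (l - sg)) g *+ p ^ sg.-1).
    rewrite -(sum_periodic_mul (u := fun y => chi ((g.[y%:Z])%:~R / (p ^ (l - sg))%:R))); last first.
      by move=> y; apply: chi_poly_periodic; rewrite expn_gt0 p_gt0.
    rewrite hle mulr_sumr; apply: eq_bigr => y _.
    rewrite -chiD; congr chi; rewrite PoszD PoszM hg rmorphD rmorphM /= mulrDl; congr (_ + _).
    have -> : (p ^ l = p ^ sg * p ^ (l - sg))%N by rewrite -expnD subnKC// ltnW.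
    by rewrite -[_%:~R in LHS]/((p ^ sg)%:R) natrM; field; rewrite !pln0.
  rewrite cmodM cmod_chi mul1r -[expsum _ _ _ *+ _]mulr_natr cmodM cmod_nat.
  have hlt : (l - sg < n)%N by apply: leq_trans (_ : l <= n)%N => //; lia.
  have := IH _ _ _ _ _ hlt hsg hgs hG G0 hGs; rewrite -/(m _).
  have -> : maxn 1 (m x%:~R) = m x%:R by apply/maxn_idPr.
  move=> hIH; apply: le_trans (ler_wpM2r _ hIH) _ => //.
  have -> : hua_const%:R * (m x%:R)%:R * ((p ^ (l - sg))%:R * b ^+ (l - sg)) * (p ^ sg.-1)%:R =
     hua_const%:R * ((p ^ l)%:R * (b ^+ e * b ^+ (l - sg))) * (m x%:R)%:R.
    rewrite [(p ^ l)%:R * _]mulrA pinv -hle natrM; ring.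
  rewrite ler_wpM2r// ler_wpM2l// ler_wpM2l ?(ltW (pl0 _))//.
  apply: (@le_trans _ _ (b ^+ sg * b ^+ (l - sg))); first by rewrite ler_wpM2r ?exprn_ge0.
  by rewrite -exprD subnKC// ltnW.
apply: le_trans (cmod_sum _ _ _) _.
apply: (@le_trans _ _ (\sum_(x < p) hua_const%:R * ((p ^ l)%:R * b ^+ l) * (m x%:R)%:R)).
  by apply: ler_sum => x _; exact: hT.
rewrite -mulr_sumr (sum_ord_Fp (fun x => (m x)%:R)) -natr_sum [leRHS]mulrAC.
rewrite ler_wpM2l ?mulr_ge0 ?exprn_ge0 ?(ltW (pl0 _))// ler_nat.
apply: leq_trans (sum_mup_le F0) _; rewrite leq_max; apply/orP; right.
by rewrite -ltnS prednK// size_poly_gt0.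
Qed.

Lemma hua_prime_power l (f : {poly int}) : (size f <= e.+1)%N ->
  (1 < size (redp f))%N ->
  cmod (expsum R (p ^ l) f) <= (hua_const * e)%:R * ((p ^ l)%:R * b ^+ l).
Proof.
move=> hs hf.
have f'0 : f^`() != 0.
  apply: contraTneq hf => f0; rewrite -leqNgt (leq_trans (size_redp f))//.
  have -> : f = (f`_0)%:P.
    apply/polyP => -[|i]; rewrite coefC//=.
    have := congr1 (fun g : {poly int} => g`_i) f0; rewrite /= coef_deriv coef0 => /eqP.
    by rewrite mulrn_eq0 /= => /eqP.
  exact: size_polyC_leq1.
have [tau [F [hF F0]]] := poly_content f'0.
have hsF : (size (redp F) <= e.+1)%N.
  have hp : (p ^ tau)%:Z != 0 by rewrite -[_ == 0 :> int]/(_ == 0)%N expn_eq0 (gtn_eqF p_gt0).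
  apply: leq_trans (size_redp F) _; rewrite -(size_scale F hp) -hF.
  by apply: leq_trans hs; rewrite (leq_trans (size_poly _ _))// leq_pred.
have := hua_prime_power_ind l hs hf hF F0 hsF.
by have -> : maxn 1 e = e by [apply/maxn_idPr]; rewrite natrM.
Qed.

End PrimePower.

(** * Divisor bounds *)

Lemma size_divisorsM m n : (0 < m)%N -> (0 < n)%N ->
  (size (divisors (m * n)) <= size (divisors m) * size (divisors n))%N.
Proof.
move=> m0 n0; rewrite -(size_allpairs muln).
apply: uniq_leq_size; first exact: divisors_uniq.
move=> d; rewrite -dvdn_divisors ?muln_gt0 ?m0// => hd.
have d0 : (0 < d)%N by apply: dvdn_gt0 hd; rewrite muln_gt0 m0.
have g0 : (0 < gcdn d m)%N by rewrite gcdn_gt0 d0.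
apply/allpairsP; exists (gcdn d m, d %/ gcdn d m)%N => /=; split.
- by rewrite -dvdn_divisors// dvdn_gcdr.
- rewrite -dvdn_divisors//.
  have hc : coprime (d %/ gcdn d m) (m %/ gcdn d m).
    rewrite /coprime -(eqn_pmul2r g0) muln_gcdl !divnK ?dvdn_gcdl ?dvdn_gcdr//.
    by rewrite mul1n.
  rewrite -(Gauss_dvdr _ hc) -(dvdn_pmul2r g0) divnK ?dvdn_gcdl//.
  by rewrite mulnAC divnK// dvdn_gcdr.
- by rewrite mulnC divnK// dvdn_gcdl.
Qed.

Lemma size_divisors_pfactor p l : prime p -> (size (divisors (p ^ l)) <= l.+1)%N.
Proof.
move=> pp; rewrite -[leqRHS](size_iota 0 l.+1) -[leqRHS](size_map (expn p)).
apply: uniq_leq_size; first exact: divisors_uniq.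
move=> d; rewrite -dvdn_divisors ?expn_gt0 ?prime_gt0// => /(dvdn_pfactor _ _ pp)[i il ->].
by apply: map_f; rewrite mem_iota.
Qed.

Lemma prod_primes_logn n : (0 < n)%N -> n = (\prod_(p <- primes n) p ^ logn p n)%N.
Proof.
by move=> n0; rewrite [LHS]prod_prime_decomp// prime_decompE big_map.
Qed.

Lemma size_divisors_le n : (0 < n)%N ->
  (size (divisors n) <= \prod_(p <- primes n) (logn p n).+1)%N.
Proof.
move=> n0; rewrite {1}(prod_primes_logn n0).
have : all prime (primes n) by apply/allP => p; rewrite mem_primes => /andP[].
elim: (primes n) => [|p s IH] /=; first by rewrite !big_nil.
move=> /andP[pp hs]; rewrite !big_cons.
have s0 : (0 < \prod_(j <- s) j ^ logn j n)%N.
  rewrite big_seq; elim/big_rec: _ => // j m js m0.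
  by rewrite muln_gt0 m0 expn_gt0 (prime_gt0 (allP hs _ js)).
apply: leq_trans (size_divisorsM _ s0) _; first by rewrite expn_gt0 prime_gt0.
by rewrite leq_mul ?size_divisors_pfactor ?IH.
Qed.

(** Bernoulli in the form [l.+1 <= s * (l %/ s).+1 <= s * 2 ^ (l %/ s)], raised to the power [s]. *)
Lemma leq_exp_two s l : (0 < s)%N -> (l.+1 ^ s <= s ^ s * 2 ^ l)%N.
Proof.
move=> s0.
have h : (l.+1 <= s * 2 ^ (l %/ s))%N.
  apply: (@leq_trans (s * (l %/ s).+1)); last by rewrite leq_mul2l ltn_expl ?orbT.
  by rewrite {1}(divn_eq l s) -addnS mulnS mulnC addnC leq_add2r ltn_pmod.
apply: (@leq_trans ((s * 2 ^ (l %/ s)) ^ s)); first by rewrite leq_exp2r.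
by rewrite expnMn leq_mul2l -expnM leq_exp2l// leq_trunc_div orbT.
Qed.

(* Only the primes below [(2K)^s] contribute a factor exceeding [p ^ logn p n]. *)
Lemma prod_primes_subpoly (K s : nat) : (0 < K)%N -> (0 < s)%N ->
  exists C, (0 < C)%N /\ forall n, (0 < n)%N ->
    ((\prod_(p <- primes n) (K * (logn p n).+1)) ^ s <= C * n)%N.
Proof.
move=> K0 s0; pose P0 := ((2 * K) ^ s)%N; pose C0 := (K ^ s * s ^ s)%N.
have C00 : (0 < C0)%N by rewrite muln_gt0 !expn_gt0 K0 s0.
exists (C0 ^ P0)%N; split; first by rewrite expn_gt0 C00.
move=> n n0; rewrite [X in (_ <= _ * X)%N](prod_primes_logn n0).
have hloc p : prime p -> (0 < logn p n)%N ->
    ((K * (logn p n).+1) ^ s <= (if (p < P0)%N then C0 else 1) * p ^ logn p n)%N.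
  move=> pp; move: (logn p n) => l l0; case: ltnP => hp.
    rewrite expnMn /C0 -mulnA leq_mul2l; apply/orP; right.
    apply: leq_trans (leq_exp_two l s0) _.
    by rewrite leq_mul2l leq_exp2r// prime_gt1 ?orbT.
  rewrite mul1n; apply: (@leq_trans (P0 ^ l)); last by rewrite leq_exp2r.
  rewrite /P0 -expnM [(s * l)%N]mulnC expnM leq_exp2r// expnMn mulnC leq_mul//.
    by rewrite ltn_expl.
  by rewrite -{1}(expn1 K) leq_pexp2l.
have : forall p, p \in primes n -> prime p /\ (0 < logn p n)%N.
  by move=> p hp; split; [move: hp; rewrite mem_primes => /andP[] | rewrite logn_gt0].
have -> : (C0 ^ P0 = \prod_(p <- iota 0 P0) C0)%N.
  by rewrite big_const_seq count_predT size_iota iter_muln_1.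
have hC : (\prod_(p <- primes n) (if p < P0 then C0 else 1) <= \prod_(p <- iota 0 P0) C0)%N.
  rewrite -big_mkcond -big_filter !big_const_seq !count_predT !iter_muln_1 leq_pexp2l//.
  apply: uniq_leq_size; first by rewrite filter_uniq// primes_uniq.
  by move=> p; rewrite mem_filter mem_iota => /andP[].
move=> hpr; apply: leq_trans (leq_mul hC (leqnn _)).
rewrite -big_split /=.
have -> : ((\prod_(p <- primes n) (K * (logn p n).+1)) ^ s =
           \prod_(p <- primes n) ((K * (logn p n).+1) ^ s))%N.
  elim: (primes n) => [|p r IH]; first by rewrite !big_nil exp1n.
  by rewrite !big_cons expnMn IH.
rewrite big_seq [leqRHS]big_seq; apply: leq_prod => p hp.
by have [] := hpr p hp; exact: hloc.
Qed.

Lemma divisors_subpoly (s : nat) : (0 < s)%N ->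
  exists C, (0 < C)%N /\ forall n, (0 < n)%N -> (size (divisors n) ^ s <= C * n)%N.
Proof.
move=> s0; have [C [C0 hC]] := prod_primes_subpoly (ltn0Sn 0) s0.
exists C; split => // n n0; apply: leq_trans (hC n n0).
rewrite leq_exp2r//; apply: leq_trans (size_divisors_le n0) _.
by apply: leq_prod => p _; rewrite mul1n.
Qed.

(** * Counting congruent pairs by iterated Cauchy-Schwarz *)

Lemma sqr_sum_le (R : realFieldType) (I : finType) (v : I -> R) :
  (\sum_i v i) ^+ 2 <= #|I|%:R * \sum_i v i ^+ 2.
Proof.
have h : 0 <= \sum_i \sum_j (v i - v j) ^+ 2.
  by apply: sumr_ge0 => i _; apply: sumr_ge0 => j _; exact: sqr_ge0.
have h2 : \sum_i \sum_j (v i - v j) ^+ 2 =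
   2 * (#|I|%:R * \sum_i v i ^+ 2) - 2 * (\sum_i v i) ^+ 2.
  have -> : \sum_i \sum_j (v i - v j) ^+ 2 =
     \sum_i \sum_j (v i ^+ 2 + v j ^+ 2 - 2 * (v i * v j)).
    by apply: eq_bigr => i _; apply: eq_bigr => j _; ring.
  under eq_bigr do rewrite sumrB big_split /= sumr_const -mulr_sumr -mulr_sumr.
  rewrite sumrB big_split /= sumr_const -mulr_sumr -mulr_suml -expr2.
  by rewrite sumrMnl -[_ *+ _]mulr_natl; ring.
rewrite h2 in h; lra.
Qed.

(** Abstract form of the relations stating that [q] times the difference of two points is integral.
    Constants proved at this level are automatically uniform in the matrix, the frequency and the
    points. *)
Definition congruence_system (I : finType) (r : nat -> rel I) (d D : nat) : Prop :=
  [/\ forall q, (0 < q)%N -> equivalence_rel (r q),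
      forall q q' i j, (0 < q')%N -> (q %| q')%N -> r q i j -> r q' i j,
      forall q q' i j, (0 < q)%N -> (0 < q')%N ->
         r q i j -> r q' i j -> r (gcdn q q') i j &
      forall q i, (0 < q)%N -> (#|[set j | r q i j]| <= D * q ^ d)%N].

Definition pairs (I : finType) (r : nat -> rel I) (q : nat) : nat :=
  (\sum_i \sum_j r q i j)%N.

Section CongruenceSystem.
Variables (I : finType) (r : nat -> rel I) (d D : nat).
Hypothesis hr : congruence_system r d D.

Lemma csys_sym q i j : (0 < q)%N -> r q i j = r q j i.
Proof.
move=> q0; have [/(_ q q0) hq _ _ _] := hr.
have h1 a : r q a a by have [] := hq a a a.
have h2 a b c : r q a b -> r q a c = r q b c by have [_] := hq a b c.
by apply/idP/idP => h; [rewrite -(h2 _ _ i h) h1 | rewrite -(h2 _ _ j h) h1].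
Qed.

Lemma csys_trans q i j l : (0 < q)%N -> r q i j -> r q j l -> r q i l.
Proof.
move=> q0; have [/(_ q q0) hq _ _ _] := hr.
by have [_ h] := hq i j l; move=> /h ->.
Qed.

(** If a middle point [j] exists, then [i] and [l] are congruent for the lcm; and all middle points
    lie in a single class for the gcd. *)
Lemma csys_codegree q q' i l : (0 < q)%N -> (0 < q')%N ->
  (\sum_j (r q i j && r q' j l) <= D * gcdn q q' ^ d * r (lcmn q q') i l)%N.
Proof.
move=> q0 q'0; have [_ hdv hgcd hcard] := hr.
have g0 : (0 < gcdn q q')%N by rewrite gcdn_gt0 q0.
have l0 : (0 < lcmn q q')%N by rewrite lcmn_gt0 q0.
have [/existsP[j0 /andP[h1 h2]]|] := boolP [exists j, r q i j && r q' j l]; last first.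
  by rewrite negb_exists => /forallP h; rewrite big1// => j _; rewrite (negPf (h j)).
have -> : r (lcmn q q') i l.
  by apply: (@csys_trans _ _ j0) => //; [apply: hdv h1 | apply: hdv h2];
    rewrite ?dvdn_lcml ?dvdn_lcmr.
rewrite muln1; apply: leq_trans (hcard _ j0 g0).
rewrite -sum1_card [leqRHS]big_mkcond /=; apply: leq_sum => j _; rewrite inE.
case: andP => //= -[h3 h4]; rewrite hgcd//.
  by apply: (@csys_trans _ _ i) => //; rewrite csys_sym.
by apply: (@csys_trans _ _ l) => //; rewrite csys_sym.
Qed.

Lemma pairs_le q : (pairs r q <= #|I| ^ 2)%N.
Proof.
rewrite /pairs (@leq_trans (\sum_(i : I) \sum_(j : I) 1))//.
  by apply: leq_sum => i _; apply: leq_sum => j _; case: (r q i j).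
by under eq_bigr do rewrite sum1_card; rewrite sum_nat_const.
Qed.

Variable R : realType.

(** For [s >= d] the weight compensates the power [gcdn q q' ^ d] in the number of middle points and
    leaves the weight of the lcm, so this family of counts is stable under squaring. *)
Definition wpairs (s : R) (Q : nat) : R :=
  \sum_(q < Q) (q.+1%:R `^ (- s)) * (pairs r q.+1)%:R.

(* Cauchy-Schwarz over the middle point of the paths [i ~q j ~q' l]. *)
Lemma wpairs_sqr (s : R) Q : d%:R <= s ->
  wpairs s Q ^+ 2 <= (#|I| * D)%:R *
    \sum_(q < Q) \sum_(q' < Q)
       (lcmn q.+1 q'.+1)%:R `^ (- s) * (pairs r (lcmn q.+1 q'.+1))%:R.
Proof.
move=> ds; pose w (q : 'I_Q) : R := q.+1%:R `^ (- s).
pose v j := \sum_(q < Q) \sum_i w q * (r q.+1 i j)%:R.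
have -> : wpairs s Q = \sum_j v j.
  rewrite /v exchange_big /=; apply: eq_bigr => q _.
  rewrite -/(w q) /pairs natr_sum mulr_sumr exchange_big /=; apply: eq_bigr => i _.
  by rewrite natr_sum mulr_sumr.
apply: le_trans (sqr_sum_le _) _; rewrite natrM -mulrA ler_wpM2l//.
have -> : \sum_j v j ^+ 2 = \sum_(q < Q) \sum_(q' < Q) w q * w q' *
    (\sum_i \sum_l \sum_j (r q.+1 i j && r q'.+1 j l))%N%:R.
  have -> : \sum_j v j ^+ 2 = \sum_j \sum_(q < Q) \sum_(q' < Q) w q * w q' *
      (\sum_i \sum_l (r q.+1 i j && r q'.+1 j l))%N%:R.
    apply: eq_bigr => j _; rewrite expr2 {1}/v mulr_suml; apply: eq_bigr => q _.
    rewrite /v mulr_sumr; apply: eq_bigr => q' _.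
    rewrite natr_sum [RHS]mulr_sumr mulr_suml; apply: eq_bigr => i _.
    rewrite natr_sum !mulr_sumr; apply: eq_bigr => l _.
    by rewrite (csys_sym l j)//; case: (r q.+1 i j); case: (r q'.+1 j l); rewrite /=; ring.
  rewrite exchange_big /=; apply: eq_bigr => q _; rewrite exchange_big /=.
  apply: eq_bigr => q' _; rewrite -mulr_sumr -natr_sum; congr (_ * _%:R).
  by rewrite exchange_big /=; apply: eq_bigr => i _; rewrite exchange_big.
rewrite mulr_sumr; apply: ler_sum => q _; rewrite mulr_sumr; apply: ler_sum => q' _.
set g := gcdn q.+1 q'.+1; set m := lcmn q.+1 q'.+1.
have g0 : (0 < g)%N by rewrite gcdn_gt0.
have m0 : (0 < m)%N by rewrite lcmn_gt0.
have h1 : (\sum_i \sum_l \sum_j (r q.+1 i j && r q'.+1 j l) <= D * g ^ d * pairs r m)%N.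
  rewrite /pairs big_distrr /=; apply: leq_sum => i _.
  by rewrite big_distrr /=; apply: leq_sum => l _; exact: csys_codegree.
(* Since gcd times lcm is [q.+1 * q'.+1], the weights split into a gcd part, which absorbs [g ^ d],
   and an lcm part. *)
have h2 : w q * w q' = g%:R `^ (- s) * m%:R `^ (- s).
  by rewrite /w -!powRM// -!natrM [(g * m)%N]mulnC /m /g muln_lcm_gcd.
have h3 : g%:R `^ (- s) * g%:R ^+ d <= 1.
  rewrite -powR_mulrn// -powRD; last by rewrite pnatr_eq0 (gtn_eqF g0) implybT.
  by rewrite -[leRHS](powRr0 g%:R) ler_powR ?ler1n//; lra.
apply: (@le_trans _ _ (w q * w q' * (D * g ^ d * pairs r m)%:R)).
  by rewrite ler_wpM2l ?ler_nat// mulr_ge0 ?powR_ge0.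
rewrite h2 !natrM natrX.
set a := g%:R `^ (- s) in h3 *; set b := m%:R `^ _; set c := g%:R ^+ d in h3 *.
set x := (pairs _ _)%:R.
have -> : a * b * (D%:R * c * x) = (a * c) * (D%:R * (b * x)) by ring.
by rewrite ler_piMl// !mulr_ge0 ?powR_ge0.
Qed.

End CongruenceSystem.

Lemma divisors_subpolyR (R : realType) (delta : R) : 0 < delta ->
  exists C : R, 0 < C /\ forall n, (0 < n)%N ->
    (size (divisors n))%:R ^+ 2 <= C * n%:R `^ delta.
Proof.
move=> d0; pose u := (Num.truncn (delta^-1)).+1.
have hu : u%:R^-1 <= delta.
  rewrite -[leRHS]invrK lef_pV2 ?posrE ?invr_gt0// ltW//.
  have /andP[] // : (Num.truncn delta^-1)%:R <= delta^-1 < u%:R.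
  by apply: truncn_itv; rewrite invr_ge0 ltW.
have u0 : (0 < u)%N by [].
(* The factor 2 accounts for the squared divisor count, [u] for the exponent [1/u <= delta]. *)
have [C [C0 hC]] := @divisors_subpoly (2 * u) (ltn0Sn _).
exists (C%:R `^ u%:R^-1); split; first by rewrite powR_gt0// ltr0n.
move=> n n0.
have h : ((size (divisors n))%:R ^+ 2) ^+ u <= (C * n)%:R :> R.
  by rewrite -exprM -natrX ler_nat hC.
apply: (@le_trans _ _ ((C * n)%:R `^ u%:R^-1)).
  set a := _ ^+ 2 in h *; have a0 : 0 <= a by exact: sqr_ge0.
  have -> : a = (a ^+ u) `^ u%:R^-1.
    by rewrite -powR_mulrn// -powRrM mulfV ?pnatr_eq0// powRr1.
  by rewrite ge0_ler_powR ?invr_ge0// nnegrE ?exprn_ge0.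
rewrite natrM powRM// ler_wpM2l ?powR_ge0// ler_powR// ler1n//.
Qed.

(** Both members of a pair with lcm [m] are divisors of [m]. *)
Lemma sum_lcm_le (R : realType) (Q : nat) (phi : nat -> R) :
  (forall n, 0 <= phi n) ->
  \sum_(q < Q) \sum_(q' < Q) phi (lcmn q.+1 q'.+1) <=
  \sum_(m < Q * Q) (size (divisors m.+1))%:R ^+ 2 * phi m.+1.
Proof.
move=> phi0; rewrite pair_big /=.
have hlt (w : 'I_Q * 'I_Q) : ((lcmn w.1.+1 w.2.+1).-1 < Q * Q)%N.
  rewrite prednK ?lcmn_gt0//.
  apply: (@leq_trans (w.1.+1 * w.2.+1)); last by rewrite leq_mul.
  by rewrite dvdn_leq// dvdn_lcm dvdn_mulr// dvdn_mull.
rewrite (partition_big (fun w => Ordinal (hlt w)) predT)//=.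
apply: ler_sum => m _.
rewrite (eq_bigr (fun=> phi m.+1)); last first.
  by move=> w /eqP <- /=; rewrite prednK// lcmn_gt0.
rewrite sumr_const -[_ *+ _]mulr_natl ler_wpM2r// -natrX ler_nat.
pose A := [set q : 'I_Q | (q.+1 %| m.+1)%N].
have hA : (#|A| <= size (divisors m.+1))%N.
  rewrite cardE -(size_map (fun q : 'I_Q => q.+1)); apply: uniq_leq_size.
    by rewrite map_inj_uniq ?enum_uniq// => a b [] /val_inj.
  by move=> n /mapP[q]; rewrite mem_enum inE => h ->; rewrite -dvdn_divisors.
apply: (@leq_trans (#|A| ^ 2)); last by rewrite leq_exp2r.
rewrite -cardsE -[(#|A| ^ 2)%N]mulnn -cardsX; apply: subset_leq_card; apply/fintype.subsetP => w.
rewrite !inE => /eqnP /= <-.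
by rewrite prednK ?lcmn_gt0// dvdn_lcml dvdn_lcmr.
Qed.

(** Integral comparison in telescoped form: [key] bounds each term by a difference of values of the
    primitive, through [1 + y <= expR y] and [ln (1 - x) <= - x]. *)
Lemma sum_powR_le (R : realType) (delta : R) Q : 0 < delta ->
  \sum_(q < Q) q.+1%:R `^ (- (1 + delta)) <= 1 + delta^-1.
Proof.
move=> d0.
have key (q : nat) : delta * q.+2%:R `^ (- (1 + delta)) <=
    q.+1%:R `^ (- delta) - q.+2%:R `^ (- delta).
  have q2 : 0 < q.+2%:R :> R by [].
  have -> : q.+2%:R `^ (- (1 + delta)) = q.+2%:R `^ (- delta) / q.+2%:R.
    rewrite opprD addrC powRD; last by rewrite pnatr_eq0 implybT.
    by rewrite powR_inv1.
  have -> : q.+1%:R `^ (- delta) = q.+2%:R `^ (- delta) * (1 - q.+2%:R^-1) `^ (- delta).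
    rewrite -powRM//; last by rewrite subr_ge0 invf_le1// ler1n.
    by congr (_ `^ _); rewrite mulrBr mulr1 mulfV// -[X in _ = X - _]natr1 addrK.
  have : 1 + delta / q.+2%:R <= (1 - q.+2%:R^-1) `^ (- delta).
    have x0 : 0 < 1 - q.+2%:R^-1 :> R by rewrite subr_gt0 invf_lt1// ltr1n.
    rewrite /powR (gt_eqF x0); apply: le_trans (expR_ge1Dx _).
    have hln (x : R) : 0 < 1 - x -> ln (1 - x) <= - x by move=> hx; apply: le_ln1Dx; lra.
    have := hln _ x0.
    set y := ln _; set x := q.+2%:R^-1 => h.
    by nra.
  have := powR_ge0 q.+2%:R (- delta).
  set a := _ `^ _; set b := _ `^ _; set x := q.+2%:R^-1 => a0 h.
  nra.
have : delta * (\sum_(q < Q) q.+2%:R `^ (- (1 + delta))) <= 1 - Q.+1%:R `^ (- delta).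
  elim: Q => [|Q IH]; first by rewrite big_ord0 mulr0 powR1 subrr.
  by rewrite big_ord_recr /= mulrDr; have := key Q; lra.
case: Q => [_|Q]; first by rewrite big_ord0 addr_ge0 ?invr_ge0// ltW.
rewrite big_ord_recr /= mulrDr => h.
rewrite big_ord_recl /= powR1 lerD2l -[leRHS]mulr1 mulrC ler_pdivlMr// mulrC.
have := powR_ge0 Q.+2%:R (- delta); have := powR_ge0 Q.+2%:R (- (1 + delta)).
move: h; rewrite /bump /=; under [X in _ -> _ -> _ -> _ * X <= _]eq_bigr do rewrite add1n.
nra.
Qed.

(** Each squaring replaces [Q] by [Q * Q] and gives up [delta] in the weight, to pay for the pairs
    with a given lcm; the growth of [Q] is harmless since the bound does not involve it. The
    recursion ends with the trivial estimate [#|I| ^ 2] and a convergent series. After extraction of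
    the root of order [2 ^ t], the trivial estimate weighs only [2 ^ -t], whence
    [#|I| ^ (1 + o(1))]. *)
Lemma wpairs_bound (R : realType) (d : nat) (delta : R) (t : nat) :
  0 < delta -> (0 < d)%N ->
  exists C : R, 0 < C /\ forall (I : finType) (r : nat -> rel I) (D Q : nat),
    congruence_system r d D -> (0 < D)%N -> (0 < #|I|)%N ->
    wpairs r (d%:R + t.+1%:R * delta) Q ^+ (2 ^ t) <=
      C * (#|I| * D)%:R ^+ (2 ^ t).-1 * #|I|%:R ^+ 2.
Proof.
move=> d0 dpos; elim: t => [|t [C [C0 IH]]].
  exists (1 + delta^-1); split; first by rewrite addr_gt0// invr_gt0.
  move=> I r D Q hr D0 I0; rewrite expn0 expr1 mul1r /= expr0 mulr1 /wpairs.
  apply: (@le_trans _ _ (\sum_(q < Q) q.+1%:R `^ (- (1 + delta)) * #|I|%:R ^+ 2)).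
    apply: ler_sum => q _; apply: ler_pM; rewrite ?powR_ge0//.
      rewrite ler_powR ?ler1n// lerN2 lerD2r -[1]/(1%:R) ler_nat//.
    by rewrite -natrX ler_nat; exact: pairs_le.
  by rewrite -mulr_suml ler_wpM2r ?exprn_ge0// sum_powR_le.
have [K [K0 hK]] := divisors_subpolyR d0.
exists (K ^+ (2 ^ t) * C); split; first by rewrite mulr_gt0 ?exprn_gt0.
move=> I r D Q hr D0 I0; set s := d%:R + t.+2%:R * delta.
have hs : d%:R <= s by rewrite lerDl mulr_ge0// ltW.
have h1 : wpairs r s Q ^+ 2 <= (#|I| * D)%:R * (K * wpairs r (d%:R + t.+1%:R * delta) (Q * Q)).
  apply: le_trans (wpairs_sqr hr Q hs) _; rewrite ler_wpM2l//.
  apply: le_trans (sum_lcm_le Q (phi := fun n => n%:R `^ (- s) * (pairs r n)%:R) _) _.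
    by move=> n; rewrite mulr_ge0 ?powR_ge0.
  rewrite /wpairs mulr_sumr; apply: ler_sum => m _.
  rewrite mulrA [K * _]mulrA ler_wpM2r//.
  apply: (@le_trans _ _ (K * m.+1%:R `^ delta * m.+1%:R `^ (- s))).
    by rewrite ler_wpM2r ?powR_ge0// hK.
  rewrite -mulrA -powRD; last by rewrite pnatr_eq0 implybT.
  by rewrite ler_wpM2l ?(ltW K0)// ler_powR ?ler1n// /s -[t.+2%:R]natr1; lra.
have w0 s' Q' : 0 <= wpairs r s' Q'.
  by apply: sumr_ge0 => q _; rewrite mulr_ge0 ?powR_ge0.
rewrite expnS exprM.
apply: (@le_trans _ _ (((#|I| * D)%:R * (K * wpairs r (d%:R + t.+1%:R * delta) (Q * Q))) ^+ (2 ^ t))).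
  by rewrite lerXn2r// ?nnegrE ?exprn_ge0 ?w0// mulr_ge0// mulr_ge0 ?w0// ltW.
rewrite !exprMn; have := IH I r D (Q * Q)%N hr D0 I0.
set W := wpairs _ _ _ ^+ _; set m := (2 ^ t)%N => hW.
have m0 : (0 < m)%N by rewrite expn_gt0.
have -> : ((2 * m).-1 = m + m.-1)%N by lia.
rewrite exprD; set A := (_ * _)%:R ^+ m; set B := (_ * _)%:R ^+ m.-1 in hW *.
have -> : K ^+ m * C * (A * B) * #|I|%:R ^+ 2 = A * (K ^+ m * (C * B * #|I|%:R ^+ 2)) by ring.
by rewrite !ler_wpM2l ?exprn_ge0// ltW.
Qed.

(** * Weyl's theorem by van der Corput differencing *)

Lemma expn_addr n q j : exists K, ((n + q) ^ j = n ^ j + q * K)%N.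
Proof.
elim: j => [|j [K IH]]; first by exists 0%N; rewrite muln0.
exists (n ^ j + K * (n + q))%N; rewrite !expnS IH; ring.
Qed.

Lemma ltr_truncnS (R : realType) (x : R) : 0 <= x -> x < (Num.truncn x).+1%:R.
Proof. by move=> /truncn_itv/andP[]. Qed.

Section Weyl.
Variable R : realType.
Local Notation C := R[i].
Implicit Types (u : nat -> C) (f g : {poly R}).

(** The upper limit of the modulus of the means is at most [b]. The rank [N0] may depend on [u]: it
    will be maximised over finitely many sequences. *)
Definition mean_le u (b : R) : Prop :=
  forall eps, 0 < eps -> exists N0, forall N, (N0 <= N)%N ->
    cmod (\sum_(n < N) u n) <= (b + eps) * N%:R.

Lemma mean_le_bounded u (B : R) : (forall N, cmod (\sum_(n < N) u n) <= B) ->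
  mean_le u 0.
Proof.
move=> hB eps e0; exists (Num.truncn (B / eps)).+1 => N hN; rewrite add0r.
apply: le_trans (hB N) _; rewrite mulrC -ler_pdivrMr//.
have B0 : 0 <= B by apply: le_trans (hB 0%N); rewrite big_ord0 cmod0.
apply: (@le_trans _ _ (Num.truncn (B / eps)).+1%:R); last by rewrite ler_nat.
by rewrite ltW// ltr_truncnS// divr_ge0// ltW.
Qed.

Lemma sum_shift_diff u h N : (forall n, cmod (u n) <= 1) ->
  cmod (\sum_(n < N) u n - \sum_(n < N) u (n + h)%N) <= 2 * h%:R.
Proof.
move=> hu; elim: h => [|h IH].
  by under [X in _ - X]eq_bigr do rewrite addn0; rewrite subrr cmod0 mulr0.
have hs : \sum_(n < N) u (n + h)%N - \sum_(n < N) u (n + h.+1)%N = u h - u (N + h)%N.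
  elim: N {IH} => [|N IHN]; first by rewrite !big_ord0 add0n !subrr.
  rewrite !big_ord_recr /= (_ : (N + h.+1 = N.+1 + h)%N); last by rewrite addnS addSn.
  have -> : \sum_(n < N) u (n + h)%N + u (N + h)%N - (\sum_(n < N) u (n + h.+1)%N + u (N.+1 + h)%N)
    = (\sum_(n < N) u (n + h)%N - \sum_(n < N) u (n + h.+1)%N) + (u (N + h)%N - u (N.+1 + h)%N) by ring.
  by rewrite IHN; ring.
have -> : \sum_(n < N) u n - \sum_(n < N) u (n + h.+1)%N =
  (\sum_(n < N) u n - \sum_(n < N) u (n + h)%N) + (u h - u (N + h)%N) by rewrite -hs; ring.
apply: le_trans (cmodD _ _) _; rewrite -[h.+1%:R]natr1 mulrDr mulr1 lerD//.
apply: le_trans (cmodB _ _) _; have := hu h; have := hu (N + h)%N; lra.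
Qed.

Lemma cmod_sum_sqr (I : finType) (z : I -> C) :
  cmod (\sum_i z i) ^+ 2 <= #|I|%:R * \sum_i cmod (z i) ^+ 2.
Proof.
apply: le_trans (sqr_sum_le _); rewrite lerXn2r ?nnegrE ?cmod_ge0//.
  by apply: sumr_ge0 => i _; exact: cmod_ge0.
exact: cmod_sum.
Qed.

Lemma cmod_sqr_sum (I : finType) (z : I -> C) :
  (cmod (\sum_i z i) ^+ 2)%:C%C = \sum_i \sum_j z i * ((z j)^*)%C.
Proof.
rewrite -mulconjC mulr_suml; apply: eq_bigr => i _.
by rewrite rmorph_sum /= mulr_sumr.
Qed.

(** Averaging over [H] shifts changes the sum by at most [2 H]. Cauchy-Schwarz in [n] then leaves
    [H] diagonal terms out of [H ^ 2] and correlations that are negligible by hypothesis, so the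
    squared mean is of order [1/H]. *)
Lemma van_der_corput u : (forall n, cmod (u n) <= 1) ->
  (forall h h', h != h' -> mean_le (fun n => u (n + h)%N * ((u (n + h')%N)^*)%C) 0) ->
  mean_le u 0.
Proof.
move=> hu hcor eps e0.
(* Chosen so that [2 * ep] is the square of [eps / 2]; the other half of [eps] pays for the
   shifts. *)
pose ep := eps ^+ 2 / 8; have ep0 : 0 < ep by rewrite divr_gt0 ?exprn_gt0.
pose H := (Num.truncn ep^-1).+1.
have H0 : 0 < H%:R :> R by rewrite ltr0n.
have hH : 1 <= ep * H%:R.
  have /andP[_ h] : (Num.truncn ep^-1)%:R <= ep^-1 < H%:R by apply: truncn_itv; rewrite invr_ge0 ltW.
  by rewrite mulrC -ler_pdivrMr// div1r ltW.
have [N1 hN1] : exists N1, forall N, (N1 <= N)%N -> forall h h' : 'I_H, h != h' ->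
    cmod (\sum_(n < N) u (n + h)%N * ((u (n + h')%N)^*)%C) <= ep * N%:R.
  have hc (w : 'I_H * 'I_H) : exists N0, forall N, (N0 <= N)%N -> w.1 != w.2 ->
     cmod (\sum_(n < N) u (n + w.1)%N * ((u (n + w.2)%N)^*)%C) <= ep * N%:R.
    have [hw|hw] := eqVneq w.1 w.2; first by exists 0%N.
    have [N0 h0] := hcor _ _ hw _ ep0; exists N0 => N /h0; by rewrite add0r.
  have [F hF] := choice hc.
  exists (\max_w F w)%N => N hN h h' hh; apply: (hF (h, h')) => //.
  by apply: leq_trans hN; exact: leq_bigmax.
pose N2 := (Num.truncn (4 * H%:R / eps)).+1.
exists (maxn N1 N2) => N; rewrite geq_max => /andP[hNa hNb]; rewrite add0r.
have hN2 : 4 * H%:R <= eps * N%:R.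
  have /andP[_ h] : (Num.truncn (4 * H%:R / eps))%:R <= 4 * H%:R / eps < N2%:R.
    by apply: truncn_itv; rewrite divr_ge0 ?mulr_ge0// ltW.
  rewrite [eps * _]mulrC -ler_pdivrMr//; apply: (le_trans (ltW h)).
  by rewrite ler_nat.
pose b := cmod (\sum_(n < N) \sum_(h < H) u (n + h)%N).
have hb : b ^+ 2 <= (N%:R * H%:R * eps / 2) ^+ 2.
  apply: le_trans (cmod_sum_sqr _) _; rewrite card_ord.
  have hin : \sum_(n < N) cmod (\sum_(h < H) u (n + h)%N) ^+ 2 <=
     H%:R * N%:R + H%:R ^+ 2 * (ep * N%:R).
    apply: (@le_trans _ _ (\sum_(h < H) \sum_(h' < H) (N%:R * (h == h')%:R + ep * N%:R))); last first.
      have hN0 : 0 <= ep * N%:R by rewrite mulr_ge0// ltW.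
      under eq_bigr do rewrite big_split /= sumr_const card_ord -mulr_sumr.
      rewrite big_split /= sumr_const card_ord -mulr_sumr.
      under eq_bigr do rewrite -natr_sum.
      have h1 (i : 'I_H) : (\sum_(j < H) (i == j) = 1)%N.
        by rewrite (bigD1 i)//= eqxx big1 ?addn0// => j /negPf; rewrite eq_sym => ->.
      under eq_bigr do rewrite h1.
      by rewrite sumr_const card_ord -mulrnA -[_ *+ (H * H)]mulr_natl natrM expr2 mulrC.
    rewrite -lecR rmorph_sum /=; under eq_bigr do rewrite cmod_sqr_sum.
    rewrite exchange_big /= rmorph_sum /=.
    under eq_bigr do rewrite exchange_big /=.
    set X := \sum_(i < H) _; set Y := \sum_(i < H) _.
    (* Comparing [X] with its modulus requires it to be real, which is seen by writing it back as a
       sum of squared moduli. *)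
    have hX : X \is Num.real.
      have -> : X = (\sum_(n < N) cmod (\sum_(h < H) u (n + h)%N) ^+ 2)%:C%C.
        rewrite rmorph_sum /=; under [RHS]eq_bigr do rewrite cmod_sqr_sum.
        rewrite [RHS]exchange_big /=; apply: eq_bigr => i _; by rewrite exchange_big.
      by rewrite complex_real eqxx.
    apply: (le_trans (real_ler_norm hX)).
    apply: (le_trans (ler_norm_sum _ _ _)); apply: ler_sum => h _.
    apply: (le_trans (ler_norm_sum _ _ _)); rewrite rmorph_sum /=; apply: ler_sum => h' _.
    rewrite normr_cmod lecR; have [<-|hh] := eqVneq h h'; last first.
      by rewrite mulr0 add0r hN1.
    rewrite mulr1; apply: (@le_trans _ _ N%:R); last by rewrite lerDl mulr_ge0// ltW.
    apply: (le_trans (cmod_sum _ _ _)).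
    rewrite -[N in N%:R]card_ord -sumr_const; apply: ler_sum => n _.
    by rewrite cmodM cmodC mulr_ile1 ?cmod_ge0.
  apply: (le_trans (ler_wpM2l _ hin)) => //.
  have -> : (N%:R * H%:R * eps / 2) ^+ 2 = N%:R * (N%:R * H%:R * (H%:R * (2 * ep))).
    by rewrite /ep; field.
  rewrite ler_wpM2l//.
  have -> : H%:R * N%:R + H%:R ^+ 2 * (ep * N%:R) = N%:R * H%:R * (1 + H%:R * ep) by ring.
  by rewrite ler_wpM2l ?mulr_ge0//; nra.
have {}hb : b <= N%:R * H%:R * eps / 2.
  rewrite -(@ler_pXn2r _ 2)// nnegrE ?cmod_ge0// !mulr_ge0// ltW//.
have hH2 : H%:R * cmod (\sum_(n < N) u n) <= b + 2 * H%:R ^+ 2.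
  have -> : H%:R * cmod (\sum_(n < N) u n) = cmod (\sum_(h < H) \sum_(n < N) u n).
    by rewrite sumr_const card_ord -[X in _ = cmod X]mulr_natl cmodM cmod_nat.
  have -> : \sum_(h < H) \sum_(n < N) u n = \sum_(n < N) \sum_(h < H) u (n + h)%N +
     \sum_(h < H) (\sum_(n < N) u n - \sum_(n < N) u (n + h)%N).
    by rewrite sumrB [X in _ + (_ - X)]exchange_big /= addrC subrK.
  apply: (le_trans (cmodD _ _)); rewrite lerD//.
  apply: (le_trans (cmod_sum _ _ _)).
  apply: (@le_trans _ _ (\sum_(h < H) 2 * H%:R)).
    apply: ler_sum => h _; apply: (le_trans (sum_shift_diff _ _ hu)).
    by rewrite ler_wpM2l// ler_nat ltnW.
  by rewrite sumr_const card_ord -[_ *+ H]mulr_natl expr2 mulrCA.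
rewrite -(ler_pM2l H0); nra.
Qed.

Definition israt (c : R) : Prop := exists x : rat, c = ratr x.

Lemma isratD a b : israt a -> israt b -> israt (a + b).
Proof. by move=> [x ->] [y ->]; exists (x + y); rewrite rmorphD. Qed.

Lemma isratM a b : israt a -> israt b -> israt (a * b).
Proof. by move=> [x ->] [y ->]; exists (x * y); rewrite rmorphM. Qed.

Lemma isratN a : israt a -> israt (- a).
Proof. by move=> [x ->]; exists (- x); rewrite rmorphN. Qed.

Lemma isratV a : israt a -> israt a^-1.
Proof. by move=> [x ->]; exists x^-1; rewrite fmorphV. Qed.

Lemma israt_nat n : israt n%:R.
Proof. by exists n%:R; rewrite ratr_nat. Qed.

Lemma israt_sum (I : Type) (s : seq I) (P : pred I) (F : I -> R) :
  (forall i, P i -> israt (F i)) -> israt (\sum_(i <- s | P i) F i).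
Proof. by move=> h; elim/big_ind: _ => //; [exact: (israt_nat 0)|exact: isratD]. Qed.

Lemma israt_common_denom f k : (forall j, (k <= j)%N -> israt f`_j) ->
  exists q, (0 < q)%N /\ forall j, (k <= j)%N -> exists z : int, q%:R * f`_j = z%:~R.
Proof.
move=> hf.
have [n hn] : exists n, forall j, (n <= j)%N -> f`_j = 0.
  by exists (size f) => j; exact: nth_default.
suff [q [q0 hq]] : exists q, (0 < q)%N /\ forall j, (k <= j < n)%N ->
    exists z : int, q%:R * f`_j = z%:~R.
  exists q; split=> // j kj; have [jn|/hn ->] := ltnP j n; last by exists 0; rewrite mulr0.
  by apply: hq; rewrite kj.
elim: n {hn} => [|n [q [q0 IH]]]; first by exists 1%N; split=> // j; rewrite ltn0 andbF.
have [kn|kn] := leqP k n; last first.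
  by exists q; split=> // j /andP[h1 h2]; apply: IH; lia.
have [x hx] := hf n kn.
exists (q * absz (denq x))%N; split; first by rewrite muln_gt0 q0 absz_gt0 denq_neq0.
move=> j /andP[kj]; rewrite ltnS leq_eqVlt => /orP[/eqP ->|jn].
  exists (q%:Z * numq x); rewrite hx.
  have hd : (absz (denq x))%:R = (denq x)%:~R :> R by rewrite -[in RHS]absz_denq.
  rewrite natrM hd /ratr rmorphM /=; field.
  by rewrite intr_eq0 denq_eq0.
have [|z hz] := IH j; first by rewrite kj.
exists ((absz (denq x))%:Z * z); rewrite natrM rmorphM /= -hz; ring.
Qed.

Lemma poly_shift_diff f (h h' : R) :
  exists g, (forall x, g.[x] = f.[x + h] - f.[x + h']) /\
    forall j, g`_j = \sum_(i < size f - j) (f`_(j + i) *+ 'C(j + i, j)) * (h ^+ i - h' ^+ i).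
Proof.
exists (\poly_(j < size f) ((f^`N(j)).[h] - (f^`N(j)).[h'])); split.
  move=> x; rewrite [x + h]addrC [x + h']addrC !nderiv_taylor; try exact: mulrC.
  rewrite -sumrB horner_poly; apply: eq_bigr => i _; ring.
move=> j; rewrite coef_poly; case: ltnP => hj; last first.
  by rewrite (eqP (hj : (_ - _ == 0)%N)) big_ord0.
by rewrite !horner_poly -sumrB; apply: eq_bigr => i _; rewrite mulrBr.
Qed.

(** Induction on the largest index of an irrational coefficient. If it is 1, a shift by a common
    denominator [q] of the higher coefficients multiplies the sequence by a constant other than 1,
    so the sums are bounded. Otherwise differencing lowers the index by one. *)
Lemma weyl_irrational f l : (forall j, (l.+1 < j)%N -> israt f`_j) ->
  ~ israt f`_l.+1 -> mean_le (fun n => chi f.[n%:R]) 0.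
Proof.
elim: l f => [|l IH] f hr hi.
  have [q [q0 hq]] := israt_common_denom hr.
  have qR : q%:R != 0 :> R by rewrite pnatr_eq0 -lt0n.
  pose z := chi (q%:R * f`_1).
  have z1 : z != 1.
    apply/eqP => /chi_eq1[y hy]; apply: hi.
    exists (y%:~R / q%:R); rewrite rmorphM fmorphV /= ratr_int ratr_nat; by rewrite -hy mulrAC mulfV// mul1r.
  have hper (n : nat) : chi f.[(n + q)%N%:R] = z * chi f.[n%:R].
    have hint : exists y : int, f.[(n + q)%N%:R] = f.[n%:R] + q%:R * f`_1 + y%:~R.
      rewrite !(@horner_coef_wide _ (size f).+2 f) ?leqW//.
      rewrite !big_ord_recl /= !expr0 !expr1 /bump /= !add1n.
      set S1 := \sum_(i < _) _; set S2 := \sum_(i < _) _.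
      have : S1 - S2 \is a Num.int.
        rewrite -sumrB; apply: rpred_sum => i _.
        have [K hK] := expn_addr n q i.+2.
        have [y2 hy2] := hq i.+2 isT.
        apply/intrP; exists (y2 * K%:Z); rewrite !add1n rmorphM /= -hy2 -!natrX hK natrD natrM.
        by rewrite -pmulrn; ring.
      case/intrP => y2 hy2; exists y2; rewrite natrD -hy2; ring.
    by have [y ->] := hint; rewrite chiDint chiD mulrC.
  apply: (@mean_le_bounded _ (2 * q%:R / cmod (1 - z))) => N.
  have c0 : 0 < cmod (1 - z).
    by rewrite lt_def cmod_ge0 andbT; apply/eqP => /cmod_eq0/eqP; rewrite subr_eq0 eq_sym (negPf z1).
  rewrite ler_pdivlMr// mulrC -cmodM mulrBl mul1r mulr_sumr.
  under [X in _ - X]eq_bigr do rewrite -hper.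
  apply: (sum_shift_diff (u := fun n => chi f.[n%:R])) => n; by rewrite cmod_chi.
apply: van_der_corput => [n|h h' hh]; first by rewrite cmod_chi.
have [g [hg1 hg2]] := poly_shift_diff f h%:R h'%:R.
have hgn n : chi f.[(n + h)%N%:R] * ((chi f.[(n + h')%N%:R])^*)%C = chi g.[n%:R].
  by rewrite -chiN -chiD hg1 !natrD.
rewrite (_ : (fun n => _) = (fun n => chi g.[n%:R])); last by apply/funext => n; exact: hgn.
have ratdiff i : israt (h%:R ^+ i - h'%:R ^+ i).
  by apply: isratD; [|apply: isratN]; rewrite -natrX; exact: israt_nat.
apply: IH.
  move=> j hj; rewrite hg2; apply: israt_sum => -[[|i] hi'] _ /=.
    by rewrite !expr0 subrr mulr0; exact: (israt_nat 0).
  apply: isratM => //; rewrite -mulr_natr; apply: isratM; last exact: israt_nat.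
  by apply: hr; lia.
move=> hg.
have hsz : (1 < size f - l.+1)%N.
  rewrite ltnNge; apply/negP => hs; apply: hi; rewrite nth_default; last by move: hs; rewrite leq_subLR addn1.
  exact: (israt_nat 0).
apply: hi; move: hg; rewrite hg2.
move: hsz; case: (size f - l.+1)%N => [//|[//|m]] _.
rewrite big_ord_recl /= !expr0 subrr mulr0 add0r big_ord_recl /= /bump /= add1n !expr1 addn1.
set S := \sum_(i < m) _ => hS.
have hS2 : israt S.
  apply: israt_sum => i _; apply: isratM => //; rewrite -mulr_natr; apply: isratM; last exact: israt_nat.
  by apply: hr; rewrite /bump; lia.
have h0 : (l.+2)%:R * (h%:R - h'%:R) != 0 :> R.
  by rewrite mulf_neq0 ?pnatr_eq0// subr_eq0 eqr_nat.
(* The leading irrational coefficient is solved for from the coefficient of the difference, which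
   was assumed rational. *)
have -> : f`_l.+2 = ((f`_l.+2 *+ 'C(l.+2, l.+1)) * (h%:R - h'%:R) + S - S) / (l.+2%:R * (h%:R - h'%:R)).
  rewrite [X in _ = X / _](_ : _ = f`_l.+2 * (l.+2%:R * (h%:R - h'%:R))) ?mulfK//.
  by rewrite addrK binSn -[f`_l.+2 *+ _]mulr_natr mulrA.
apply: isratM; first by apply: isratD => //; exact: isratN.
apply: isratV; apply: isratM; first exact: israt_nat.
by apply: isratD; [|apply: isratN]; exact: israt_nat.
Qed.

End Weyl.

(** * Hua's bound for all moduli, and means of polynomial phases *)

Lemma powR_exp_comm (R : realType) (a x : R) n : 0 <= a ->
  (a ^+ n) `^ x = (a `^ x) ^+ n.
Proof.
move=> a0; rewrite -powR_mulrn// -powRrM mulrC powRrM powR_mulrn//.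
exact: powR_ge0.
Qed.

Section HuaGeneral.
Variables (R : realType) (e : nat).
Hypothesis e0 : (0 < e)%N.

Lemma redpZ p (a : int) (f : {poly int}) : redp p (a *: f) = a%:~R *: redp p f.
Proof. by apply/polyP => i; rewrite coefZ !redp_coef coefZ rmorphM. Qed.

(** Prime powers are split off one at a time, each at the cost of a constant factor. The product
    over the prime divisors of [q] is [q ^ o(1)], as for the divisor function. *)
Lemma hua_general q (f : {poly int}) : (0 < q)%N -> (size f <= e.+1)%N ->
  (forall p, prime p -> (p %| q)%N -> (1 < size (redp p f))%N) ->
  cmod (expsum R q f) <=
    (\prod_(p <- primes q) (hua_const e * e))%N%:R * (q%:R * q%:R `^ (- e%:R^-1)).
Proof.
have [n] := ubnP q; elim: n q f => // n IH q f hn q0 hs hf.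
have [q1|q1] := leqP q 1.
  have -> : q = 1%N by apply/eqP; rewrite eqn_leq q1.
  rewrite big_nil mul1r powR1 mulr1; exact: cmod_expsum_le.
pose p := pdiv q; have pp : prime p by exact: pdiv_prime.
have [m hpm hq] := pfactor_coprime pp q0; set l := logn p q in hq.
have l0 : (0 < l)%N by rewrite logn_gt0 mem_primes pp q0 pdiv_dvd.
have m0 : (0 < m)%N by move: q0; rewrite hq muln_gt0 => /andP[].
have pl0 : (0 < p ^ l)%N by rewrite expn_gt0 prime_gt0.
have cpl : coprime (p ^ l) m by rewrite coprimeXl.
rewrite mulnC in hq.
have [a [b [ha hb hab]]] := expsum_mul R f pl0 m0 cpl.
have hscale (c : int) (q' p' : nat) : prime p' -> (p' %| q')%N -> (q' %| q)%N -> coprimez c q' ->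
    (1 < size (redp p' (c *: f)))%N.
  move=> pp' hp' hq' hc; rewrite redpZ size_scale.
    by apply: hf => //; exact: dvdn_trans hp' hq'.
  rewrite -dvdz_Fp//; apply/negP => hpc.
  have : (p' %| gcdz c q')%Z by rewrite dvdz_gcd hpc.
  rewrite (eqP hc) dvdzE /= dvdn1 => /eqP p1.
  by move: pp'; rewrite p1.
have hs' (c : int) : (size (c *: f) <= e.+1)%N by rewrite (leq_trans (size_scale_leq _ _)).
pose be := p%:R `^ (- e%:R^-1) : R.
have pR : 0 < p%:R :> R by rewrite ltr0n prime_gt0.
have be0 : 0 < be by exact: powR_gt0.
have hbe : be ^+ e * p%:R = 1.
  rewrite -powR_mulrn ?(ltW be0)// -powRrM mulNr mulVf ?pnatr_eq0 -?lt0n//.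
  by rewrite powR_inv1 ?(ltW pR)// mulVf// gt_eqF.
have h1 : cmod (expsum R (p ^ l) (a *: f)) <=
    (hua_const e * e)%:R * ((p ^ l)%:R * (p ^ l)%:R `^ (- e%:R^-1)).
  rewrite [X in X `^ _]natrX powR_exp_comm ?(ltW pR)//.
  apply: hua_prime_power => //; apply: (hscale _ (p ^ l)%N) => //.
    by rewrite -{1}(expn1 p) dvdn_exp2l.
  by rewrite hq dvdn_mulr.
have h2 : cmod (expsum R m (b *: f)) <=
    (\prod_(p <- primes m) (hua_const e * e))%N%:R * (m%:R * m%:R `^ (- e%:R^-1)).
  apply: IH => //; last first.
    by move=> p' pp' hp'; apply: (hscale _ m) => //; rewrite hq dvdn_mull.
  rewrite -ltnS (leq_trans _ hn)// hq ltnS ltn_Pmull//.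
  by rewrite -{1}(expn0 p) ltn_exp2l// prime_gt1.
have hprimes : perm_eq (primes q) (p :: primes m).
  apply: uniq_perm; rewrite ?primes_uniq//=.
    rewrite primes_uniq andbT mem_primes pp m0 /=.
    by rewrite -prime_coprime.
  by move=> p'; rewrite hq inE primesM// primesX// primes_prime// inE.
rewrite (perm_big _ hprimes) /= big_cons hq hab cmodM.
apply: le_trans (ler_pM (cmod_ge0 _) (cmod_ge0 _) h1 h2) _.
rewrite le_eqVlt; apply/orP; left; apply/eqP; rewrite !natrM powRM//; ring.
Qed.

Lemma hua_bound (delta : R) : 0 < delta ->
  exists C : R, 0 < C /\ forall q (f : {poly int}), (0 < q)%N -> (size f <= e.+1)%N ->
  (forall p, prime p -> (p %| q)%N -> (1 < size (redp p f))%N) ->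
  cmod (expsum R q f) <= C * q%:R `^ (- e%:R^-1 + delta) * q%:R.
Proof.
move=> d0; pose u := (Num.truncn (delta^-1)).+1.
have hu : u%:R^-1 <= delta.
  rewrite -[leRHS]invrK lef_pV2 ?posrE ?invr_gt0// ltW//.
  by apply: ltr_truncnS; rewrite invr_ge0 ltW.
have K0 : (0 < hua_const e * e)%N by rewrite muln_gt0 e0 hua_const_gt0.
have [C [C0 hC]] := prod_primes_subpoly K0 (ltn0Sn u.-1).
exists (C%:R `^ u%:R^-1); split; first by rewrite powR_gt0// ltr0n.
move=> q f q0 hs hf; apply: le_trans (hua_general q0 hs hf) _.
rewrite [q%:R * _]mulrC mulrA ler_wpM2r//.
set W := (\prod_(p <- primes q) _)%N.
have hW : (W%:R ^+ u <= (C * q)%:R :> R).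
  rewrite -natrX ler_nat; apply: leq_trans (hC q q0); rewrite leq_exp2r//.
  by apply: leq_prod => p _; rewrite leq_pmulr.
have {}hW : W%:R <= C%:R `^ u%:R^-1 * q%:R `^ delta.
  have -> : W%:R = (W%:R ^+ u) `^ u%:R^-1 :> R.
    by rewrite -powR_mulrn// -powRrM mulfV ?pnatr_eq0// powRr1.
  apply: (@le_trans _ _ ((C * q)%:R `^ u%:R^-1)).
    by rewrite ge0_ler_powR ?invr_ge0// nnegrE ?exprn_ge0.
  by rewrite natrM powRM// ler_wpM2l ?powR_ge0// ler_powR// ler1n.
rewrite addrC powRD; last by rewrite pnatr_eq0 (gtn_eqF q0) implybT.
by rewrite mulrA ler_wpM2r ?powR_ge0.
Qed.

Lemma mean_periodic (u : nat -> R[i]) q (B : R) : (0 < q)%N ->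
  (forall n, u (n + q)%N = u n) -> (forall n, cmod (u n) <= 1) ->
  cmod (\sum_(n < q) u n) <= B * q%:R -> mean_le u B.
Proof.
move=> q0 hu hu1 hB eps ep0; exists (Num.truncn (q%:R / eps)).+1 => N hN.
have hN2 : q%:R <= eps * N%:R.
  rewrite mulrC -ler_pdivrMr//; apply: le_trans (ltW (ltr_truncnS _)) _.
    by rewrite divr_ge0// ltW.
  by rewrite ler_nat.
have qR : 0 < q%:R :> R by rewrite ltr0n.
have B0 : 0 <= B by rewrite -(pmulr_lge0 _ qR) (le_trans _ hB)// cmod_ge0.
have hsum a c : cmod (\sum_(n < a + c) u n) <= cmod (\sum_(n < a) u n) + c%:R.
  rewrite big_split_ord /=; apply: le_trans (cmodD _ _) _; rewrite lerD2l.
  apply: le_trans (cmod_sum _ _ _) _.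
  apply: (@le_trans _ _ (\sum_(i < c) 1)); first by apply: ler_sum => i _; exact: hu1.
  by rewrite sumr_const card_ord.
have hN' : (q * (N %/ q) + N %% q = N)%N by rewrite mulnC -divn_eq.
have := hsum (q * (N %/ q))%N (N %% q)%N; rewrite hN' => /le_trans; apply.
rewrite (sum_periodic_mul _ hu) -[_ *+ _]mulr_natr cmodM cmod_nat mulrDl lerD//; last first.
  by apply: le_trans hN2; rewrite ler_nat ltnW// ltn_pmod.
apply: (@le_trans _ _ (B * q%:R * (N %/ q)%:R)); first by rewrite ler_wpM2r.
by rewrite -mulrA ler_wpM2l// -natrM ler_nat mulnC leq_trunc_div.
Qed.

Lemma mean_le_mono (u : nat -> R[i]) (B B' : R) : B <= B' -> mean_le u B -> mean_le u B'.
Proof.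
move=> hB h eps ep0; have [N0 hN0] := h eps ep0; exists N0 => N /hN0 h1.
by apply: le_trans h1 _; rewrite ler_wpM2r// lerD2r.
Qed.

(** If a coefficient of positive index is irrational, Weyl's theorem at the largest such index gives
    mean 0. Otherwise the least common denominator [q] exceeds [Q], and its minimality makes the
    numerator nonconstant modulo every prime factor of [q], as Hua's bound requires. *)
Lemma mean_poly (delta : R) : 0 < delta -> delta < e%:R^-1 ->
  exists C : R, 0 < C /\ forall (g : {poly R}) (Q : nat), (size g <= e.+1)%N -> (0 < Q)%N ->
    (forall q, (0 < q <= Q)%N ->
       ~ (forall j, (0 < j)%N -> q%:R * g`_j \is a Num.int)) ->
    mean_le (fun n => chi g.[n%:R]) (C * Q%:R `^ (- e%:R^-1 + delta)).
Proof.
move=> d0 de; have [C [C0 hC]] := hua_bound d0; exists C; split=> // g Q hsg Q0 hQ.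
have [hrat|] := pselect (forall j, (0 < j)%N -> israt g`_j); last first.
  move=> /existsNP[j0 /not_implyP[hj0 irr0]].
  have hex : exists j, `[< (0 < j)%N /\ ~ israt g`_j >] by exists j0; apply/asboolP.
  have hub j : `[< (0 < j)%N /\ ~ israt g`_j >] -> (j <= size g)%N.
    move/asboolP => [_ hj]; rewrite leqNgt; apply/negP => h; apply: hj.
    by rewrite nth_default ?(ltnW h)//; exact: (israt_nat _ 0).
  case: (ex_maxnP hex hub) => j /asboolP[jpos irr] hmax.
  apply: (@mean_le_mono _ 0); first by rewrite mulr_ge0 ?powR_ge0// ltW.
  apply: (@weyl_irrational _ _ j.-1); rewrite prednK// => i hi.
  apply: contrapT => hni; have := hmax i; rewrite asboolT; last by split=> //; lia.
  by move=> /(_ isT); lia.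
have [q1 [q10 hq1]] := israt_common_denom hrat.
pose good q := `[< (0 < q)%N /\ forall j, (0 < j)%N -> q%:R * g`_j \is a Num.int >].
have hex : exists q, good q.
  by exists q1; apply/asboolP; split=> // j /hq1 hz; apply/intrP.
case: (ex_minnP hex) => q /asboolP[q0 hq] hmin.
have hqQ : (Q < q)%N.
  by rewrite ltnNge; apply/negP => hle; apply: (hQ q) => //; rewrite q0.
have qR : q%:R != 0 :> R by rewrite pnatr_eq0 -lt0n.
(* The constant coefficient, possibly irrational, is left out: it only yields a factor of modulus 1.
   The other floors are exact by [hq]. *)
pose f := \poly_(j < e.+1) (if j == 0%N then 0 else Num.floor (q%:R * g`_j)).
have hf j : (0 < j)%N -> (f`_j)%:~R = q%:R * g`_j.
  move=> j0; rewrite coef_poly (gtn_eqF j0); case: ltnP => hj; first exact: floorK (hq j j0).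
  by rewrite nth_default ?mulr0// (leq_trans hsg).
have hf0 : f`_0 = 0 by rewrite coef_poly.
have hchi n : chi g.[n%:R] = chi g`_0 * chi ((f.[n%:Z])%:~R / q%:R).
  rewrite -chiD; congr chi; rewrite (horner_coef_wide _ hsg) (@horner_coef_wide _ e.+1 f) ?size_poly//.
  rewrite !big_ord_recl /= hf0 mul0r add0r expr0 mulr1; congr (_ + _).
  rewrite rmorph_sum /= mulr_suml; apply: eq_bigr => i _.
  rewrite rmorphM /= hf// rmorphXn /= -pmulrn; field.
  exact: qR.
rewrite (_ : (fun n => _) = (fun n => chi g`_0 * chi ((f.[n%:Z])%:~R / q%:R))); last exact/funext.
apply: (@mean_le_mono _ (C * q%:R `^ (- e%:R^-1 + delta))).
  rewrite ler_wpM2l ?(ltW C0)//.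
  pose x := e%:R^-1 - delta; have hx : 0 <= x by rewrite subr_ge0 ltW.
  have -> : - e%:R^-1 + delta = - x by rewrite opprB addrC.
  rewrite !powRN lef_pV2 ?posrE ?powR_gt0 ?ltr0n//.
  by rewrite ge0_ler_powR ?nnegrE// ler_nat ltnW.
apply: (@mean_periodic _ q) => // [n|n|].
- by rewrite chi_poly_periodic.
- by rewrite cmodM !cmod_chi mulr1.
rewrite -mulr_sumr cmodM cmod_chi mul1r.
apply: hC => //; first exact: size_poly.
move=> p pp pq; rewrite ltnNge; apply/negP => hsz.
have hdiv j : (0 < j)%N -> (p%:Z %| f`_j)%Z.
  by move=> j0; rewrite dvdz_Fp// -redp_coef nth_default// (leq_trans hsz).
have hqp : (0 < q %/ p)%N by rewrite divn_gt0 ?prime_gt0// dvdn_leq.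
(* If [p] divided all the numerators, [q %/ p] would be a smaller common denominator. *)
have : (q <= q %/ p)%N.
  apply: hmin; apply/asboolP; split=> // j j0; have /dvdzP[z hz] := hdiv j j0.
  apply/intrP; exists z; have := hf j j0; rewrite hz -{1}(divnK pq) natrM rmorphM /= -pmulrn => h.
  have pR : p%:R != 0 :> R by rewrite pnatr_eq0 -lt0n prime_gt0.
  by apply: (mulIf pR); rewrite h; ring.
by rewrite leqNgt ltn_Pdiv// prime_gt1.
Qed.

End HuaGeneral.

(** * The trigonometric kernel and large Fourier coefficients *)

Lemma card_eq_pairs_ge (R : realFieldType) (T V : finType) (f : T -> V) :
  #|T|%:R ^+ 2 <= #|V|%:R * (\sum_(w : T * T) (f w.1 == f w.2))%N%:R :> R.
Proof.
pose n v := (\sum_(a : T) (f a == v))%N.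
have h1 : (#|T| = \sum_v n v)%N.
  rewrite /n exchange_big /= -sum1_card; apply: eq_bigr => a _.
  by rewrite (bigD1 (f a))//= eqxx big1 ?addn0// => v /negPf; rewrite eq_sym => ->.
have h2 : (\sum_(w : T * T) (f w.1 == f w.2) = \sum_v n v ^ 2)%N.
  rewrite -(pair_bigA _ (fun a b => (f a == f b : nat))) /=.
  under [RHS]eq_bigr do rewrite -mulnn /n big_distrl /=.
  rewrite [RHS]exchange_big /=; apply: eq_bigr => a _.
  rewrite [RHS](bigD1 (f a))//= eqxx mul1n [X in _ = (_ + X)%N]big1 ?addn0; last first.
    by move=> v /negPf; rewrite eq_sym => ->; rewrite mul0n.
  by apply: eq_bigr => b _; rewrite eq_sym.
rewrite h1 h2 !natr_sum; apply: le_trans (sqr_sum_le _) _.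
by rewrite ler_wpM2l//; under [leRHS]eq_bigr do rewrite natrX.
Qed.

Section Kernel.
Variables (R : realType) (d r M k : nat).
Hypotheses (r0 : (0 < r)%N) (M0 : (0 < M)%N).
Local Notation C := R[i].

(** Expanding the product of the [r]-th powers of Dirichlet kernels, a term is a choice of [r]
    exponents per coordinate, and a pair of choices gives a term of the squared modulus, of
    frequency [fdiff]. Listing frequencies with multiplicity avoids computing Fourier
    coefficients. *)
Definition freqT := {ffun 'I_d -> {ffun 'I_r -> 'I_M}}.
Definition fsum (a : freqT) (i : 'I_d) : nat := (\sum_(t < r) a i t)%N.
Definition fdiff (w : freqT * freqT) (i : 'I_d) : int := (fsum w.1 i)%:Z - (fsum w.2 i)%:Z.

Lemma fsum_lt a i : (fsum a i < r * M)%N.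
Proof.
apply: (@leq_ltn_trans (\sum_(t < r) M.-1)).
  by apply: leq_sum => t _; rewrite -ltnS prednK.
by rewrite sum_nat_const card_ord ltn_pmul2l// prednK.
Qed.

Lemma absz_fdiff w i : (absz (fdiff w i) <= r * M)%N.
Proof. by have := fsum_lt w.1 i; have := fsum_lt w.2 i; rewrite /fdiff; lia. Qed.

Lemma card_freqT : (#|freqT| = M ^ (r * d))%N.
Proof. by rewrite !card_ffun !card_ord expnM. Qed.

Definition zeros : nat := (\sum_(w : freqT * freqT) [forall i, fdiff w i == 0])%N.

(** Pigeonhole for the vectors of sums, which take at most [(r * M) ^ d] values. [zeros] is the mean
    of the squared kernel. *)
Lemma zeros_ge : #|freqT|%:R ^+ 2 <= (r * M)%:R ^+ d * zeros%:R :> R.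
Proof.
pose f (a : freqT) : {ffun 'I_d -> 'I_(r * M)} := [ffun i => Ordinal (fsum_lt a i)].
have cV : #|{ffun 'I_d -> 'I_(r * M)}| = ((r * M) ^ d)%N by rewrite card_ffun !card_ord.
have := card_eq_pairs_ge R f; rewrite cV natrX.
have -> // : zeros = (\sum_(w : freqT * freqT) (f w.1 == f w.2))%N.
apply: eq_bigr => w _; congr nat_of_bool; apply/esym.
apply/eqP/forallP => [h i|h].
  rewrite /fdiff subr_eq0; apply/eqP; congr Posz.
  by have /ffunP/(_ i) := h; rewrite !ffunE => -[].
apply/ffunP => i; rewrite !ffunE; apply: val_inj => /=.
by have := h i; rewrite /fdiff subr_eq0 => /eqP[].
Qed.

Definition dirich (t : R) : C := \sum_(j < M) chi (j%:R * t).

Lemma prod_dirich (t : 'I_d -> R) :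
  \prod_(i < d) dirich (t i) ^+ r = \sum_(a : freqT) chi (\sum_(i < d) (fsum a i)%:R * t i).
Proof.
have h i : dirich (t i) ^+ r = \sum_(a : {ffun 'I_r -> 'I_M}) chi ((\sum_(j < r) a j)%N%:R * t i).
  rewrite -[in LHS](card_ord r) -prodr_const /dirich.
  rewrite (bigA_distr_bigA (fun _ (j : 'I_M) => chi (j%:R * t i))) /=.
  apply: eq_bigr => a _; rewrite -chi_sum natr_sum mulr_suml//.
under eq_bigr do rewrite h.
rewrite (bigA_distr_bigA (fun i (a : {ffun 'I_r -> 'I_M}) => chi ((\sum_(j < r) a j)%N%:R * t i))) /=.
by apply: eq_bigr => a _; rewrite -chi_sum.
Qed.

Lemma cmod_dirich_le t : cmod (dirich t) <= M%:R.
Proof.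
apply: le_trans (cmod_sum _ _ _) _.
by under eq_bigr do rewrite cmod_chi; rewrite sumr_const card_ord.
Qed.

Lemma cmod_dirich_far t (eps : R) : 0 < eps ->
  (forall z : int, eps <= `|t - z%:~R|) -> cmod (dirich t) <= eps^-1.
Proof.
move=> e0 h; have h1 := cmod1B_chi_dist h; have h2 := cmod_chi_geom t M.
rewrite -/(dirich t) in h2; have h3 := cmod_ge0 (dirich t).
rewrite -div1r ler_pdivlMr//; nra.
Qed.

Definition fcoef (y : 'I_k -> 'I_d -> R) (w : freqT * freqT) : C :=
  \sum_(j < k) chi (\sum_(i < d) (fdiff w i)%:~R * y j i).

Lemma cmod_prod_dirich (t : 'I_d -> R) :
  (cmod (\prod_(i < d) dirich (t i) ^+ r) ^+ 2)%:C%C =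
  \sum_(w : freqT * freqT) chi (\sum_(i < d) (fdiff w i)%:~R * t i).
Proof.
rewrite prod_dirich cmod_sqr_sum pair_bigA; apply: eq_bigr => w _.
rewrite -chiN -chiD; congr chi; rewrite -sumrN -big_split; apply: eq_bigr => i _.
by rewrite /= /fdiff rmorphB /= -!pmulrn mulrBl.
Qed.

Lemma fcoefC (y : 'I_k -> 'I_d -> R) w :
  ((fcoef y w)^*)%C = \sum_(j < k) chi (- \sum_(i < d) (fdiff w i)%:~R * y j i).
Proof. by rewrite /fcoef rmorph_sum; apply: eq_bigr => j _; rewrite chiN. Qed.

(* If every point is far from [zeta] then the kernel [|G|^2], which has
   nonnegative Fourier coefficients and a large mean, is small at all
   [zeta - y j]; hence the nonzero frequencies must compensate. *)
Lemma fcoef_large (y : 'I_k -> 'I_d -> R) (zeta : 'I_d -> R) (eps : R) :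
  (0 < d)%N -> 0 < eps ->
  (forall j, exists i, forall z : int, eps <= `|zeta i - y j i - z%:~R|) ->
  2 * (r * M)%:R ^+ d * eps^-1 ^+ (2 * r) <= M%:R ^+ (2 * r) ->
  #|freqT|%:R ^+ 2 * k%:R ^+ 2 <= 4 * (r * M)%:R ^+ (2 * d) *
    \sum_(w : freqT * freqT | ~~ [forall i, fdiff w i == 0]) cmod (fcoef y w) ^+ 2.
Proof.
move=> d0 e0 hfar hM.
pose G j := \prod_(i < d) dirich (zeta i - y j i) ^+ r.
pose Z := zeros.
have MR : 0 < M%:R :> R by rewrite ltr0n.
(* At the far coordinate the Dirichlet kernel is at most [eps^-1], elsewhere at most [M]; by [hM]
   the squared kernel is then at most half the lower bound of [zeros_ge] for its mean. *)
have hG j : 2 * (r * M)%:R ^+ d * cmod (G j) ^+ 2 <= #|freqT|%:R ^+ 2.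
  have [i hi] := hfar j.
  have hGe : cmod (G j) ^+ 2 <= eps^-1 ^+ (2 * r) * M%:R ^+ (2 * r * d.-1).
    rewrite /G (bigD1 i)//= cmodM exprMn cmodX -exprM.
    apply: ler_pM; rewrite ?exprn_ge0 ?cmod_ge0//.
      rewrite mulnC lerXn2r ?nnegrE ?cmod_ge0 ?invr_ge0 ?(ltW e0)//.
      exact: cmod_dirich_far.
    have -> : (2 * r * d.-1 = (r * d.-1) * 2)%N by lia.
    rewrite [leRHS]exprM lerXn2r ?nnegrE ?cmod_ge0 ?exprn_ge0//.
    have -> : M%:R ^+ (r * d.-1) = \prod_(i' < d | i' != i) M%:R ^+ r :> R.
      by rewrite exprM prodr_const cardC1 card_ord.
    elim/big_ind2: _ => [||i' _]; first by rewrite cmod1.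
      by move=> a b a' b' h1 h2; rewrite cmodM ler_pM ?cmod_ge0.
    by rewrite cmodX lerXn2r ?nnegrE ?cmod_ge0// cmod_dirich_le.
  apply: le_trans (ler_wpM2l _ hGe) _; first by rewrite mulr_ge0 ?exprn_ge0.
  rewrite mulrA; apply: le_trans (ler_wpM2r _ hM) _; first by rewrite exprn_ge0.
  rewrite -exprD card_freqT natrX -exprM -mulnS prednK//.
  by have -> : (2 * r * d = r * d * 2)%N by lia.
have hexp : (\sum_(j < k) cmod (G j) ^+ 2)%:C%C =
    \sum_(w : freqT * freqT) chi (\sum_(i < d) (fdiff w i)%:~R * zeta i) * ((fcoef y w)^*)%C.
  rewrite rmorph_sum /=; under eq_bigr do rewrite /G cmod_prod_dirich.
  rewrite exchange_big /=; apply: eq_bigr => w _.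
  rewrite fcoefC mulr_sumr; apply: eq_bigr => j _; rewrite -chiD; congr chi.
  by rewrite -sumrN -big_split /=; apply: eq_bigr => i _; ring.
pose P (w : freqT * freqT) := [forall i, fdiff w i == 0].
have hzero : (Z * k)%:R = \sum_(w | P w) chi (\sum_(i < d) (fdiff w i)%:~R * zeta i) * ((fcoef y w)^*)%C :> C.
  rewrite /Z /zeros natrM natr_sum mulr_suml.
  rewrite [RHS]big_mkcond /=; apply: eq_bigr => w _; rewrite -/(P w).
  case: ifP => hw; last by rewrite mul0r.
  have hf (v : 'I_d -> R) : \sum_(i < d) (fdiff w i)%:~R * v i = 0.
    by rewrite big1// => i _; have /forallP/(_ i)/eqP -> := hw; rewrite mul0r.
  rewrite hf chi0 !mul1r /fcoef; under eq_bigr do rewrite hf chi0.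
  by rewrite sumr_const card_ord conjc_nat.
have hsum : (Z * k)%:R <= \sum_(j < k) cmod (G j) ^+ 2 + \sum_(w | ~~ P w) cmod (fcoef y w).
  have -> : (Z * k)%:R = cmod ((\sum_(j < k) cmod (G j) ^+ 2)%:C%C -
     \sum_(w | ~~ P w) chi (\sum_(i < d) (fdiff w i)%:~R * zeta i) * ((fcoef y w)^*)%C).
    by rewrite hexp (bigID P) /= addrK -hzero cmod_nat.
  apply: le_trans (cmodB _ _) _; rewrite cmod_real ger0_norm ?lerD2l; last first.
    by apply: sumr_ge0 => j _; rewrite exprn_ge0 ?cmod_ge0.
  apply: le_trans (cmod_sum _ _ _) _; apply: ler_sum => w _.
  by rewrite cmodM cmod_chi mul1r cmodC.
set B := (r * M)%:R ^+ d in hG hM *.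
have B0 : 0 < B :> R by rewrite exprn_gt0// ltr0n muln_gt0 r0.
set T := #|freqT|%:R in hG *.
have T0 : 0 < T :> R by rewrite /T card_freqT ltr0n expn_gt0 M0.
have hZ : T ^+ 2 <= B * Z%:R by exact: zeros_ge.
set S1 := \sum_(w | ~~ P w) cmod (fcoef y w) in hsum.
set S2 := \sum_(w | _) _ ^+ 2.
have hGs : 2 * B * (\sum_(j < k) cmod (G j) ^+ 2) <= k%:R * T ^+ 2.
  rewrite mulr_sumr; apply: (@le_trans _ _ (\sum_(j < k) T ^+ 2)).
    by apply: ler_sum => j _; exact: hG.
  by rewrite sumr_const card_ord mulr_natl.
have h1 : T ^+ 2 * k%:R <= 2 * B * S1.
  rewrite natrM in hsum; have k0 : 0 <= k%:R :> R by [].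
  nra.
have h2 : S1 ^+ 2 <= T ^+ 2 * S2.
  have := sqr_sum_le (fun w => if ~~ P w then cmod (fcoef y w) else 0).
  rewrite -big_mkcond /= card_prod natrM -expr2 -/S1 => /le_trans; apply.
  rewrite ler_wpM2l ?exprn_ge0 ?(ltW T0)// /S2 [leRHS]big_mkcond /=.
  by apply: ler_sum => w _; rewrite -/(P w); case: ifP; rewrite ?expr0n.
have S10 : 0 <= S1 by apply: sumr_ge0 => w _; exact: cmod_ge0.
have h3 : (T ^+ 2 * k%:R) ^+ 2 <= (2 * B * S1) ^+ 2.
  by rewrite lerXn2r ?nnegrE ?mulr_ge0 ?exprn_ge0 ?(ltW B0) ?(ltW T0).
have T2 : 0 < T ^+ 2 by rewrite exprn_gt0.
rewrite -(ler_pM2l T2).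
have -> : (r * M)%:R ^+ (2 * d) = B ^+ 2 :> R by rewrite [(2 * d)%N]mulnC exprM.
apply: (@le_trans _ _ ((2 * B * S1) ^+ 2)); first by apply: le_trans h3; rewrite !exprMn; lra.
rewrite !exprMn.
have -> : T ^+ 2 * (4 * B ^+ 2 * S2) = (2 ^+ 2 * B ^+ 2) * (T ^+ 2 * S2) by ring.
by rewrite ler_wpM2l// mulr_ge0 ?exprn_ge0 ?(ltW B0).
Qed.

End Kernel.

(** * Linear algebra and congruence classes of points *)

Lemma int_kernel_row_full (m n : nat) (L : 'M[int]_(m, n)) :
  (forall v : 'cV[int]_n, v != 0 -> L *m v != 0) ->
  row_full (map_mx intr L : 'M[rat]_(m, n)).
Proof.
move=> hL; rewrite /row_full -mxrank_tr -/(row_free _) -kermx_eq0; apply/negPn/negP => hk.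
have [i hi] : exists i, row i (kermx (map_mx intr L : 'M[rat]_(m, n))^T) != 0.
  apply: contrapT => h; case/eqP: hk; apply/row_matrixP => i; rewrite row0.
  by apply/eqP/negPn/negP => hi; apply: h; exists i.
set w := row i _ in hi.
have hw : w *m (map_mx intr L : 'M[rat]_(m, n))^T = 0.
  by rewrite /w -row_mul mulmx_ker row0.
(* A rational kernel vector is made integral by multiplication with the product of its
   denominators. *)
pose D : int := \prod_(j < n) denq (w 0 j).
pose v : 'cV[int]_n := \col_j (numq (w 0 j) * \prod_(k < n | k != j) denq (w 0 k)).
have hv j : (v j 0)%:~R = D%:~R * w 0 j :> rat.
  rewrite mxE rmorphM /= -[in RHS](divq_num_den (w 0 j)) /D [X in _ = X%:~R * _](bigD1 j)//= rmorphM /=.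
  by field; rewrite intr_eq0 denq_eq0.
have D0 : D%:~R != 0 :> rat.
  by rewrite intr_eq0 prodf_seq_neq0; apply/allP => j _; rewrite denq_eq0.
have v0 : v != 0.
  apply: contraNneq hi => v0; apply/eqP/rowP => j; rewrite [RHS]mxE.
  by have := hv j; rewrite v0 mxE => /esym/eqP; rewrite mulf_eq0 (negPf D0) /= => /eqP ->.
case/eqP: (hL v v0); apply/colP => l; rewrite !mxE; apply/eqP.
rewrite -(intr_eq0 rat) rmorph_sum /=.
have -> : \sum_(j < n) (L l j * v j 0)%:~R = D%:~R * (w *m (map_mx intr L : 'M[rat]_(m, n))^T) 0 l.
  rewrite mxE mulr_sumr; apply: eq_bigr => j _; rewrite rmorphM /= hv !mxE; ring.
by rewrite hw mxE mulr0.
Qed.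

(** Injectivity on integer vectors is full rank over the rationals, hence an invertible minor, which
    stays invertible over the reals. Keeping only [n] of the [m] rows is what yields classes of size
    [O(q ^ d)] and not [O(q ^ m)] below. *)
Lemma int_kernel_minor (R : realType) (m n : nat) (L : 'M[int]_(m, n)) :
  (forall v : 'cV[int]_n, v != 0 -> L *m v != 0) ->
  exists f : 'I_n -> 'I_m, forall x : 'cV[R]_n,
    (forall a, (map_mx intr L *m x) (f a) 0 = 0) -> x = 0.
Proof.
move=> /int_kernel_row_full hfull.
exists (fullrankfun hfull) => x hx; set f := fullrankfun hfull in hx.
have hU : rowsub f (map_mx intr L : 'M[rat]_(m, n)) \in unitmx.
  exact: fullrowsub_unit.
have hUR : map_mx (@ratr R) (rowsub f (map_mx intr L)) \in unitmx by rewrite map_unitmx.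
rewrite -(mulKmx hUR x).
have -> : map_mx (@ratr R) (rowsub f (map_mx intr L)) *m x = 0.
  apply/colP => a; rewrite [RHS]mxE -(hx a) !mxE; apply: eq_bigr => s _.
  by rewrite !mxE ratr_int.
by rewrite mulmx0.
Qed.

Section Lattice.
Variables (R : realType) (d m k : nat) (L : 'M[int]_(m, d)).
Variable x : 'I_k -> 'cV[R]_d.

Definition lform (v : 'cV[R]_d) (l : 'I_m) : R := \sum_(s < d) (L l s)%:~R * v s 0.

(** For [L] the coefficient matrix of a frequency, the phase difference of the two points has all
    its coefficients in [q^-1] times the integers. *)
Definition congr_rel (q : nat) : rel 'I_k := fun i j =>
  [forall l, q%:R * (lform (x i) l - lform (x j) l) \is a Num.int].

Lemma lform_bound (hL : nat) (u v : 'cV[R]_d) (l : 'I_m) : (forall l s, (absz (L l s) <= hL)%N) ->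
  (forall s, 0 <= u s 0 < 1) -> (forall s, 0 <= v s 0 < 1) ->
  `|lform u l - lform v l| <= (d * hL)%:R.
Proof.
move=> h hu hv; rewrite /lform -sumrB; apply: le_trans (ler_norm_sum _ _ _) _.
apply: (@le_trans _ _ (\sum_(s < d) hL%:R)); last by rewrite sumr_const card_ord natrM mulr_natl.
apply: ler_sum => s _; rewrite -mulrBr normrM -[leRHS]mulr1 ler_pM//.
  by rewrite -intr_norm -abszE -pmulrn ler_nat.
have /andP[? ?] := hu s; have /andP[? ?] := hv s.
by rewrite ler_norml; apply/andP; split; lra.
Qed.

(** The gcd axiom is Bezout's identity. For the class bound, [d] suitable forms send each member of
    the class to integers of absolute value at most [q * (d * hL)], and these determine the
    point. *)
Lemma congruence_system_congr (hL : nat) : (0 < d)%N -> (0 < hL)%N ->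
  (forall v : 'cV[int]_d, v != 0 -> L *m v != 0) ->
  (forall l s, (absz (L l s) <= hL)%N) ->
  injective x -> (forall i s, 0 <= x i s 0 < 1) ->
  congruence_system congr_rel d ((3 * d * hL) ^ d).
Proof.
move=> d0 hL0 hker hLb xI hx; split.
- move=> q q0 i j l; split.
    by apply/forallP => a; rewrite subrr mulr0 rpred0.
  move=> /forallP hij; apply/forallP/forallP => h a.
    have -> : q%:R * (lform (x j) a - lform (x l) a) =
      q%:R * (lform (x i) a - lform (x l) a) - q%:R * (lform (x i) a - lform (x j) a) by ring.
    by rewrite rpredB.
  have -> : q%:R * (lform (x i) a - lform (x l) a) =
      q%:R * (lform (x j) a - lform (x l) a) + q%:R * (lform (x i) a - lform (x j) a) by ring.
  by rewrite rpredD.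
- move=> q q' i j q'0 /dvdnP[c ->] /forallP h; apply/forallP => a.
  by rewrite natrM -mulrA rpredM// ?h// natr_int.
- move=> q q' i j q0 q'0 /forallP h /forallP h'; apply/forallP => a.
  have [u [v huv]] := Bezoutz q q'.
  have -> : (gcdn q q')%:R = u%:~R * q%:R + v%:~R * q'%:R :> R.
    by apply/esym; have /(congr1 (fun z : int => z%:~R : R)) := huv; rewrite rmorphD !rmorphM; exact.
  by rewrite mulrDl -!mulrA rpredD// rpredM// ?h ?h'// intr_int.
move=> q i q0.
have [f hf] := int_kernel_minor R hker.
pose B := (q * (d * hL))%N.
have hB0 : (0 < B)%N by rewrite !muln_gt0 q0 d0.
pose y (j : 'I_k) (a : 'I_d) : int := Num.floor (q%:R * (lform (x j) (f a) - lform (x i) (f a))).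
pose A := [set j | congr_rel q i j].
have hyE j a : j \in A -> (y j a)%:~R = q%:R * (lform (x j) (f a) - lform (x i) (f a)).
  rewrite inE => /forallP/(_ (f a)) h; apply: floorK.
  by rewrite -opprB mulrN rpredN.
have hyB j a : j \in A -> (absz (y j a) <= B)%N.
  move=> jA; rewrite -(ler_nat R) pmulrn abszE intr_norm hyE// normrM ger0_norm//.
  by rewrite /B natrM ler_wpM2l//; exact: lform_bound.
have B30 : (0 < 3 * B)%N by rewrite muln_gt0.
(* The default value of [insubd] never occurs on [A]: there [y j a + B] lies between 0 and [2 * B],
   below [3 * B]. *)
pose g (j : 'I_k) : {ffun 'I_d -> 'I_(3 * B)} :=
  [ffun a => insubd (Ordinal B30) (absz (y j a + B%:Z))].
have gI : {in A &, injective g}.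
  move=> j j' jA j'A hg; apply: xI; apply/eqP; rewrite -subr_eq0; apply/eqP; apply: hf => a.
  have hyy : y j a = y j' a.
    have /ffunP/(_ a)/(congr1 val) := hg; rewrite !ffunE !val_insubd.
    have h1 := hyB j a jA; have h2 := hyB j' a j'A.
    have -> : (absz (y j a + B%:Z)%R < 3 * B)%N by lia.
    have -> : (absz (y j' a + B%:Z)%R < 3 * B)%N by lia.
    lia.
  have hql : q%:R * (lform (x j) (f a) - lform (x j') (f a)) = 0.
    have := congr1 (fun z : int => z%:~R : R) hyy; rewrite /= !hyE// => h; nra.
  have qR : q%:R != 0 :> R by rewrite pnatr_eq0 -lt0n.
  move/eqP: hql; rewrite mulf_eq0 (negPf qR) /= subr_eq0 => /eqP h.
  rewrite mulmxBr mxE [X in _ + X]mxE !mxE.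
  under eq_bigr do rewrite mxE. under [X in _ - X]eq_bigr do rewrite mxE.
  by rewrite -/(lform _ _) -/(lform _ _) h subrr.
rewrite -/A -(card_in_imset gI); apply: leq_trans (max_card _) _.
rewrite card_ffun !card_ord /B -expnMn; apply: eq_leq; congr (_ ^ _)%N; lia.
Qed.

End Lattice.

(** * Choice of the parameters *)

Section ParameterChoice.
Variables (R : realType) (d e : nat).
Hypotheses (d0 : (0 < d)%N) (e0 : (0 < e)%N).

Let D1 : 1 <= d%:R :> R. Proof. by rewrite ler1n. Qed.
Let E1 : 1 <= e%:R :> R. Proof. by rewrite ler1n. Qed.

(* All [o(1)] exponents are fixed fractions of [slack]: [kpow] is the power of the
   Dirichlet kernel, [iters] the number of Cauchy-Schwarz steps, [hua_loss] the
   loss in Hua's bound and [step_loss] the loss at each Cauchy-Schwarz step. *)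
Definition slack : R := (6 * (2 * d%:R ^+ 2 * e%:R + 3 * d%:R))^-1.
Definition expo : R := d%:R * (2 * d%:R + 1) * e%:R + (7 * d%:R + 1) / 2.
Definition iters : nat := (Num.truncn slack^-1).+1.
Definition kpow : nat := (Num.truncn ((2 * d%:R + 1) / slack)).+1.
Definition hua_loss : R := slack / (e%:R * (1 + slack)).
Definition step_loss : R := d%:R * slack / iters.+1%:R.

Lemma slack_gt0 : 0 < slack.
Proof.
by rewrite invr_gt0 mulr_gt0// addr_gt0// !mulr_gt0 ?exprn_gt0 ?ltr0n.
Qed.

Lemma slack_le1 : slack <= 1.
Proof.
rewrite invf_le1; last by rewrite -invr_gt0 slack_gt0.
have : 0 <= d%:R ^+ 2 * e%:R :> R by rewrite mulr_ge0 ?exprn_ge0//; lra.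
by have := D1; nra.
Qed.

Lemma hua_loss_gt0 : 0 < hua_loss.
Proof. by have := slack_gt0; have := E1 => ? ?; rewrite divr_gt0// mulr_gt0//; lra. Qed.

Lemma step_loss_gt0 : 0 < step_loss.
Proof. by have := slack_gt0; have := D1 => ? ?; rewrite divr_gt0// mulr_gt0//; lra. Qed.

Lemma hua_lossE : e%:R^-1 - hua_loss = (e%:R * (1 + slack))^-1.
Proof.
have s0 := slack_gt0; have hE := E1; rewrite /hua_loss; field.
by apply/andP; split; apply: lt0r_neq0; lra.
Qed.

Lemma hua_loss_lt : hua_loss < e%:R^-1.
Proof.
rewrite -subr_gt0 hua_lossE invr_gt0 mulr_gt0//; first by have := E1; lra.
by have := slack_gt0; lra.
Qed.

Lemma step_lossE : d%:R + iters.+1%:R * step_loss = d%:R * (1 + slack).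
Proof. by rewrite /step_loss [_%:R * (_ / _)]mulrC divfK ?pnatr_eq0// mulrDr mulr1. Qed.

(** With [Y] the lossless exponent, [slack] is [1 / (6 Y)] and [(1 + slack) ^+ 4 <= 1 + 6 * slack],
    so all losses together cost at most 1. The 1 on the right is a spare power of [E] that will
    absorb constants. *)
Lemma slack_pow4 : (1 + slack) ^+ 4 * (2 * d%:R ^+ 2 * e%:R + 3 * d%:R) <= expo - 1.
Proof.
have s0 := slack_gt0; have s1 := slack_le1; have hD := D1; have hE := E1.
set Y := 2 * d%:R ^+ 2 * e%:R + 3 * d%:R.
have hde : 1 <= d%:R ^+ 2 * e%:R :> R by rewrite mulr_ege1// exprn_ege1.
have hY : 5 <= Y by rewrite /Y; lra.
have hs : 6 * slack * Y = 1.
  by rewrite /slack -/Y; field; apply: lt0r_neq0; lra.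
have hs30 : 30 * slack <= 1 by nra.
have h4 : (1 + slack) ^+ 4 <= 1 + 6 * slack.
  have -> : (1 + slack) ^+ 4 = 1 + 4 * slack + slack * (6 * slack + 4 * slack ^+ 2 + slack ^+ 3) by ring.
  have : slack ^+ 2 <= slack by rewrite expr2 ler_piMl// ltW.
  have : slack ^+ 3 <= slack.
    by rewrite exprS ler_piMr ?(ltW s0)// exprn_ile1// ltW.
  nra.
apply: (@le_trans _ _ ((1 + 6 * slack) * Y)); first by rewrite ler_wpM2r//; lra.
have -> : (1 + 6 * slack) * Y = Y + 1 by rewrite mulrDl mul1r hs.
have hde1 : 1 <= d%:R * e%:R :> R by rewrite mulr_ege1.
by rewrite /Y /expo; nra.
Qed.

(** With [T = 2 ^ iters], extracting a root of order [T - 1] from a [T]-th power then costs a factor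
    [T / (T - 1) <= 1 + slack] in the exponents. *)
Lemma iters_pow : slack^-1 <= (2 ^ iters).-1%:R.
Proof.
have : slack^-1 <= iters%:R by rewrite ltW// ltr_truncnS// invr_ge0 ltW// slack_gt0.
move=> h; apply: le_trans h _; rewrite ler_nat -ltnS prednK ?expn_gt0//.
exact: ltn_expl.
Qed.

Lemma kpow_slack : d%:R * (1 + slack) + 1 <= 2 * kpow%:R * slack.
Proof.
have s0 := slack_gt0; have s1 := slack_le1; have hD := D1.
have : (2 * d%:R + 1) / slack < kpow%:R by apply: ltr_truncnS; rewrite divr_ge0// ?ltW//; lra.
rewrite ltr_pdivrMr// => h; nra.
Qed.

(** The kernel condition asks [M ^ (2 kpow - d)] to dominate a constant times [E ^ (2 kpow)]. One
    more power of [E] absorbs the constant, and [M >= E ^ (1 + slack)] is then large enough. *)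
Lemma kpow_exponent : (d <= 2 * kpow)%N /\
  (2 * kpow).+1%:R <= (1 + slack) * (2 * kpow - d)%N%:R.
Proof.
have s0 := slack_gt0; have s1 := slack_le1; have h := kpow_slack.
have k0 : 0 <= kpow%:R :> R by [].
have hd : (d <= 2 * kpow)%N by rewrite -(ler_nat R) natrM; nra.
by split=> //; rewrite natrB// -natr1 natrM; nra.
Qed.

(** In powers of [E]: [x * (2 * d)] for [fbound M]; this times [e * x] for [Q], which is raised to
    the power [d * x]; a factor [x] for the root of order [T - 1]; [x * d] for the class bound; 1
    for the constants. *)
Lemma exponent_le (x := 1 + slack) :
  (x * (2 * d)%:R + x * (2 * d)%:R * (e%:R * x) * (d%:R * x)) * x + x * d%:R + 1 <= expo.
Proof.
have s0 := slack_gt0; have hD := D1.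
have x1 : 1 <= x by rewrite /x; lra.
have h4 := slack_pow4; rewrite -/x in h4.
have hx4 : x <= x ^+ 4 by rewrite -{1}(expr1 x) ler_weXn2l.
have hx24 : x ^+ 2 <= x ^+ 4 by rewrite ler_weXn2l.
have -> : (x * (2 * d)%:R + x * (2 * d)%:R * (e%:R * x) * (d%:R * x)) * x + x * d%:R =
  x ^+ 4 * (2 * d%:R ^+ 2 * e%:R) + (x ^+ 2 * (2 * d%:R) + x * d%:R) by rewrite natrM; ring.
rewrite mulrDr in h4; set u := x ^+ 4 * (_ * _) in h4 *.
by nra.
Qed.

(** Eight times the constant of [fcoef_large], so that the lower bound for the means beats the
    factor 3 of the upper one. *)
Definition fbound (M : nat) : R := 32 * (kpow * M)%:R ^+ (2 * d).

(** [E] is [eps^-1]. The three conditions say that the kernel is concentrated, that pairs of large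
    denominator are negligible, and that those of small denominator are few. The 2 before [k] allows
    for rounding. *)
Lemma parameter_choice (Ch Cw : R) : 1 <= Ch -> 1 <= Cw ->
  exists E0 : R, 1 <= E0 /\ forall (E : R) (H k : nat), E0 <= E -> (0 < H)%N ->
    H%:R `^ ((3 * d%:R + 1) / 2) * E `^ expo <= 2 * k%:R ->
    exists M Q : nat, [/\ (0 < M)%N, (0 < Q)%N,
      2 * (kpow * M)%:R ^+ d * (d%:R * E) ^+ (2 * kpow) <= M%:R ^+ (2 * kpow),
      Ch * Q%:R `^ (- e%:R^-1 + hua_loss) * fbound M <= 1 &
      Cw * (fbound M * Q%:R `^ (d%:R * (1 + slack))) ^+ (2 ^ iters) *
        ((3 * d * (d * (kpow * M) * H)) ^ d)%:R ^+ (2 ^ iters).-1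
        <= k%:R ^+ (2 ^ iters).-1].
Proof.
move=> hCh hCw.
have Ch0 : 0 <= Ch by exact: le_trans hCh.
have Cw0 : 0 <= Cw by exact: le_trans hCw.
have s0 := slack_gt0; have hD := D1; have hE1 := E1.
have [hr2 hrx] := kpow_exponent.
have hdh : d%:R <= (3 * d%:R + 1) / 2 :> R by lra.
have hexp := exponent_le; have hit := iters_pow.
have hue : e%:R^-1 - hua_loss = (e%:R * (1 + slack))^-1 by exact: hua_lossE.
set r := kpow in hr2 hrx *; set T := (2 ^ iters)%N in hit *; set x := 1 + slack in hrx hexp hue *.
have x1 : 1 <= x by rewrite lerDl ltW.
have x0 : 0 <= x by exact: le_trans x1.
pose cB : R := 32 * (r * 2)%:R ^+ (2 * d).
pose ie : R := e%:R * x.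
have ie1 : 1 <= ie by rewrite mulr_ege1.
have ie0 : 0 <= ie by exact: le_trans ie1.
have ien0 : ie != 0 by rewrite gt_eqF// (lt_le_trans ltr01).
have dx0 : 0 <= d%:R * x by rewrite mulr_ge0.
pose cQ : R := 2 * (Ch * cB) `^ ie.
pose cY : R := cB * cQ `^ (d%:R * x).
pose K : R := Num.max 1 (Cw * cY ^+ T).
pose cD : R := ((3 * d * (d * (r * 2))) ^ d)%:R.
(* The first entry lets a spare factor [E] beat the constants of the kernel condition, the second
   those of the count of pairs. [H] is absent: it occurs only as [H ^+ d], which the hypothesis on
   [k] covers. *)
pose E0 : R := Num.max 1 (Num.max (2 * r%:R ^+ d * d%:R ^+ (2 * r)) (2 * K * cD)).
exists E0; split; first by rewrite le_max lexx.
move=> E H k; rewrite /E0 !ge_max => /andP[EE1 /andP[hE2 hE3]] H0 hk.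
have Epos : 0 < E by exact: lt_le_trans EE1.
have E0' : 0 <= E by exact: ltW.
pose y : R := E `^ x.
have y1 : 1 <= y by rewrite /y -[leLHS](powRr0 E) ler_powR.
have y0 : 0 <= y by exact: le_trans y1.
have trunc2 (v : R) : 1 <= v -> (Num.truncn v).+1%:R <= 2 * v.
  move=> v1; have /andP[h _] : (Num.truncn v)%:R <= v < (Num.truncn v).+1%:R.
    by apply: truncn_itv; exact: le_trans v1.
  by rewrite -natr1 mulr_natl mulr2n lerD.
pose M := (Num.truncn y).+1.
have My : y < M%:R by exact: ltr_truncnS.
have M2y : M%:R <= 2 * y by exact: trunc2.
have M0 : (0 < M)%N by [].
set B := fbound M.
have hB1 : 1 <= (r * M)%:R ^+ (2 * d) :> R by rewrite exprn_ege1// ler1n.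
have B1 : 1 <= B by rewrite /B /fbound mulr_ege1// ler1n.
have B0 : 0 <= B by exact: le_trans B1.
have cB1 : 1 <= cB.
  by rewrite /cB mulr_ege1 ?ler1n// exprn_ege1// ler1n.
have cB0 : 0 <= cB by exact: le_trans cB1.
have hB : B <= cB * y ^+ (2 * d).
  rewrite /B /fbound /cB -mulrA -exprMn ler_wpM2l// lerXn2r// ?nnegrE ?mulr_ge0//.
  by rewrite !natrM -mulrA ler_wpM2l.
have ChB1 : 1 <= Ch * B by rewrite mulr_ege1.
have ChB0 : 0 <= Ch * B by rewrite mulr_ge0.
have ChcB0 : 0 <= Ch * cB by rewrite mulr_ge0.
pose q1 : R := (Ch * B) `^ ie.
pose Q := (Num.truncn q1).+1.
have q10 : 0 <= q1 by exact: powR_ge0.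
have hQ1 : q1 < Q%:R by exact: ltr_truncnS.
have hq11 : 1 <= q1.
  apply: (@le_trans _ _ (1 `^ ie)); first by rewrite powR1.
  by rewrite /q1 ge0_ler_powR ?nnegrE.
have hQ2 : Q%:R <= 2 * q1 by exact: trunc2.
have hyX (n : nat) : y ^+ n = E `^ (x * n%:R).
  by rewrite /y -powR_mulrn ?powR_ge0// -powRrM.
have hQ3 : Q%:R <= cQ * E `^ (x * (2 * d)%:R * ie).
  apply: le_trans hQ2 _; rewrite /cQ -mulrA ler_wpM2l//.
  rewrite powRrM -hyX -powRM ?exprn_ge0//.
  rewrite ge0_ler_powR ?nnegrE ?mulr_ge0 ?exprn_ge0//.
  by rewrite -mulrA ler_wpM2l.
exists M, Q; split=> //.
- rewrite -/r natrM !exprMn -[X in _ <= _ ^+ X](subnKC hr2) exprD.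
  have -> : 2 * (r%:R ^+ d * M%:R ^+ d) * (d%:R ^+ (2 * r) * E ^+ (2 * r)) =
    M%:R ^+ d * (2 * r%:R ^+ d * d%:R ^+ (2 * r) * E ^+ (2 * r)) by ring.
  rewrite ler_wpM2l ?exprn_ge0//.
  apply: (@le_trans _ _ (E * E ^+ (2 * r))); first by rewrite ler_wpM2r ?exprn_ge0.
  rewrite -exprS; apply: (@le_trans _ _ (y ^+ (2 * r - d))); last first.
    by rewrite lerXn2r ?nnegrE// ltW.
  by rewrite hyX -powR_mulrn// ler_powR.
- have -> : - e%:R^-1 + hua_loss = - ie^-1 by rewrite /ie -hue opprB addrC.
  rewrite powRN; have Qpos : 0 < Q%:R `^ ie^-1 :> R by apply: powR_gt0; rewrite ltr0n.
  have h : Ch * B <= Q%:R `^ ie^-1.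
    have -> : Ch * B = q1 `^ ie^-1 by rewrite /q1 -powRrM mulfV ?powRr1.
    by rewrite ge0_ler_powR ?nnegrE ?invr_ge0// ltW.
  by rewrite mulrAC ler_pdivrMr// mul1r.
have cQ0 : 0 <= cQ by rewrite mulr_ge0 ?powR_ge0.
have hQs : Q%:R `^ (d%:R * x) <= cQ `^ (d%:R * x) * E `^ (x * (2 * d)%:R * ie * (d%:R * x)).
  by rewrite [X in _ <= _ * X]powRrM -powRM ?powR_ge0// ge0_ler_powR ?nnegrE ?mulr_ge0 ?powR_ge0.
pose z : R := x * (2 * d)%:R + x * (2 * d)%:R * ie * (d%:R * x).
have hY : B * Q%:R `^ (d%:R * x) <= cY * E `^ z.
  rewrite /z powRD; last by rewrite (gt_eqF Epos) implybT.
  rewrite -hyX /cY.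
  have -> : cB * cQ `^ (d%:R * x) * (y ^+ (2 * d) * E `^ (x * (2 * d)%:R * ie * (d%:R * x))) =
    (cB * y ^+ (2 * d)) * (cQ `^ (d%:R * x) * E `^ (x * (2 * d)%:R * ie * (d%:R * x))) by ring.
  by rewrite ler_pM ?powR_ge0.
have z0 : 0 <= z by rewrite addr_ge0// !mulr_ge0.
have cY0 : 0 <= cY by rewrite mulr_ge0 ?powR_ge0.
have T1 : (0 < T.-1)%N by rewrite /T -ltnS prednK ?expn_gt0// -{1}(expn0 2) ltn_exp2l.
have K1 : 1 <= K by rewrite /K le_max lexx.
have K0 : 0 <= K by exact: le_trans K1.
(* One of the [T.-1] factors [K] absorbs [Cw * cY ^+ T]; on the exponents of [E],
   [T <= x * T.-1]. *)
have hYT : Cw * (B * Q%:R `^ (d%:R * x)) ^+ T <= (K * E `^ (z * x)) ^+ T.-1.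
  apply: (@le_trans _ _ (Cw * (cY * E `^ z) ^+ T)).
    by rewrite ler_wpM2l// lerXn2r ?nnegrE ?mulr_ge0 ?powR_ge0.
  rewrite [(cY * _) ^+ T]exprMn [(K * _) ^+ _]exprMn mulrA.
  rewrite ler_pM ?exprn_ge0 ?powR_ge0 ?mulr_ge0 ?exprn_ge0//.
    apply: (@le_trans _ _ K); first by rewrite /K le_max lexx orbT.
    by rewrite -{1}(expr1 K) ler_weXn2l.
  rewrite -!powR_mulrn ?powR_ge0// -!powRrM ler_powR// -mulrA ler_wpM2l//.
  have hT : T%:R = T.-1%:R + 1 :> R by rewrite natr1 prednK// expn_gt0.
  rewrite hT /x mulrDl mul1r lerD2l.
  by have := ler_wpM2l (ltW s0) hit; rewrite mulfV ?lt0r_neq0.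
set DD := ((3 * d * (d * (r * M) * H)) ^ d)%:R.
have hDD : DD <= cD * (y ^+ d * H%:R ^+ d).
  rewrite /DD /cD !natrX -!exprMn lerXn2r ?nnegrE ?mulr_ge0//.
  have -> : (3 * d * (d * (r * M) * H))%:R = (3 * d * (d * r) * H)%:R * M%:R :> R.
    by rewrite -natrM; congr (_%:R); clear; lia.
  have -> : (3 * d * (d * (r * 2)))%:R * (y * H%:R) = (3 * d * (d * r) * H)%:R * (2 * y) :> R.
    by rewrite !natrM; ring.
  by rewrite ler_wpM2l.
have cD0 : 0 <= cD by [].
have hKD : K * E `^ (z * x) * DD <= k%:R.
  apply: (@le_trans _ _ (K * E `^ (z * x) * (cD * (y ^+ d * H%:R ^+ d)))).
    by rewrite ler_wpM2l// mulr_ge0 ?powR_ge0.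
  rewrite hyX.
  have -> : K * E `^ (z * x) * (cD * (E `^ (x * d%:R) * H%:R ^+ d)) =
    K * cD * H%:R ^+ d * (E `^ (z * x) * E `^ (x * d%:R)) by ring.
  rewrite -powRD; last by rewrite (gt_eqF Epos) implybT.
  set v := z * x + x * d%:R.
  have hv : 1 + v <= expo by rewrite addrC.
  have hEv : 2 * (K * cD) * E `^ v <= E `^ expo.
    apply: (@le_trans _ _ (E * E `^ v)); first by rewrite ler_wpM2r ?powR_ge0// mulrA.
    rewrite -{1}(powRr1 E0') -powRD; last by rewrite (gt_eqF Epos) implybT.
    by rewrite ler_powR.
  have hH : H%:R ^+ d <= H%:R `^ ((3 * d%:R + 1) / 2) :> R.
    by rewrite -powR_mulrn// ler_powR ?ler1n.
  rewrite -(@ler_pM2l _ 2)//; apply: le_trans hk.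
  have -> : 2 * (K * cD * H%:R ^+ d * E `^ v) = H%:R ^+ d * (2 * (K * cD) * E `^ v) by ring.
  by rewrite ler_pM ?exprn_ge0// !mulr_ge0 ?powR_ge0.
have DD0 : 0 <= DD by [].
apply: (@le_trans _ _ ((K * E `^ (z * x)) ^+ T.-1 * DD ^+ T.-1)).
  by rewrite ler_wpM2r// exprn_ge0.
by rewrite -exprMn lerXn2r ?nnegrE// mulr_ge0// mulr_ge0 ?powR_ge0.
Qed.

End ParameterChoice.

Local Open Scope classical_set_scope.

(** * Failure of density in one coordinate *)

Section NotDense.
Variables (R : realType) (d : nat).

(** If every coordinate were within [eps / d] of an integer, the Euclidean distance would be at most
    [sqrt d * (eps / d) <= eps]. *)
Lemma not_dense_far (eps : R) (B : 'M[int]_d) (X : set 'cV[R]_d) : (0 < d)%N -> 0 < eps ->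
  ~ eps_dense_image eps B X ->
  exists zeta : 'cV[R]_d, forall x, X x -> exists i, forall z : int,
    eps / d%:R <= `|zeta i 0 - (map_mx intr B *m x) i 0 - z%:~R|.
Proof.
move=> d0 e0 hnd.
have [zeta hz] : exists zeta, forall x, X x -> eps < torus_dist zeta (torus_act B x).
  apply: contrapT => hno; apply: hnd; apply: ge_ereal_sup => _ [zeta _ <-].
  have [x /not_implyP[Xx /negP hx]] : exists x, ~ (X x -> eps < torus_dist zeta (torus_act B x)).
    by apply/existsNP => h; apply: hno; exists zeta.
  apply: (@le_trans _ _ (torus_dist zeta (torus_act B x))%:E).
    by apply: ereal_inf_lbound; exists x.
  by rewrite lee_fin leNgt.
exists zeta => x Xx; apply: contrapT => hno.
set y := map_mx intr B *m x in hno.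
have hz2 (i : 'I_d) : exists z : int, `|zeta i 0 - y i 0 - z%:~R| < eps / d%:R.
  have /existsNP[z /negP hzz] : ~ forall z : int, eps / d%:R <= `|zeta i 0 - y i 0 - z%:~R|.
    by move=> h; apply: hno; exists i.
  by exists z; rewrite ltNge.
have [f hf] := choice hz2.
have := hz x Xx; apply/negP; rewrite -leNgt.
(* The added floor undoes the reduction made by [torus_proj]. *)
pose v : 'cV[int]_d := \col_i (f i + Num.floor (y i 0)).
apply: (@le_trans _ _ (euclid_norm (zeta - torus_act B x - map_mx intr v))).
  apply: ge_inf; last by exists v.
  by exists 0 => _ [w _ <-]; exact: sqrtr_ge0.
have hc i : (zeta - torus_act B x - map_mx intr v) i 0 = zeta i 0 - y i 0 - (f i)%:~R.
  by rewrite /torus_act /torus_proj -/y !mxE rmorphD /=; ring.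
rewrite /euclid_norm; under eq_bigr do rewrite hc.
rewrite -[leRHS]ger0_norm ?(ltW e0)// -sqrtr_sqr ler_wsqrtr//.
apply: (@le_trans _ _ (\sum_(i < d) (eps / d%:R) ^+ 2)).
  apply: ler_sum => i _; rewrite -[leLHS]real_normK ?num_real// lerXn2r ?nnegrE//.
    by rewrite divr_ge0// ltW.
  exact: ltW.
rewrite sumr_const card_ord -[leLHS]mulr_natl.
have D1 : 1 <= d%:R :> R by rewrite ler1n.
have -> : d%:R * (eps / d%:R) ^+ 2 = eps ^+ 2 / d%:R by field; apply: lt0r_neq0; lra.
by rewrite ler_pdivrMr ?ler_peMr ?sqr_ge0//; lra.
Qed.

End NotDense.

(** * Phases attached to a frequency *)

Section Phase.
Variables (R : realType) (d e : nat) (A : 'M[{poly int}]_d).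
Hypothesis hdeg : poly_mx_deg A = e.

Lemma size_poly_mx r s : (size (A r s) <= e.+1)%N.
Proof.
have : ((size (A r s)).-1 <= e)%N.
  rewrite -hdeg; apply: leq_trans (leq_bigmax (F := fun s => (size (A r s)).-1) s) _.
  exact: (leq_bigmax (F := fun r => (\max_(s < d) (size (A r s)).-1)%N) r).
by case: (size _).
Qed.

Lemma coef_poly_mx r s l : (absz ((A r s)`_l)%R <= poly_mx_height A)%N.
Proof.
have [hl|hl] := ltnP l (size (A r s)); last by rewrite nth_default.
apply: leq_trans (leq_bigmax (F := fun r => (\max_(s < d) \max_(i < size (A r s)) absz ((A r s)`_i)%R)%N) r).
apply: leq_trans (leq_bigmax (F := fun s => (\max_(i < size (A r s)) absz ((A r s)`_i)%R)%N) s).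
exact: (leq_bigmax (F := fun i : 'I_(size (A r s)) => absz ((A r s)`_i)%R) (Ordinal hl)).
Qed.

(** Row [l] is the coefficient of [X^l] in the row vector [m^t A(X)], so applying the matrix to a
    point lists the coefficients of its phase. *)
Definition coef_mx (m : 'I_d -> int) : 'M[int]_(e.+1, d) :=
  \matrix_(l, s) \sum_(r < d) m r * (A r s)`_l.

Lemma coef_mx_ker (m : 'I_d -> int) :
  (forall u v : 'cV[int]_d, u != 0 -> v != 0 -> poly_mx_form A u v != 0) ->
  (exists i, m i != 0) ->
  forall v : 'cV[int]_d, v != 0 -> coef_mx m *m v != 0.
Proof.
move=> hA [i0 hi0] v v0; pose u : 'cV[int]_d := \col_i m i.
have u0 : u != 0.
  by apply: contraNneq hi0 => u0; have /colP/(_ i0) := u0; rewrite !mxE => ->.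
apply: contraNneq (hA u v u0 v0) => hL; apply/eqP/polyP => l; rewrite coef0.
have -> : (poly_mx_form A u v)`_l = \sum_(s < d) (\sum_(r < d) m r * (A r s)`_l) * v s 0.
  rewrite /poly_mx_form mxE coef_sum; apply: eq_bigr => s _.
  rewrite !mxE coefMC coef_sum; congr (_ * _); apply: eq_bigr => r _.
  by rewrite !mxE coefCM.
have [hl|hl] := ltnP l e.+1.
  have /colP/(_ (Ordinal hl)) := hL; rewrite !mxE => h.
  by rewrite -[RHS]h; apply: eq_bigr => s _; rewrite mxE.
rewrite big1// => s _; rewrite big1 ?mul0r// => r _.
by rewrite nth_default ?mulr0// (leq_trans (size_poly_mx r s)).
Qed.

(** This is the only way the height of [A] enters the argument, through the bound on class sizes. *)
Lemma coef_mx_bound (m : 'I_d -> int) (B : nat) : (forall i, (absz (m i) <= B)%N) ->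
  forall l s, (absz (coef_mx m l s) <= d * B * poly_mx_height A)%N.
Proof.
move=> hm l s; rewrite mxE -lez_nat abszE.
apply: le_trans (ler_norm_sum _ _ _) _.
apply: (@le_trans _ _ (\sum_(r < d) (B * poly_mx_height A)%N%:Z)).
  apply: ler_sum => r _; rewrite -abszE lez_nat abszM leq_mul//.
  exact: coef_poly_mx.
by rewrite sumr_const card_ord -mulr_natl natz -PoszM mulnA.
Qed.

Definition phase (m : 'I_d -> int) (x : 'cV[R]_d) : {poly R} :=
  \poly_(l < e.+1) (lform (coef_mx m) x (inord l)).

Lemma phaseE (m : 'I_d -> int) (x : 'cV[R]_d) (n : nat) :
  \sum_(i < d) (m i)%:~R * (map_mx intr (poly_mx_eval A n) *m x) i 0 =
  (phase m x).[n%:R].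
Proof.
rewrite horner_poly.
transitivity (\sum_(l < e.+1) \sum_(s < d) \sum_(r < d)
    (m r)%:~R * ((A r s)`_l)%:~R * x s 0 * n%:R ^+ l).
  rewrite [RHS]exchange_big /=; under [RHS]eq_bigr do rewrite exchange_big /=.
  rewrite [RHS]exchange_big /=; apply: eq_bigr => r _.
  rewrite mxE mulr_sumr; apply: eq_bigr => s _.
  rewrite !mxE (horner_coef_wide _ (size_poly_mx r s)) rmorph_sum /= mulr_suml mulr_sumr.
  apply: eq_bigr => l _; rewrite rmorphM /= rmorphXn /= -pmulrn; ring.
apply: eq_bigr => l _; rewrite inord_val /lform mulr_suml; apply: eq_bigr => s _.
by rewrite mxE rmorph_sum /= !mulr_suml; apply: eq_bigr => r _; rewrite rmorphM.
Qed.

(** Reconciles [mean_poly], which tests the coefficients of positive index, with [congr_rel], which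
    tests all rows. *)
Lemma lform_coef_mx0 (m : 'I_d -> int) (x : 'cV[R]_d) : (forall r s, (A r s).[0] = 0) ->
  lform (coef_mx m) x ord0 = 0.
Proof.
move=> h0; rewrite /lform big1// => s _; rewrite mxE big1 ?mul0r// => r _.
by rewrite -horner_coef0 h0 mulr0.
Qed.

End Phase.

(** * Comparison of the two bounds *)

Section Main.
Variables (R : realType) (d e : nat).
Hypotheses (d0 : (0 < d)%N) (e0 : (0 < e)%N).
Variable A : 'M[{poly int}]_d.
Hypotheses (A0 : forall r s, (A r s).[0] = 0)
  (hA : forall u v : 'cV[int]_d, u != 0 -> v != 0 -> poly_mx_form A u v != 0)
  (hdeg : poly_mx_deg A = e).
Let H := poly_mx_height A.
Hypothesis H0 : (0 < H)%N.

Variables (k M Q r t : nat) (x : 'I_k -> 'cV[R]_d) (B s tau Ch Cw : R).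
Hypotheses (k0 : (0 < k)%N) (M0 : (0 < M)%N) (Q0 : (0 < Q)%N) (r0 : (0 < r)%N).
Hypothesis B0 : 0 < B.
Hypotheses (xI : injective x) (xt : forall j i, 0 <= x j i 0 < 1).
Hypotheses (s0 : 0 <= s) (Ch0 : 0 <= Ch).
Hypothesis hCw : forall (I : finType) (rl : nat -> rel I) (D Q : nat),
    congruence_system rl d D -> (0 < D)%N -> (0 < #|I|)%N ->
    wpairs rl s Q ^+ (2 ^ t) <= Cw * (#|I| * D)%:R ^+ (2 ^ t).-1 * #|I|%:R ^+ 2.
Hypothesis hCh : forall (g : {poly R}) (Q : nat), (size g <= e.+1)%N -> (0 < Q)%N ->
    (forall q, (0 < q <= Q)%N ->
       ~ (forall j, (0 < j)%N -> q%:R * g`_j \is a Num.int)) ->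
    mean_le (fun n => chi g.[n%:R]) (Ch * Q%:R `^ tau).
Hypothesis hQ : Ch * Q%:R `^ tau * B <= 1.
Hypothesis hk : Cw * (B * Q%:R `^ s) ^+ (2 ^ t) *
        ((3 * d * (d * (r * M) * H)) ^ d)%:R ^+ (2 ^ t).-1 <= k%:R ^+ (2 ^ t).-1.

Definition ypt (n : nat) (j : 'I_k) (i : 'I_d) : R :=
  (map_mx intr (poly_mx_eval A n) *m x j) i 0.

(** A modulus up to [Q] has weight at least [Q ^ (-s)], so the plain count is at most [Q ^ s] times
    the weighted one; after raising to the power [2 ^ t] the claim reduces to [hk]. *)
Lemma sum_pairs_small (rl : nat -> rel 'I_k) :
  congruence_system rl d ((3 * d * (d * (r * M) * H)) ^ d) ->
  B * (\sum_(q < Q) pairs rl q.+1)%N%:R <= k%:R ^+ 2.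
Proof.
move=> hrl; have hk' := hk; set D := (_ ^ d)%N in hrl hk' *.
have D0 : (0 < D)%N by rewrite expn_gt0 !muln_gt0 d0 r0 M0 H0.
have := hCw Q hrl D0; rewrite card_ord => /(_ k0).
set T := (2 ^ t)%N in hk' *; set W := wpairs _ _ _ => hW.
have T0 : (0 < T)%N by rewrite expn_gt0.
have W0 : 0 <= W by apply: sumr_ge0 => q _; rewrite mulr_ge0 ?powR_ge0.
set Nn := (\sum_(q < Q) _)%N.
have hN : Nn%:R <= Q%:R `^ s * W.
  rewrite /Nn natr_sum mulr_sumr; apply: ler_sum => q _.
  rewrite mulrA ler_peMl// powRN -[leLHS]/(1 : R) ler_pdivlMr ?powR_gt0 ?ltr0n// mul1r.
  by rewrite ge0_ler_powR ?nnegrE// ler_nat.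
have kR : 0 <= k%:R :> R by [].
rewrite -(@ler_pXn2r _ T)// ?nnegrE ?mulr_ge0 ?exprn_ge0 ?(ltW B0)//.
apply: (@le_trans _ _ ((B * Q%:R `^ s) ^+ T * W ^+ T)).
  rewrite -exprMn lerXn2r ?nnegrE ?mulr_ge0 ?powR_ge0 ?(ltW B0)//.
  by rewrite -mulrA ler_wpM2l ?(ltW B0).
apply: (@le_trans _ _ ((B * Q%:R `^ s) ^+ T * (Cw * (k * D)%:R ^+ T.-1 * k%:R ^+ 2))).
  by rewrite ler_wpM2l ?exprn_ge0 ?mulr_ge0 ?powR_ge0 ?(ltW B0).
rewrite natrM [(k%:R * D%:R) ^+ _]exprMn.
have -> : (B * Q%:R `^ s) ^+ T * (Cw * (k%:R ^+ T.-1 * D%:R ^+ T.-1) * k%:R ^+ 2) =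
  (Cw * (B * Q%:R `^ s) ^+ T * D%:R ^+ T.-1) * (k%:R ^+ T.-1 * k%:R ^+ 2) by ring.
have -> : (k%:R ^+ 2) ^+ T = k%:R ^+ T.-1 * (k%:R ^+ T.-1 * k%:R ^+ 2) :> R.
  by rewrite -exprM -!exprD; congr (_ ^+ _); rewrite -{1}(prednK T0); lia.
by rewrite ler_wpM2r ?mulr_ge0 ?exprn_ge0.
Qed.

(** The mean of a pair is bounded by 1 if its phase has a denominator up to [Q], and by [h]
    otherwise. After multiplication by [B], the former pairs, the latter pairs and the error of the
    means contribute at most [k ^ 2] each, whence the 3. *)
Lemma frequency_mean (w : freqT d r M * freqT d r M) :
  ~~ [forall i, fdiff w i == 0] ->
  exists N0, forall N, (N0 <= N)%N ->
    B * (\sum_(n < N) cmod (fcoef (ypt n) w) ^+ 2) <= 3 * k%:R ^+ 2 * N%:R.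
Proof.
move=> hw; pose m i := fdiff w i; pose L := coef_mx e A m.
have hm : exists i, m i != 0.
  by move: hw; rewrite negb_forall => /existsP[i hi]; exists i.
pose rl := congr_rel L x.
have hsys : congruence_system rl d ((3 * d * (d * (r * M) * H)) ^ d).
  apply: congruence_system_congr => //; first by rewrite !muln_gt0 d0 r0 M0.
    exact: coef_mx_ker.
  by apply: coef_mx_bound => i; exact: absz_fdiff.
pose P j := phase e A m (x j).
pose g i j := P i - P j.
pose h := Ch * Q%:R `^ tau.
have h0 : 0 <= h by rewrite mulr_ge0 ?powR_ge0.
pose bad (i j : 'I_k) := [exists q : 'I_Q, rl q.+1 i j].
pose b i j : R := if bad i j then 1 else h.
have hmean i j : mean_le (fun n => chi (g i j).[n%:R]) (b i j).
  rewrite /b; case: ifP => hb.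
    move=> eps ep0; exists 0%N => N _.
    apply: le_trans (cmod_sum _ _ _) _.
    under eq_bigr do rewrite cmod_chi.
    by rewrite sumr_const card_ord ler_peMl//; lra.
  apply: hCh => //.
    by rewrite (leq_trans (size_polyD _ _))// size_polyN geq_max !size_poly.
  move=> q /andP[q0 qQ] hint; move/negbT/negP: hb; apply; rewrite /bad; apply/existsP.
  have qQ' : (q.-1 < Q)%N by rewrite prednK.
  exists (Ordinal qQ'); rewrite /= prednK//; apply/forallP => l.
  have [->|l0] := eqVneq l ord0; first by rewrite !lform_coef_mx0// subrr mulr0.
  have := hint l; rewrite lt0n => /(_ l0).
  by rewrite coefB !coef_poly ltn_ord inord_val.
have hb1 : \sum_i \sum_j b i j <= (\sum_(q < Q) pairs rl q.+1)%N%:R + k%:R ^+ 2 * h.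
  have -> : (\sum_(q < Q) pairs rl q.+1)%N%:R = \sum_i \sum_j (\sum_(q < Q) rl q.+1 i j)%N%:R :> R.
    rewrite /pairs exchange_big /= natr_sum; apply: eq_bigr => i _.
    by rewrite exchange_big /= natr_sum.
  have -> : k%:R ^+ 2 * h = \sum_(i < k) \sum_(j < k) h.
    by rewrite !sumr_const !card_ord -mulrnA -[RHS]mulr_natl natrM expr2.
  rewrite -big_split /=; apply: ler_sum => i _; rewrite -big_split /=; apply: ler_sum => j _.
  rewrite /b; case: ifP => [/existsP[q hq]|_]; last by rewrite lerDr.
  by rewrite (bigD1 q)//= hq natrD -addrA lerDl addr_ge0.
have ep0 : 0 < B^-1 by rewrite invr_gt0.
have hc (w' : 'I_k * 'I_k) : exists N0, forall N, (N0 <= N)%N ->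
    cmod (\sum_(n < N) chi (g w'.1 w'.2).[n%:R]) <= (b w'.1 w'.2 + B^-1) * N%:R.
  exact: hmean.
have [F hF] := choice hc.
exists (\max_w F w)%N => N hN.
have hS n : (cmod (fcoef (ypt n) w) ^+ 2)%:C%C = \sum_i \sum_j chi (g i j).[n%:R].
  rewrite /fcoef; under eq_bigr do rewrite (phaseE hdeg).
  rewrite cmod_sqr_sum; apply: eq_bigr => i _; apply: eq_bigr => j _.
  by rewrite -chiN -chiD hornerD hornerN.
have hsum : \sum_(n < N) cmod (fcoef (ypt n) w) ^+ 2 <= \sum_i \sum_j (b i j + B^-1) * N%:R.
  apply: le_trans (ler_norm _) _; rewrite -cmod_real rmorph_sum /=.
  under eq_bigr do rewrite hS.
  rewrite exchange_big /=; under eq_bigr do rewrite exchange_big /=.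
  apply: le_trans (cmod_sum _ _ _) _; apply: ler_sum => i _.
  apply: le_trans (cmod_sum _ _ _) _; apply: ler_sum => j _.
  apply: (hF (i, j)); apply: leq_trans hN; exact: leq_bigmax.
have hsum2 : \sum_(i < k) \sum_(j < k) (b i j + B^-1) * N%:R =
    (\sum_i \sum_j b i j + k%:R ^+ 2 * B^-1) * N%:R.
  under eq_bigr do rewrite -mulr_suml big_split /= sumr_const card_ord.
  rewrite -mulr_suml big_split /= sumr_const card_ord -mulrnA; congr ((_ + _) * _).
  by rewrite -[LHS]mulr_natl natrM expr2.
have hp := sum_pairs_small hsys.
apply: (@le_trans _ _ (B * ((\sum_i \sum_j b i j + k%:R ^+ 2 * B^-1) * N%:R))).
  by rewrite ler_wpM2l ?(ltW B0)// -hsum2.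
rewrite mulrA ler_wpM2r//.
apply: (@le_trans _ _ (B * ((\sum_(q < Q) pairs rl q.+1)%N%:R + k%:R ^+ 2 * h + k%:R ^+ 2 * B^-1))).
  by rewrite ler_wpM2l ?(ltW B0)// lerD2r.
have hQ' : h * B <= 1 by exact: hQ.
have k2 : 0 <= k%:R ^+ 2 :> R by rewrite exprn_ge0.
have -> : B * ((\sum_(q < Q) pairs rl q.+1)%N%:R + k%:R ^+ 2 * h + k%:R ^+ 2 * B^-1) =
  B * (\sum_(q < Q) pairs rl q.+1)%N%:R + k%:R ^+ 2 * (h * B) + k%:R ^+ 2 * (B * B^-1) by ring.
rewrite mulfV ?gt_eqF// mulr1.
have : k%:R ^+ 2 * (h * B) <= k%:R ^+ 2 * 1 by rewrite ler_wpM2l.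
by lra.
Qed.

(** Otherwise the kernel bound holds for every [n > 0]; summed over [n] and compared with
    [frequency_mean] for at most [#|freqT| ^ 2] pairs [w], it gives [8 N <= 3 (N + 1)], false for
    [N >= 1]. *)
Lemma exists_dense (eps : R) (X : set 'cV[R]_d) : 0 < eps -> (forall j, X (x j)) ->
  B = 32 * (r * M)%:R ^+ (2 * d) ->
  2 * (r * M)%:R ^+ d * (d%:R / eps) ^+ (2 * r) <= M%:R ^+ (2 * r) ->
  exists n, (0 < n)%N /\ eps_dense_image eps (poly_mx_eval A n) X.
Proof.
move=> ep0 hX hB hM; apply: contrapT => hno.
have hnd n : (0 < n)%N -> ~ eps_dense_image eps (poly_mx_eval A n) X.
  by move=> n0 hd; apply: hno; exists n.
pose Pw (w : freqT d r M * freqT d r M) := [forall i, fdiff w i == 0].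
have D1 : 0 < d%:R :> R by rewrite ltr0n.
have hlow n : (0 < n)%N -> 8 * #|freqT d r M|%:R ^+ 2 * k%:R ^+ 2 <=
   B * \sum_(w | ~~ Pw w) cmod (fcoef (ypt n) w) ^+ 2.
  move=> n0; have [zeta hz] := not_dense_far d0 ep0 (hnd n n0).
  have hfar j : exists i, forall z : int, eps / d%:R <= `|zeta i 0 - ypt n j i - z%:~R|.
    exact: hz (hX j).
  have := @fcoef_large R d r M k r0 M0 (ypt n) (fun i => zeta i 0) (eps / d%:R) d0.
  rewrite divr_gt0// invf_div => /(_ isT hfar hM); rewrite hB.
  set S := \sum_(w | _) _; set c := _ ^+ (2 * d); set v := _ ^+ 2 * _ ^+ 2 => h.
  by rewrite -[leLHS]mulrA -/v; lra.
have hc (w : freqT d r M * freqT d r M) : exists N0, forall N, ~~ Pw w -> (N0 <= N)%N ->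
    B * (\sum_(n < N) cmod (fcoef (ypt n) w) ^+ 2) <= 3 * k%:R ^+ 2 * N%:R.
  have [hw|hw] := boolP (Pw w); first by exists 0%N.
  by have [N0 hN0] := frequency_mean hw; exists N0 => N _; exact: hN0.
have [F hF] := choice hc.
pose N := (\max_w F w).+1%N.
pose G n := B * \sum_(w | ~~ Pw w) cmod (fcoef (ypt n) w) ^+ 2.
have hG0 n : 0 <= G n.
  by rewrite mulr_ge0 ?(ltW B0)//; apply: sumr_ge0 => w _; rewrite exprn_ge0 ?cmod_ge0.
have up : \sum_(n < N.+1) G n <= #|freqT d r M|%:R ^+ 2 * (3 * k%:R ^+ 2 * N.+1%:R).
  rewrite /G -mulr_sumr exchange_big /= mulr_sumr.
  apply: (@le_trans _ _ (\sum_(w | ~~ Pw w) 3 * k%:R ^+ 2 * N.+1%:R)).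
    apply: ler_sum => w hw; apply: hF => //.
    by apply: leq_trans (leq_bigmax w) _; rewrite /N; lia.
  apply: (@le_trans _ _ (\sum_(w : freqT d r M * freqT d r M) 3 * k%:R ^+ 2 * N.+1%:R)).
    rewrite [leLHS]big_mkcond /=; apply: ler_sum => w _; case: (~~ Pw w) => //=.
  by rewrite sumr_const card_prod -[leLHS]mulr_natl natrM expr2.
(* The index [n = 0] is not admissible and has no lower bound, so its nonnegative term is
   dropped. *)
have lo : 8 * #|freqT d r M|%:R ^+ 2 * k%:R ^+ 2 * N%:R <= \sum_(n < N.+1) G n.
  rewrite big_ord_recl /=; apply: (@le_trans _ _ (\sum_(n < N) G n.+1)); last first.
    by rewrite lerDr; exact: hG0.
  apply: (@le_trans _ _ (\sum_(n < N) 8 * #|freqT d r M|%:R ^+ 2 * k%:R ^+ 2)).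
    by rewrite sumr_const card_ord mulr_natr.
  by apply: ler_sum => n _; exact: hlow.
have := le_trans lo up.
have T0 : 0 < #|freqT d r M|%:R ^+ 2 :> R.
  by rewrite exprn_gt0// card_freqT ltr0n expn_gt0 M0.
have K0 : 0 < k%:R ^+ 2 :> R by rewrite exprn_gt0// ltr0n.
have N1 : 1 <= N%:R :> R by rewrite ler1n.
rewrite -[N.+1%:R]natr1 leNgt => /negP; apply.
set a := _ ^+ 2 in T0 *; set c := k%:R ^+ 2 in K0 *.
have ac : 0 < a * c by rewrite mulr_gt0.
have -> : a * (3 * c * (N%:R + 1)) = (a * c) * (3 * (N%:R + 1)) by ring.
have -> : 8 * a * c * N%:R = (a * c) * (8 * N%:R) by ring.
by rewrite ltr_pM2l//; lra.
Qed.

End Main.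

Lemma card_le_inj (T : Type) (k : nat) (X : set T) : (`I_k #<= X)%card ->
  exists2 x : 'I_k -> T, injective x & forall j, X (x j).
Proof.
case/card_leP=> f.
have hk (j : 'I_k) : (j : nat) \in `I_k by rewrite inE /=.
exists (fun j => val (f (SigSub (hk j)))) => [i j /val_inj hij|j]; last exact: set_valP.
by have /(congr1 val)/= := inj (mem_set I) (mem_set I) hij; exact: val_inj.
Qed.

(** Testing nondegeneracy on a basis vector gives a nonzero diagonal entry; vanishing at 0, it is
    not constant. *)
Lemma poly_mx_height_gt0 d (A : 'M[{poly int}]_d) : (0 < d)%N ->
  (forall r s, (A r s).[0] = 0) ->
  (forall u v : 'cV[int]_d, u != 0 -> v != 0 -> poly_mx_form A u v != 0) ->
  (0 < poly_mx_height A)%N /\ (0 < poly_mx_deg A)%N.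
Proof.
move=> d0 A0 hA; pose i0 := Ordinal d0.
pose u : 'cV[int]_d := \col_i (i == i0)%:R.
have u0 : u != 0.
  apply/eqP => /colP/(_ i0); rewrite !mxE eqxx => /eqP; by rewrite oner_eq0.
have h := hA u u u0 u0.
have hA1 : A i0 i0 != 0.
  apply: contraNneq h => h0; rewrite /poly_mx_form mxE big1// => s _.
  rewrite !mxE; have [->|hs] := eqVneq s i0; last by rewrite mulr0.
  rewrite (bigD1 i0)//= !mxE eqxx h0 mulr0 add0r big1 ?mul0r// => r /negPf hr.
  by rewrite !mxE hr mul0r.
have hs1 : (1 < size (A i0 i0))%N.
  rewrite ltnNge; apply: contra hA1 => /size1_polyC hc.
  by have := A0 i0 i0; rewrite hc hornerC => ->.
split.
- have := coef_poly_mx A i0 i0 (size (A i0 i0)).-1; apply: leq_trans.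
  by rewrite absz_gt0 -/(lead_coef _) lead_coef_eq0.
- have := size_poly_mx (erefl (poly_mx_deg A)) i0 i0; lia.
Qed.

Theorem theorem1p1 (R : realType) (d e : nat) (hd : (1 <= d)%N) :
  exists c : R, 0 < c /\
    forall delta : R, 0 < delta ->
    exists eps0 : R, 0 < eps0 /\
      forall A : 'M[{poly int}]_d,
        (forall r s : 'I_d, (A r s).[0] = 0) ->
        (forall u v : 'cV[int]_d, u != 0 -> v != 0 ->
           poly_mx_form A u v != 0) ->
        poly_mx_deg A = e ->
        forall eps : R, 0 < eps -> eps < eps0 ->
        exists k : nat, is_glasner_number A eps k /\
          k%:R <= c
            * (poly_mx_height A)%:R `^ ((3 * d%:R + 1) / 2 + delta)
            * eps `^ (- (d%:R * (2 * d%:R + 1) * e%:R)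
                      - (7 * d%:R + 1) / 2 - delta).
Proof.
exists 1; split=> // delta delta0.
(* For [e = 0] no matrix satisfies the hypotheses. *)
have [e0|e0] := posnP e.
  exists 1; split=> // A A0 hA hdeg.
  by have [_] := poly_mx_height_gt0 hd A0 hA; rewrite hdeg e0.
have [Ch [Ch0 hCh]] := mean_poly e0 (hua_loss_gt0 R hd e0) (hua_loss_lt R hd e0).
have [Cw [Cw0 hCw]] := wpairs_bound (iters R d e) (step_loss_gt0 R hd e0) hd.
have [E0 [E01 hE0]] := @parameter_choice R d e hd e0 (Num.max 1 Ch) (Num.max 1 Cw)
   (ltac:(by rewrite le_max lexx)) (ltac:(by rewrite le_max lexx)).
(* The entry [2^-1] ensures [bd >= 2], so that the integer part of [bd] is at least [bd / 2].
   Nothing here depends on [delta]. *)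
exists (Num.min 1 (Num.min E0^-1 2^-1)); split.
  by rewrite !lt_min ltr01 !invr_gt0 ltr0n andbT /=; lra.
move=> A A0 hA hdeg eps ep0; rewrite !lt_min => /and3P[ep1 epE ep2].
have [H0 _] := poly_mx_height_gt0 hd A0 hA.
set H := poly_mx_height A in H0 *.
pose E := eps^-1.
have hE : E0 <= E by rewrite /E -[leLHS]invrK lef_pV2 ?posrE ?invr_gt0 ?ltW//; lra.
have E2 : 2 <= E by rewrite /E -[leLHS]invrK lef_pV2 ?posrE ?invr_gt0 ?ltW//.
have hepsE (x : R) : eps `^ (- x) = E `^ x.
  by rewrite /E -powR_inv1 ?(ltW ep0)// -powRrM mulN1r.
pose bd := H%:R `^ ((3 * d%:R + 1) / 2) * E `^ expo R d e.
have D1 : 1 <= d%:R :> R by rewrite ler1n.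
have e1 : 1 <= e%:R :> R by rewrite ler1n.
have hexpo : 1 <= expo R d e.
  have h1 : 0 <= d%:R * (2 * d%:R + 1) * e%:R :> R by rewrite !mulr_ge0//; lra.
  by rewrite /expo; lra.
have H1 : 1 <= H%:R :> R by rewrite ler1n.
have hbd2 : 2 <= bd.
  have hE1 : 2 <= E `^ expo R d e.
    apply: (@le_trans _ _ (E `^ 1)); first by rewrite powRr1//; lra.
    by rewrite ler_powR//; lra.
  have hH1 : 1 <= H%:R `^ ((3 * d%:R + 1) / 2) :> R.
    by rewrite -[leLHS](powRr0 H%:R) ler_powR//; lra.
  rewrite /bd; set a := _ `^ _ in hH1 *; set b := _ `^ _ in hE1 *; nra.
(* One explicit admissible value yields both the existence of the least one and its upper bound. *)
pose k0 := Num.truncn bd.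
have /andP[hk1 hk2] : k0%:R <= bd < k0.+1%:R by apply: truncn_itv; lra.
have hk3 : bd <= 2 * k0%:R by rewrite -natr1 in hk2; lra.
have k00 : (0 < k0)%N by rewrite -(ltr0n R); lra.
have [M [Q [M0 Q0 hM hQ hk]]] := hE0 E H k0 hE H0 hk3.
have hgl : glasner_bound A eps k0.
  move=> X hX /card_le_inj[x xinj hXx].
  apply: (@exists_dense R d e hd e0 A A0 hA hdeg H0 k0 M Q (kpow R d e) (iters R d e)
    x (fbound R d e M) (d%:R * (1 + slack R d e)) (- e%:R^-1 + hua_loss R d e)
    (Num.max 1 Ch) (Num.max 1 Cw) k00 M0 Q0 (ltn0Sn _) _ xinj _ _ _ _ _
    hQ hk eps X ep0 hXx (erefl _) hM).
  - by rewrite /fbound mulr_gt0// exprn_gt0// ltr0n muln_gt0.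
  - by move=> j; exact: hX (hXx j).
  - by have := slack_gt0 R hd e0 => ?; rewrite mulr_ge0//; lra.
  - by rewrite le_max ler01.
  - move=> I rl D Q' hrl D0 I0; rewrite -step_lossE.
    apply: le_trans (hCw I rl D Q' hrl D0 I0) _.
    by rewrite -!mulrA ler_wpM2r ?mulr_ge0 ?exprn_ge0// le_max lexx orbT.
  - move=> g Q' hg Q'0 hq; apply: mean_le_mono (hCh g Q' hg Q'0 hq).
    by rewrite ler_wpM2r ?powR_ge0// le_max lexx orbT.
have hex : exists k, `[< glasner_bound A eps k >] by exists k0; apply/asboolP.
case: (ex_minnP hex) => k /asboolP hk' hmin.
exists k; split.
  by split=> // j hj; apply: hmin; apply/asboolP.
have kk0 : (k <= k0)%N by apply: hmin; apply/asboolP.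
rewrite mul1r.
apply: (@le_trans _ _ bd); first by apply: le_trans hk1; rewrite ler_nat.
have -> : - (d%:R * (2 * d%:R + 1) * e%:R) - (7 * d%:R + 1) / 2 - delta =
  - (expo R d e + delta) by rewrite /expo; ring.
(* Both bases are at least 1, so adding [delta] to the exponents only enlarges the right-hand
   side. *)
rewrite hepsE /bd ler_pM ?powR_ge0// ler_powR//; lra.
Qed.
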